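(* Let $R$ be an indecomposable commutative ring, $\Gamma$ a discrete group with identity $\epsilon$, and let $(\Sigma,i,q)$ with gradings $c_\Sigma:\Sigma\to\Gamma$, $c_G:G\to\Gamma$ be a $\Gamma$-graded discrete $R$-twist over an ample Hausdorff groupoid $G$. Let $A=A_R^{\mathrm{gr}}(G;\Sigma)$ and $C=A_R(G^{(0)};q^{-1}(G^{(0)}))$. Let $\Sigma_\star$ be the groupoid of ultrafilters on the inverse semigroup $N_\star(C)$ of homogeneous normalisers of $C$ in $A$, and let $\Phi:\Sigma\to\Sigma_\star$ be the map $\Phi(\sigma)=(\tilde 1_XU_{s(\sigma)})^\uparrow$ defined in the context. The following are equivalent. (a) The pair $(A,C)$ is a graded algebraic quasi-Cartan pair. (b) The twist $\Sigma_\epsilon=c_\Sigma^{-1}(\epsilon)$ over $G_\epsilon=c_G^{-1}(\epsilon)$ satisfies the local bisection hypothesis. (c) The map $\Phi$ is surjective, and in particular, it is a graded isomorphism of topological groupoids.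
   Context: **Groupoids and twists.** $s(\alpha)=\alpha^{-1}\alpha$, $r(\alpha)=\alpha\alpha^{-1}$. An open bisection is an open set $B$ with $r(B),s(B)$ open and $r|_B,s|_B$ homeomorphisms onto their images. A topological groupoid is ample if it has a basis of compact open bisections. A ring is indecomposable if its only idempotents are $0,1$. A discrete $R$-twist over an ample groupoid $G$ is a sequence $G^{(0)}\times R^\times\xrightarrow{i}\Sigma\xrightarrow{q}G$, with $R^\times$ the discrete unit group, $G^{(0)}\times R^\times$ the trivial group bundle, $\Sigma$ a topological groupoid with $\Sigma^{(0)}=i(G^{(0)}\times\{1\})$, and $i,q$ continuous groupoid homomorphisms restricting to homeomorphisms of unit spaces, such that: (DT1) $i(\{x\}\times R^\times)=q^{-1}(x)$ for $x\in G^{(0)}$, $i$ injective, $q$ surjective; (DT2) each $\alpha\in G$ has an open bisection $B_\alpha\ni\alpha$ and a continuous $P_\alpha:B_\alpha\to\Sigma$ with $q\circ P_\alpha=\mathrm{id}$ and $(\beta,t)\mapsto i(r(\beta),t)P_\alpha(\beta)$ a homeomorphism $B_\alpha\times R^\times\to q^{-1}(B_\alpha)$; (DT3) $i(r(\sigma),t)\sigma=\sigma i(s(\sigma),t)$. Write $t\cdot\sigma=i(r(\sigma),t)\sigma$ and identify $\Sigma^{(0)}$ with $G^{(0)}$. It is $\Gamma$-graded if equipped with continuous groupoid homomorphisms $c_\Sigma:\Sigma\to\Gamma$, $c_G:G\to\Gamma$ with $c_\Sigma=c_G\circ q$. Put $G_\gamma=c_G^{-1}(\gamma)$, $\Sigma_\gamma=c_\Sigma^{-1}(\gamma)$.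 Restricting $i,q$ gives a discrete $R$-twist $G^{(0)}\times R^\times\to\Sigma_\epsilon\to G_\epsilon$. **Twisted Steinberg algebras.** $A_R(G;\Sigma)$ is the set of locally constant $f:\Sigma\to R$ with $f(t\cdot\sigma)=t^{-1}f(\sigma)$ and $\mathrm{supp}_G(f):=q(\{\sigma:f(\sigma)\ne0\})$ compact, with pointwise linear operations and $(f*g)(\sigma)=\sum_{\alpha\in\mathrm{supp}_G(f),\,r(\alpha)=r(\sigma)}f(S(\alpha))g(S(\alpha)^{-1}\sigma)$ for any section $S:\mathrm{supp}_G(f)\to\mathrm{supp}(f)$ of $q$ (independent of $S$). $A_R^{\mathrm{gr}}(G;\Sigma)$ is this algebra with $\gamma$-component $\{f:\mathrm{supp}_G(f)\subseteq G_\gamma\}$. $A_R(G^{(0)};q^{-1}(G^{(0)}))$ is regarded, via extension by zero, as the subalgebra of $f$ with $\mathrm{supp}_G(f)\subseteq G^{(0)}$. For a compact open bisection $X\subseteq\Sigma$, $\tilde1_X\in A_R(G;\Sigma)$ is given by $\tilde1_X(\sigma)=t^{-1}$ if $\sigma\in t\cdot X$ with $t\in R^\times$, and $0$ otherwise. An element of $C$ is evaluated at $x\in\Sigma^{(0)}\subseteq\Sigma$ as a function on $\Sigma$. **Normalisers and pairs.** For a commutative subalgebra $C$ of an $R$-algebra $B$, $I(C)$ is its set of idempotents; $n\in B$ is a normaliser of $C$ in $B$ if there is $m\in B$ with $mnm=m$, $nmn=n$, $mCn\cup nCm\subseteq C$; $N_B(C)$ is the set of these. $I(C)$ is a set of local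 units for $B$ if for each finite $F\subseteq B$ some $e\in I(C)$ satisfies $ea=a=ae$ for $a\in F$; then $m$ is unique, written $n^\dagger$. (WT): if $e\in I(C)\setminus\{0\}$, $t\in R$, $te=0$ then $t=0$. A conditional expectation $P:B\to C$ is $R$-linear with $P|_C=\mathrm{id}_C$, $P(cbc')=cP(b)c'$; faithful if for each $b\neq0$ there is $n\in N_B(C)$ with $P(nb)\ne0$; implemented by idempotents if for each $n\in N_B(C)$ there is $e\in I(C)$ with $P(n)=ne=en$. $(B,C)$ is an algebraic quasi-Cartan pair if $C$ satisfies (WT), $I(C)$ is a set of local units for $B$, $C=\mathrm{span}_RI(C)$, $B=\mathrm{span}_RN_B(C)$, and there is a faithful conditional expectation $B\to C$ implemented by idempotents. For a $\Gamma$-graded $R$-algebra $A$ and commutative subalgebra $C\subseteq A_\epsilon$, put $N_\star(C)=\bigcup_\gamma(N_A(C)\cap A_\gamma)$; $(A,C)$ is a graded algebraic quasi-Cartan pair if $(A_\epsilon,C)$ is an algebraic quasi-Cartan pair and $N_\star(C)$ spans $A$. **Local bisection hypothesis.** A discrete $R$-twist $\Sigma\to G$ over an ample Hausdorff groupoid satisfies it if for every normaliser $n$ of $A_R(G^{(0)};q^{-1}(G^{(0)}))$ in $A_R(G;\Sigma)$, $\mathrm{supp}_G(n)$ is an open bisection of $G$. **Ultrafilter groupoid.** $N_\star(C)$ is an inverse semigroup with inverse $n\mapsto n^\dagger$ and idempotents $I(C)$; $m\le n\iff m=nm^\dagger m$. $U^\uparrow=\{m\in N_\star(C):\exists n\in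 U,\ n\le m\}$. A filter is $U\subseteq N_\star(C)\setminus\{0\}$ with $U=U^\uparrow$ and such that any $m,n\in U$ have some $p\in U$ with $p\le m,n$; an ultrafilter is a maximal filter. $\Sigma_\star$ is the set of ultrafilters, a groupoid with $U^{-1}=\{n^\dagger:n\in U\}$, $(U,V)$ composable iff $mn\ne0$ for all $m\in U,n\in V$, and $UV=\{mn\}^\uparrow$. Its topology has basis $\mathcal V_n=\{U:n\in U\}$, $n\in N_\star(C)$. Its grading is $c_{\Sigma_\star}(U)=$ the common degree of the elements of $U$. **The map $\Phi$.** For $x\in\Sigma^{(0)}$ let $U_x=\{e\in I(C):e(x)=1\}$. For $\sigma\in\Sigma$ with $\gamma=c_\Sigma(\sigma)$, choose a compact open bisection $X\subseteq\Sigma_\gamma$ containing $\sigma$ and set $\Phi(\sigma)=(\tilde1_XU_{s(\sigma)})^\uparrow=\{\tilde1_Xe:e\in U_{s(\sigma)}\}^\uparrow\in\Sigma_\star$; this does not depend on $X$. $\Phi$ is a graded isomorphism of topological groupoids if it is a groupoid isomorphism and homeomorphism with $c_{\Sigma_\star}\circ\Phi=c_\Sigma$. *)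

(* Defs.v *)
From HB Require Import structures.
From mathcomp Require Import all_boot all_algebra all_classical topology.

Set Implicit Arguments.
Unset Strict Implicit.
Unset Printing Implicit Defensive.

Import GRing.Theory.

Local Open Scope classical_set_scope.
Local Open Scope ring_scope.

(* The multiplication of a groupoid is a total function, but only its values
   on composable pairs are meaningful. *)
HB.mixin Record hasGroupoidOps G := {
  gdmul : G -> G -> G ;
  gdinv : G -> G
}.

#[short(type="preGroupoidType")]
HB.structure Definition PreGroupoid := {G of hasGroupoidOps G}.

Notation "a ** b" := (gdmul a b) (at level 40, left associativity).

Definition src {G : preGroupoidType} (a : G) : G := gdinv a ** a.
Definition rng {G : preGroupoidType} (a : G) : G := a ** gdinv a.
Definition composable {G : preGroupoidType} (a b : G) : Prop := src a = rng b.

HB.mixin Record PreGroupoid_isGroupoid G of PreGroupoid G := {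
  gdinvK : involutive (@gdinv G) ;
  rngM : forall a b : G, composable a b -> rng (a ** b) = rng a ;
  srcM : forall a b : G, composable a b -> src (a ** b) = src b ;
  gdmulA : forall a b c : G, composable a b -> composable b c ->
    a ** (b ** c) = (a ** b) ** c ;
  gdmulKl : forall a b : G, composable a b -> gdinv a ** (a ** b) = b ;
  gdmulKr : forall a b : G, composable a b -> (a ** b) ** gdinv b = a
}.

#[short(type="groupoidType")]
HB.structure Definition Groupoid :=
  {G of PreGroupoid G & PreGroupoid_isGroupoid G}.

Section GroupoidTheory.
Context {G : groupoidType}.
Implicit Types a b : G.

Definition unit_space : set G := [set x | src x = x].

Lemma src_inv a : src (gdinv a) = rng a.
Proof. by rewrite /src gdinvK. Qed.

Lemma rng_inv a : rng (gdinv a) = src a.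
Proof. by rewrite /rng gdinvK. Qed.

Lemma composableVg a : composable (gdinv a) a.
Proof. exact: src_inv. Qed.

Lemma composablegV a : composable a (gdinv a).
Proof. by rewrite /composable rng_inv. Qed.

Lemma src_src a : src (src a) = src a.
Proof. exact: srcM _ _ (composableVg a). Qed.

Lemma rng_src a : rng (src a) = src a.
Proof. by rewrite (rngM _ _ (composableVg a)) rng_inv. Qed.

Lemma src_rng a : src (rng a) = rng a.
Proof. by rewrite -src_inv src_src. Qed.

Lemma gdmul_src a : a ** src a = a.
Proof. by have := gdmulKl _ _ (composableVg a); rewrite gdinvK. Qed.

Definition srcU a : unit_space := exist _ (src a) (mem_set (src_src a)).
Definition rngU a : unit_space := exist _ (rng a) (mem_set (src_rng a)).

End GroupoidTheory.
Arguments unit_space : clear implicits.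

Definition groupoid_hom {G H : groupoidType} (f : G -> H) : Prop :=
  forall a b, composable a b ->
    composable (f a) (f b) /\ f (a ** b) = f a ** f b.

HB.mixin Record Groupoid_isTopGroupoid G of Topological G & Groupoid G := {
  gdinv_continuous : continuous (@gdinv G) ;
  gdmul_continuous : {within [set p : G * G | composable p.1 p.2],
    continuous (fun p : G * G => p.1 ** p.2)}
}.

#[short(type="topGroupoidType")]
HB.structure Definition TopGroupoid :=
  {G of Topological G & Groupoid G & Groupoid_isTopGroupoid G}.

(* f restricts to a homeomorphism from A onto B, where both sets carry the
   relative topology. *)
Definition homeomorphism_on {T U : topologicalType} (A : set T) (B : set U)
    (f : T -> U) : Prop :=
  [/\ set_bij A B f, {within A, continuous f} &
      forall O, open O -> exists2 W, open W & f @` (A `&` O) = B `&` W].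

Definition open_bisection {G : topGroupoidType} (B : set G) : Prop :=
  [/\ open B, open (rng @` B), open (src @` B),
      homeomorphism_on B (rng @` B) rng & homeomorphism_on B (src @` B) src].

Definition ample (G : topGroupoidType) : Prop :=
  exists2 F : set (set G),
    F `<=` [set B | compact B /\ open_bisection B] & basis F.

Definition indecomposable (R : pzRingType) : Prop :=
  forall e : R, e * e = e -> e = 0 \/ e = 1.

Definition unit_group (R : comUnitRingType) : Type :=
  discrete_topology {t : R | t \is a GRing.unit}.

HB.instance Definition _ (R : comUnitRingType) :=
  DiscreteTopology.on (unit_group R).

Section UnitGroup.
Context {R : comUnitRingType}.
Local Notation U := (unit_group R).

Definition uval (t : U) : R := sval t.

Lemma uval_inj : injective uval. Proof. exact: val_inj. Qed.

Definition unit_one : U := exist _ 1 (unitr1 R).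
Definition unit_mul (t u : U) : U :=
  exist _ (uval t * uval u)
    (rpredM (svalP t : _ \is a GRing.unit) (svalP u : _ \is a GRing.unit)).
Definition unit_inv (t : U) : U :=
  exist _ (uval t)^-1 (rpredVr (svalP t : _ \is a GRing.unit)).

Lemma unit_mulA : associative unit_mul.
Proof. by move=> t u v; apply: uval_inj; rewrite /= mulrA. Qed.
Lemma unit_mul1g : left_id unit_one unit_mul.
Proof. by move=> t; apply: uval_inj; rewrite /= mul1r. Qed.
Lemma unit_mulg1 : right_id unit_one unit_mul.
Proof. by move=> t; apply: uval_inj; rewrite /= mulr1. Qed.
Lemma unit_mulVg : left_inverse unit_one unit_inv unit_mul.
Proof. by move=> t; apply: uval_inj; rewrite /= mulVr//; exact: svalP t. Qed.
Lemma unit_mulgV : right_inverse unit_one unit_inv unit_mul.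
Proof. by move=> t; apply: uval_inj; rewrite /= mulrV//; exact: svalP t. Qed.

HB.instance Definition _ := isGroup.Build U
  unit_mulA unit_mul1g unit_mulg1 unit_mulVg unit_mulgV.

End UnitGroup.

(* [twi (x, t)] is i(x, t). In the fields below a unit of Sg is identified
   with its image under q in the unit space of G. *)
Record discrete_twist (R : comUnitRingType) (G Sg : topGroupoidType) :=
  DiscreteTwist {
  twi : unit_space G * unit_group R -> Sg ;
  twq : Sg -> G ;
  twi_continuous : continuous twi ;
  twi_hom : forall (x : unit_space G) (t u : unit_group R),
    composable (twi (x, t)) (twi (x, u)) /\
    twi (x, (t * u)%g) = twi (x, t) ** twi (x, u) ;
  twi_units : homeomorphism_on setT (unit_space Sg) (fun x => twi (x, 1%g)) ;
  twq_continuous : continuous twq ;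
  twq_hom : groupoid_hom twq ;
  twq_units : homeomorphism_on (unit_space Sg) (unit_space G) twq ;
  tw_exact : forall x : unit_space G,
    twi @` ([set x] `*` setT) = twq @^-1` [set \val x] ;
  twi_inj : injective twi ;
  twq_surj : set_surj setT setT twq ;
  tw_trivial : forall a : G, exists (B : set G) (P : G -> Sg),
    [/\ open_bisection B, B a, {within B, continuous P},
        (forall b, B b -> twq (P b) = b) &
        homeomorphism_on (B `*` setT) (twq @^-1` B)
          (fun p : G * unit_group R => twi (rngU p.1, p.2) ** P p.1)] ;
  tw_central : forall (s : Sg) (t : unit_group R),
    twi (rngU (twq s), t) ** s = s ** twi (srcU (twq s), t)
}.

Section Grading.
Context {G : topGroupoidType} {Gamma : groupType}.

Record grading := Grading {
  gdeg :> G -> Gamma ;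
  gdeg_continuous : continuous (gdeg : G -> discrete_topology Gamma) ;
  gdegM : forall a b, composable a b -> gdeg (a ** b) = (gdeg a * gdeg b)%g
}.

Variable c : grading.

Lemma gdeg_src a : c (src a) = 1%g.
Proof.
apply: (@mulgI _ (c a)); rewrite mulg1 -gdegM ?gdmul_src//.
by rewrite /composable rng_src.
Qed.

Lemma gdegV a : c (gdinv a) = (c a)^-1%g.
Proof.
have := gdeg_src a; rewrite /src gdegM; last exact: composableVg.
by move/eqP; rewrite mulg_eq1 => /eqP.
Qed.

Lemma open_gdeg (A : set Gamma) : open (c @^-1` A).
Proof.
have /continuousP := @gdeg_continuous c.
by apply; exact: (@discrete_open (discrete_topology Gamma)).
Qed.

(* the homogeneous component of degree 1, an open subgroupoid *)
Definition gker : Type := (c @^-1` [set 1%g] : set G).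

HB.instance Definition _ := Topological.copy gker (c @^-1` [set 1%g] : set G).
HB.instance Definition _ := SubType.copy gker (c @^-1` [set 1%g] : set G).

End Grading.
Arguments grading : clear implicits.

Section Embedding.
Context {T U : topologicalType}.

Definition embedding (j : T -> U) : Prop :=
  injective j /\
  forall O, open O <-> exists2 W, open W & O = j @^-1` W.

Lemma within_continuousP (A : set T) (f : T -> U) :
  {within A, continuous f} <->
  forall x, A x -> forall V, nbhs (f x) V -> \forall y \near x, A y -> V (f y).
Proof. by rewrite subspace_continuousP. Qed.

Lemma embedding_nbhs (j : T -> U) : embedding j ->
  forall x V, nbhs x V <-> exists2 W, nbhs (j x) W & j @^-1` W `<=` V.
Proof.
move=> [_ jo] x V; split.
  rewrite nbhsE => -[O [/jo [W oW ->] Wx] OV].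
  by exists W => //; apply: open_nbhs_nbhs.
move=> [W + WV]; rewrite nbhsE => -[W' [oW' W'x] W'W].
apply: (filterS WV); apply: (@filterS _ _ _ (j @^-1` W')).
  by move=> y; exact: W'W.
by apply: open_nbhs_nbhs; split => //; apply/jo; exists W'.
Qed.

Lemma embedding_continuous (j : T -> U) : embedding j -> continuous j.
Proof. by move=> [_ jo]; apply/continuousP => W oW; apply/jo; exists W. Qed.

End Embedding.

Lemma embedding_comp (T U V : topologicalType) (j : T -> U) (k : U -> V) :
  embedding j -> embedding k -> embedding (k \o j).
Proof.
move=> [ji jo] [ki ko]; split; first exact: inj_comp.
move=> O; split => [/jo [W /ko [W' oW' ->] ->]|[W oW ->]]; first by exists W'.
by apply/jo; exists (k @^-1` W) => //; apply/ko; exists W.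
Qed.

Lemma embedding_left (T U V : topologicalType) (j : T -> U) (k : U -> V) :
  continuous k -> embedding (k \o j) -> continuous j -> embedding j.
Proof.
move=> kc [ji jo] jc; split; first by move=> x y /(congr1 k); exact: ji.
move=> O; split => [/jo [W oW ->]|[W oW ->]]; last by move/continuousP: jc; apply.
by exists (k @^-1` W) => //; by move/continuousP: kc; apply.
Qed.

Lemma embedding_prod (T U Z : topologicalType) (j : T -> U) : embedding j ->
  embedding (fun p : T * Z => (j p.1, p.2)).
Proof.
move=> je; have [ji jo] := je; split.
  by move=> [x z] [y w] /= [/ji -> ->].
have jc : continuous (fun p : T * Z => (j p.1, p.2)).
  move=> [x z]/=; apply: cvg_pair => //=; last exact: cvg_snd.
  apply: (@cvg_comp _ _ _ (fst : T * Z -> T) j); first exact: cvg_fst.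
  exact: embedding_continuous.
move=> O; split => [oO|[W oW ->]]; last by move/continuousP: jc; apply.
exists (\bigcup_(W in [set W | open W /\
    (fun p : T * Z => (j p.1, p.2)) @^-1` W `<=` O]) W).
  by apply: bigcup_open => W [].
apply/seteqP; split => [[x z] Oxz|[x z] [W [_ WO] Wxz]]; last exact: WO.
have : nbhs (x, z) O by apply: open_nbhs_nbhs.
move=> [[P Q] /= [xP zQ] PQO].
have /embedding_nbhs-/(_ x P)[/(_ xP) [P' jxP' P'P] _] := je.
exists (P'° `*` Q°).
  split; last first.
    by move=> [y w] /= [P'y Qw]; apply: (PQO (y, w)); split => /=;
      [apply: P'P; exact: nbhs_singleton P'y|exact: nbhs_singleton].
  rewrite openE => -[y w] /= [P'y Qw]; exists (P'°, Q°) => //=.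
  by split; apply: open_nbhs_nbhs; split => //; exact: open_interior.
by [].
Qed.

Lemma embedding_homeo (T U T' U' : topologicalType) (i : T' -> T) (j : U' -> U)
    (A : set T) (B : set U) (f : T -> U) (f' : T' -> U') :
    embedding i -> embedding j ->
    (forall x, A (i x) -> j (f' x) = f (i x)) ->
    (forall x y, A x -> f x = j y -> exists x', x = i x') ->
    homeomorphism_on A B f ->
  homeomorphism_on (i @^-1` A) (j @^-1` B) f'.
Proof.
move=> ie je ff' fj [[fAB fi fs] /within_continuousP fc fo].
have [ii io] := ie; have [ji jo] := je.
split; first split.
- by move=> x /= Ax; rewrite ff'//; exact: fAB.
- move=> x y; rewrite !inE /= => Ax Ay /(congr1 j); rewrite !ff'//.
  by move/fi; rewrite !inE => /(_ Ax Ay) /ii.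
- move=> y /= /fs [x Ax fxy]; have [x' xE] := fj _ _ Ax fxy.
  subst x; exists x' => //; apply: ji; by rewrite ff'.
- apply/within_continuousP => x /= Ax V /(embedding_nbhs je)[W + WV].
  rewrite ff'// => /(fc _ Ax) AW; apply/(embedding_nbhs ie).
  by eexists; first exact: AW; move=> y /= h Ay; apply: WV; rewrite /= ff'//; exact: h.
- move=> O /io [O' oO' ->]; have [W oW fW] := fo _ oO'.
  exists (j @^-1` W); first by apply/jo; exists W.
  apply/seteqP; split => [_ [x [/= Ax Ox] <-]|y [/= By Wy]].
    have : (f @` (A `&` O')) (f (i x)) by exists (i x).
    by rewrite fW -ff'// => -[].
  have : (f @` (A `&` O')) (j y) by rewrite fW.
  move=> [x [Ax Ox] fxy]; have [x' xE] := fj _ _ Ax fxy.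
  by subst x; exists x' => //; apply: ji; rewrite ff'.
Qed.

Section DegreeOneGroupoid.
Context {G : topGroupoidType} {Gamma : groupType} (c : grading G Gamma).
Local Notation K := (gker c).
Implicit Types x y : K.

Lemma gkerP x : c (\val x) = 1%g.
Proof. exact: set_mem (valP x). Qed.

Lemma embedding_gker : embedding (\val : K -> G).
Proof.
split; first exact: val_inj.
by move=> O; split => [[W oW <-]|[W oW ->]]; exists W.
Qed.

Definition gker_mul x y : K := insubd x (\val x ** \val y).
Definition gker_inv x : K := insubd x (gdinv (\val x)).

HB.instance Definition _ := hasGroupoidOps.Build K gker_mul gker_inv.

Lemma val_gdmul x y : composable (\val x) (\val y) ->
  \val (x ** y) = \val x ** \val y.
Proof.
move=> xy; apply: insubdK; apply/mem_set => /=.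
by rewrite gdegM// !gkerP mulg1.
Qed.

Lemma val_gdinv x : \val (gdinv x) = gdinv (\val x).
Proof. by apply: insubdK; apply/mem_set; rewrite /= gdegV gkerP invg1. Qed.

Lemma val_src x : \val (src x) = src (\val x).
Proof.
by rewrite {1}/src val_gdmul val_gdinv//; exact: composableVg.
Qed.

Lemma val_rng x : \val (rng x) = rng (\val x).
Proof.
by rewrite {1}/rng val_gdmul val_gdinv//; exact: composablegV.
Qed.

Lemma val_composable x y : composable (\val x) (\val y) <-> composable x y.
Proof.
by rewrite /composable -val_src -val_rng; split => [/val_inj|->].
Qed.

Lemma gker_invK : involutive (@gdinv K).
Proof. by move=> x; apply: val_inj; rewrite !val_gdinv gdinvK. Qed.

Lemma gker_rngM x y : composable x y -> rng (x ** y) = rng x.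
Proof.
move=> /val_composable xy; apply: val_inj.
by rewrite !val_rng val_gdmul// rngM.
Qed.

Lemma gker_srcM x y : composable x y -> src (x ** y) = src y.
Proof.
move=> /val_composable xy; apply: val_inj.
by rewrite !val_src val_gdmul// srcM.
Qed.

Lemma gker_mulA x y z : composable x y -> composable y z ->
  x ** (y ** z) = (x ** y) ** z.
Proof.
move=> /val_composable xy /val_composable yz; apply: val_inj.
have xyz : composable (\val x) (\val y ** \val z) by rewrite /composable rngM.
have xyz' : composable (\val x ** \val y) (\val z) by rewrite /composable srcM.
by rewrite !val_gdmul ?gdmulA// val_gdmul.
Qed.

Lemma gker_mulKl x y : composable x y -> gdinv x ** (x ** y) = y.
Proof.
move=> /val_composable xy; apply: val_inj.
have xxy : composable (gdinv (\val x)) (\val x ** \val y).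
  by rewrite /composable src_inv rngM.
by rewrite val_gdmul val_gdinv val_gdmul// gdmulKl.
Qed.

Lemma gker_mulKr x y : composable x y -> (x ** y) ** gdinv y = x.
Proof.
move=> /val_composable xy; apply: val_inj.
have xyy : composable (\val x ** \val y) (gdinv (\val y)).
  by rewrite /composable rng_inv srcM.
by rewrite val_gdmul val_gdinv val_gdmul// gdmulKr.
Qed.

HB.instance Definition _ := PreGroupoid_isGroupoid.Build K
  gker_invK gker_rngM gker_srcM gker_mulA gker_mulKl gker_mulKr.

Lemma gker_inv_continuous : continuous (@gdinv K).
Proof.
apply: continuous_comp_initial.
rewrite (_ : _ \o _ = @gdinv G \o \val); last first.
  by apply/funext => x; exact: val_gdinv.
move=> x; apply: continuous_comp; last exact: gdinv_continuous.
exact: (embedding_continuous embedding_gker).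
Qed.

Lemma gker_mul_continuous : {within [set p : K * K | composable p.1 p.2],
  continuous (fun p : K * K => p.1 ** p.2)}.
Proof.
apply/within_continuousP => -[x y] /= xy V /(embedding_nbhs embedding_gker).
move=> [W + WV]; move/val_composable : xy => xy; rewrite val_gdmul// => nW.
have /within_continuousP := @gdmul_continuous G.
move=> /(_ (\val x, \val y) xy _ nW).
have vc := embedding_continuous embedding_gker.
have : (fun p : K * K => (\val p.1, \val p.2)) @ nbhs (x, y) -->
    (\val x, \val y).
  apply: cvg_pair => /=.
    apply: (@cvg_comp _ _ _ (fst : K * K -> K) \val); last exact: vc.
    exact: cvg_fst.
  apply: (@cvg_comp _ _ _ (snd : K * K -> K) \val); last exact: vc.
  exact: cvg_snd.
move=> cv /cv; apply: (@filterS _ (nbhs (x, y))) => -[a b] /= + ab.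
by move/val_composable : ab => ab /(_ ab) Wab; apply: WV; rewrite /= val_gdmul.
Qed.

HB.instance Definition _ := Groupoid_isTopGroupoid.Build K
  gker_inv_continuous gker_mul_continuous.

End DegreeOneGroupoid.

Lemma embedding_set_val (T : topologicalType) (A : set T) :
  embedding (\val : A -> T).
Proof.
split; first exact: val_inj.
by move=> O; split => [[W oW <-]|[W oW ->]]; exists W.
Qed.

Lemma homeomorphism_onS (T U : topologicalType) (A O : set T) (B : set U)
    (f : T -> U) : open O -> O `<=` A ->
  homeomorphism_on A B f -> homeomorphism_on O (f @` O) f.
Proof.
move=> oO OA [[fAB fi fs] /within_continuousP fc fo].
have inj : set_inj O f.
  by move=> x y; rewrite !inE => /OA Ax /OA Ay; apply: fi; rewrite inE.
split; first by split => // x Ox; exists x.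
- apply/within_continuousP => x /OA Ax V /(fc _ Ax).
  by apply: filterS => y AV /OA.
- move=> W oW; have [W' oW' fW] := fo _ (openI oO oW).
  exists W' => //; apply/seteqP; split => [_ [x [Ox Wx] <-]|_ [[x Ox <-] W'x]].
    split; first by exists x.
    have : (f @` (A `&` (O `&` W))) (f x) by exists x => //; split => //; exact: OA.
    by rewrite fW => -[].
  have : (f @` (A `&` (O `&` W))) (f x).
    by rewrite fW; split => //; apply: fAB; exact: OA.
  move=> [y [Ay [Oy Wy]] yx]; exists y => //.
Qed.

Lemma homeomorphism_on_open (T U : topologicalType) (A O : set T) (B : set U)
    (f : T -> U) : open O -> O `<=` A -> open B ->
  homeomorphism_on A B f -> open (f @` O).
Proof.
move=> oO OA oB [_ _ /(_ _ oO)] [W oW].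
by rewrite setIidr// => ->; exact: openI.
Qed.

Lemma open_bisectionS (G : topGroupoidType) (B O : set G) :
  open O -> O `<=` B -> open_bisection B -> open_bisection O.
Proof.
move=> oO OB [oB rB sB rh sh]; split => //.
- exact: (homeomorphism_on_open oO OB rB rh).
- exact: (homeomorphism_on_open oO OB sB sh).
- exact: (homeomorphism_onS oO OB rh).
- exact: (homeomorphism_onS oO OB sh).
Qed.

Section DegreeOneUnits.
Context {G : topGroupoidType} {Gamma : groupType} (c : grading G Gamma).
Local Notation K := (gker c).

Lemma open_bisection_gker (B : set G) :
  open_bisection B -> open_bisection ((\val : K -> G) @^-1` B).
Proof.
move=> Bb; pose B1 : set G := B `&` c @^-1` [set 1%g].
have ve := embedding_gker c.
have B1B : open_bisection B1.
  apply: (open_bisectionS _ _ Bb); last by move=> x [].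
  by apply: openI; [by have [] := Bb|exact: open_gdeg].
have BE : (\val : K -> G) @^-1` B = \val @^-1` B1.
  by apply/seteqP; split => [x Bx|x []//]; split => //; exact: gkerP.
have key (f : G -> G) (f' : K -> K) : (forall x, \val (f' x) = f (\val x)) ->
    f' @` (\val @^-1` B1) = \val @^-1` (f @` B1).
  move=> ff'; apply/seteqP; split => [_ [x Bx <-]|y [x [Bx cx] xy]].
    by exists (\val x) => //; rewrite ff'.
  by exists (exist _ x (mem_set cx)) => //; apply: val_inj; rewrite ff'.
have [oB rB sB rh sh] := B1B.
have vi W : open W -> open ((\val : K -> G) @^-1` W).
  by move=> oW; apply/(proj2 ve); exists W.
rewrite BE; split; rewrite ?(key _ _ (@val_rng _ _ c)) ?(key _ _ (@val_src _ _ c)).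
- exact: vi.
- exact: vi.
- exact: vi.
- apply: (embedding_homeo ve ve _ _ rh) => [x _|x y [_ cx] _].
    exact: val_rng.
  by exists (exist _ x (mem_set cx)).
- apply: (embedding_homeo ve ve _ _ sh) => [x _|x y [_ cx] _].
    exact: val_src.
  by exists (exist _ x (mem_set cx)).
Qed.

Lemma gker_unitE (x : K) : unit_space K x <-> unit_space G (\val x).
Proof. by rewrite /unit_space /= -val_src; split => [->|/val_inj]. Qed.

Definition gker_unit (x : unit_space K) : unit_space G :=
  exist _ (\val (\val x)) (mem_set ((gker_unitE (\val x)).1 (set_mem (valP x)))).

Lemma embedding_gker_unit : embedding gker_unit.
Proof.
have e : embedding (\val \o gker_unit).
  rewrite (_ : _ \o _ = \val \o \val) //.
  exact: (embedding_comp (@embedding_set_val _ _) (embedding_gker c)).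
apply: (@embedding_left _ _ _ _ (\val : unit_space G -> G)) => //.
  exact: (embedding_continuous (@embedding_set_val _ _)).
by apply: continuous_comp_initial; exact: embedding_continuous.
Qed.

Lemma gker_unit_surj (y : unit_space G) : exists x, gker_unit x = y.
Proof.
have cy : c (\val y) = 1%g.
  by have /set_mem yE := valP y; rewrite -[X in c X]yE gdeg_src.
pose z : K := exist _ (\val y) (mem_set cy).
have zu : unit_space K z by apply/gker_unitE; exact: set_mem (valP y).
by exists (exist _ z (mem_set zu)); exact: val_inj.
Qed.

Lemma gker_unit_rngU (x : K) : gker_unit (rngU x) = rngU (\val x).
Proof. by apply: val_inj; rewrite /= val_rng. Qed.

Lemma gker_unit_srcU (x : K) : gker_unit (srcU x) = srcU (\val x).
Proof. by apply: val_inj; rewrite /= val_src. Qed.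

End DegreeOneUnits.

Lemma hom_src (G H : groupoidType) (f : G -> H) : groupoid_hom f ->
  forall a, f (src a) = src (f a).
Proof.
move=> fh a; have sa : composable a (src a) by rewrite /composable rng_src.
have [fsa fM] := fh _ _ sa; have := gdmulKl _ _ fsa.
by rewrite -fM gdmul_src.
Qed.

Lemma hom_rng (G H : groupoidType) (f : G -> H) : groupoid_hom f ->
  forall a, f (rng a) = rng (f a).
Proof.
move=> fh a; have ra : composable (rng a) a by rewrite /composable src_rng.
have [fra fM] := fh _ _ ra; have := gdmulKr _ _ fra.
rewrite -fM (_ : rng a ** a = a)//.
by have := gdmulKr _ _ (composablegV a); rewrite gdinvK.
Qed.

Record graded_twist (R : comUnitRingType) (Gamma : groupType)
    (G Sg : topGroupoidType) := GradedTwist {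
  gtw :> discrete_twist R G Sg ;
  gdegG : grading G Gamma ;
  gdegS : grading Sg Gamma ;
  gdegSE : forall s, gdegS s = gdegG (twq gtw s)
}.

Section DegreeOneTwist.
Context {R : comUnitRingType} {Gamma : groupType} {G Sg : topGroupoidType}.
Variable T : graded_twist R Gamma G Sg.
Local Notation i := (twi T).
Local Notation q := (twq T).
Local Notation G1 := (gker (gdegG T)).
Local Notation S1 := (gker (gdegS T)).
Local Notation RU := (unit_group R).

Lemma twq_twi x t : q (i (x, t)) = \val x.
Proof.
have : (i @` ([set x] `*` setT)) (i (x, t)) by exists (x, t).
by rewrite tw_exact.
Qed.

Lemma src_twi x t : src (i (x, t)) = i (x, 1%g).
Proof.
have [-> _] := twi_hom T x t 1%g.
have [[iU _ _] _ _] := twi_units T.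
by have /= <- := iU x I; rewrite rng_src.
Qed.

Lemma twi_rngU (s : Sg) : i (rngU (q s), 1%g) = rng s.
Proof.
have [[iU _ _] _ _] := twi_units T; have [[_ qi _] _ _] := twq_units T.
apply: qi; rewrite ?inE; first exact: iU.
  exact: src_rng.
by rewrite twq_twi /= (hom_rng (twq_hom T)).
Qed.

Lemma twi_srcU (s : Sg) : i (srcU (q s), 1%g) = src s.
Proof.
have [[iU _ _] _ _] := twi_units T; have [[_ qi _] _ _] := twq_units T.
apply: qi; rewrite ?inE; first exact: iU.
  exact: src_src.
by rewrite twq_twi /= (hom_src (twq_hom T)).
Qed.

Lemma composable_twi (s : Sg) t : composable (i (rngU (q s), t)) s.
Proof. by rewrite /composable src_twi twi_rngU. Qed.

Lemma composable_twir (s : Sg) t : composable s (i (srcU (q s), t)).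
Proof.
rewrite /composable -twi_srcU -(src_twi (srcU (q s)) 1%g).
by have [] := twi_hom T (srcU (q s)) 1%g t.
Qed.

Lemma gdegS_twi x t : gdegS T (i (x, t)) = 1%g.
Proof.
by rewrite gdegSE twq_twi; have /set_mem <- := valP x; rewrite gdeg_src.
Qed.

Lemma gdegG_twq (s : S1) : gdegG T (q (\val s)) = 1%g.
Proof. by rewrite -gdegSE gkerP. Qed.

Definition gker_twi (p : unit_space G1 * RU) : S1 :=
  exist _ (i (gker_unit p.1, p.2)) (mem_set (gdegS_twi (gker_unit p.1) p.2)).
Definition gker_twq (s : S1) : G1 :=
  exist _ (q (\val s)) (mem_set (gdegG_twq s)).

Let eS := embedding_gker (gdegS T).
Let eG := embedding_gker (gdegG T).
Let eU := embedding_gker_unit (gdegG T).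

Lemma gker_twi_continuous : continuous gker_twi.
Proof.
apply: continuous_comp_initial.
rewrite (_ : _ \o _ = i \o (fun p => (gker_unit p.1, p.2))) //.
move=> p; apply: continuous_comp; last exact: twi_continuous.
exact: (embedding_continuous (@embedding_prod _ _ RU _ eU)).
Qed.

Lemma gker_twq_continuous : continuous gker_twq.
Proof.
apply: continuous_comp_initial.
rewrite (_ : _ \o _ = q \o \val) //.
move=> p; apply: continuous_comp; last exact: twq_continuous.
exact: (embedding_continuous eS).
Qed.

Lemma gker_twi_hom (x : unit_space G1) (t u : RU) :
  composable (gker_twi (x, t)) (gker_twi (x, u)) /\
  gker_twi (x, (t * u)%g) = gker_twi (x, t) ** gker_twi (x, u).
Proof.
have [xtu iM] := twi_hom T (gker_unit x) t u.
split; last by apply: val_inj; rewrite val_gdmul.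
exact: (val_composable (gker_twi (x, t)) (gker_twi (x, u))).1 xtu.
Qed.

Lemma gker_twi_units :
  homeomorphism_on setT (unit_space S1) (fun x => gker_twi (x, 1%g)).
Proof.
have -> : unit_space S1 = \val @^-1` unit_space Sg.
  by apply/seteqP; split => x /gker_unitE.
apply: (embedding_homeo eU eS _ _ (twi_units T)) => // x y _ _.
by have [x' <-] := gker_unit_surj (gdegG T) x; exists x'.
Qed.

Lemma gker_twq_hom : groupoid_hom gker_twq.
Proof.
move=> a b /(val_composable a b) ab; have [qab qM] := twq_hom T ab.
split; first exact: (val_composable (gker_twq a) (gker_twq b)).1 qab.
by apply: val_inj; rewrite val_gdmul//= val_gdmul.
Qed.

Lemma gker_twq_units : homeomorphism_on (unit_space S1) (unit_space G1) gker_twq.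
Proof.
have -> : unit_space S1 = \val @^-1` unit_space Sg.
  by apply/seteqP; split => x /gker_unitE.
have -> : unit_space G1 = \val @^-1` unit_space G.
  by apply/seteqP; split => x /gker_unitE.
apply: (embedding_homeo eS eG _ _ (twq_units T)) => // x y xU _.
have cx : gdegS T x = 1%g by rewrite -xU gdeg_src.
by exists (exist _ x (mem_set cx)).
Qed.

Lemma gker_tw_exact (x : unit_space G1) :
  gker_twi @` ([set x] `*` setT) = gker_twq @^-1` [set \val x].
Proof.
apply/seteqP; split => [_ [[_ t] [/= -> _] <-]|s /= qs].
  by apply: val_inj; rewrite /= twq_twi.
have : (q @^-1` [set \val (gker_unit x)]) (\val s) by rewrite /= -qs.
rewrite -tw_exact => -[[y t] [/= -> _] its].
by exists (x, t) => //; exact: val_inj.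
Qed.

Lemma gker_twi_inj : injective gker_twi.
Proof.
move=> [x t] [y u] /(congr1 \val) /(@twi_inj _ _ _ T) [xy ->].
by congr pair; do 2 apply: val_inj.
Qed.

Lemma gker_twq_surj : set_surj setT setT gker_twq.
Proof.
move=> a _; have [s _ qs] := @twq_surj _ _ _ T (\val a) I.
have cs : gdegS T s = 1%g by rewrite gdegSE qs gkerP.
by exists (exist _ s (mem_set cs)) => //; exact: val_inj.
Qed.

Lemma gker_tw_trivial (a : G1) : exists (B : set G1) (P : G1 -> S1),
  [/\ open_bisection B, B a, {within B, continuous P},
      (forall b, B b -> gker_twq (P b) = b) &
      homeomorphism_on (B `*` setT) (gker_twq @^-1` B)
        (fun p : G1 * RU => gker_twi (rngU p.1, p.2) ** P p.1)].
Proof.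
have [s0 _ _] := gker_twq_surj (I : setT a).
have [B [P [Bb Ba Pc qP Ph]]] := tw_trivial T (\val a).
pose P1 (b : G1) : S1 := insubd s0 (P (\val b)).
have val_P1 (b : G1) : B (\val b) -> \val (P1 b) = P (\val b).
  move=> Bb'; apply: insubdK; apply/mem_set.
  by rewrite /= gdegSE qP// gkerP.
have cP b t : B b -> composable (i (rngU b, t)) (P b).
  by move=> Bb'; have := composable_twi (P b) t; rewrite qP.
exists (\val @^-1` B), P1; split => //.
- exact: open_bisection_gker.
- apply/within_continuousP => b /= Bb' V /(embedding_nbhs eS)[W + WV].
  rewrite val_P1// => nW; move/within_continuousP : Pc => /(_ _ Bb' _ nW) BW.
  apply/(embedding_nbhs eG); eexists; first exact: BW.
  by move=> y /= h By; apply: WV; rewrite /= val_P1//; exact: h.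
- by move=> b Bb'; apply: val_inj; rewrite /= val_P1// qP.
have -> : gker_twq @^-1` (\val @^-1` B) = \val @^-1` (q @^-1` B) by [].
have -> : (\val @^-1` B) `*` [set: RU] =
    (fun p : G1 * RU => (\val p.1, p.2)) @^-1` (B `*` setT) by [].
apply: (embedding_homeo (@embedding_prod _ _ RU _ eG) eS _ _ Ph).
- move=> [b t] [/= Bb' _].
  rewrite val_gdmul /= val_P1// ?gker_unit_rngU//; exact: cP.
- move=> [b t] s [/= Bb' _] bts; have cb : gdegG T b = 1%g.
    have := gkerP s; rewrite [X in gdegS T X](esym bts) gdegM; last exact: cP.
    by rewrite gdegS_twi mul1g gdegSE qP.
  by exists (exist _ b (mem_set cb), t).
Qed.

Lemma gker_tw_central (s : S1) (t : RU) :
  gker_twi (rngU (gker_twq s), t) ** s = s ** gker_twi (srcU (gker_twq s), t).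
Proof.
apply: val_inj; rewrite !val_gdmul /= ?gker_unit_rngU ?gker_unit_srcU /=.
- exact: tw_central.
- exact: composable_twir.
- exact: composable_twi.
Qed.

(* the twist G^(0) x R^* -> Sigma_1 -> G_1 obtained by restricting i and q *)
Definition gker_twist : discrete_twist R G1 S1 :=
  DiscreteTwist gker_twi_continuous gker_twi_hom gker_twi_units
    gker_twq_continuous gker_twq_hom gker_twq_units gker_tw_exact gker_twi_inj
    gker_twq_surj gker_tw_trivial gker_tw_central.

End DegreeOneTwist.

Definition linspan {R : pzRingType} {V : lmodType R} (S : set V) : set V :=
  [set v | exists n (a : 'I_n -> R) (w : 'I_n -> V),
     (forall k, S (w k)) /\ v = \sum_(k < n) a k *: w k].

(* Algebras need not be unital: an algebra is a submodule of an ambient module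
   V with a function mul : V -> V -> V that restricts to an associative
   R-bilinear multiplication on it. *)
Section Algebras.
Context {R : comUnitRingType} {V : lmodType R} (mul : V -> V -> V).
Implicit Types (B C : set V) (b c e m n : V).
Local Notation "x *' y" := (mul x y) (at level 40, left associativity).

Definition submodule B : Prop :=
  B 0 /\ forall (t : R) b c, B b -> B c -> B (t *: b + c).

Definition algebra B : Prop :=
  [/\ submodule B,
      (forall b c, B b -> B c -> B (b *' c)),
      (forall b c d, B b -> B c -> B d -> b *' (c *' d) = b *' c *' d),
      (forall (t : R) b c d, B b -> B c -> B d ->
         (t *: b + c) *' d = t *: (b *' d) + c *' d) &
      (forall (t : R) b c d, B b -> B c -> B d ->
         b *' (t *: c + d) = t *: (b *' c) + b *' d)].

Definition comm_subalgebra B C : Prop :=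
  [/\ C `<=` B, submodule C, (forall b c, C b -> C c -> C (b *' c)) &
      (forall b c, C b -> C c -> b *' c = c *' b)].

Definition idems C : set V := [set e | C e /\ e *' e = e].

Definition normaliser_by B C n m : Prop :=
  [/\ B m, m *' n *' m = m, n *' m *' n = n &
      forall c, C c -> C (m *' c *' n) /\ C (n *' c *' m)].

Definition normalisers B C : set V :=
  [set n | B n /\ exists m, normaliser_by B C n m].

(* n^dagger *)
Definition dagger B C n : V := xget 0 [set m | normaliser_by B C n m].

Definition local_units B C : Prop :=
  forall F : seq V, (forall a, a \in F -> B a) ->
    exists2 e, idems C e & forall a, a \in F -> e *' a = a /\ a *' e = a.

Definition without_torsion C : Prop :=
  forall e (t : R), idems C e -> e != 0 -> t *: e = 0 -> t = 0.

(* Only the values of P on B matter. *)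
Definition cond_expectation B C (P : V -> V) : Prop :=
  [/\ (forall b, B b -> C (P b)),
      (forall (t : R) b c, B b -> B c -> P (t *: b + c) = t *: P b + P c),
      (forall c, C c -> P c = c) &
      (forall b c d, B b -> C c -> C d -> P (c *' b *' d) = c *' P b *' d)].

Definition faithful B C (P : V -> V) : Prop :=
  forall b, B b -> b != 0 -> exists2 n, normalisers B C n & P (n *' b) != 0.

Definition implemented_by_idempotents B C (P : V -> V) : Prop :=
  forall n, normalisers B C n ->
    exists2 e, idems C e & P n = n *' e /\ P n = e *' n.

Definition quasi_Cartan_pair B C : Prop :=
  [/\ algebra B, comm_subalgebra B C &
   [/\ without_torsion C, local_units B C,
       C = linspan (idems C), B = linspan (normalisers B C) &
       exists P, [/\ cond_expectation B C P, faithful B C P &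
                     implemented_by_idempotents B C P]]].

Section Graded.
Context {Gamma : groupType}.
Variables (A : set V) (Ag : Gamma -> set V) (C : set V).

Definition graded_algebra : Prop :=
  [/\ algebra A,
      (forall g, Ag g `<=` A /\ submodule (Ag g)),
      (forall g h a b, Ag g a -> Ag h b -> Ag (g * h)%g (a *' b)),
      A = linspan (\bigcup_g Ag g) &
      (forall (s : seq Gamma) (a : Gamma -> V), uniq s ->
         (forall g, Ag g (a g)) -> \sum_(g <- s) a g = 0 ->
         forall g, g \in s -> a g = 0)].

(* the homogeneous normalisers N_*(C) *)
Definition hnormalisers : set V :=
  \bigcup_g (normalisers A C `&` Ag g).

Definition graded_quasi_Cartan_pair : Prop :=
  [/\ graded_algebra, comm_subalgebra (Ag 1%g) C,
      quasi_Cartan_pair (Ag 1%g) C & A = linspan hnormalisers].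

Local Notation N := hnormalisers.
Local Notation dag := (dagger A C).

Definition hle m n : Prop := m = n *' dag m *' m.

Definition upset (U : set V) : set V := [set m | N m /\ exists2 n, U n & hle n m].

Definition is_filter (U : set V) : Prop :=
  [/\ U `<=` N `\ 0, U !=set0, U = upset U &
      forall m n, U m -> U n -> exists2 p, U p & hle p m /\ hle p n].

Definition ultrafilters : set (set V) :=
  [set U | is_filter U /\ forall W, is_filter W -> U `<=` W -> W = U].

Definition uf_inv (U : set V) : set V := [set dag n | n in U].
Definition uf_composable (U W : set V) : Prop :=
  forall m n, U m -> W n -> m *' n <> 0.
Definition uf_mul (U W : set V) : set V := upset [set m *' n | m in U & n in W].

Definition uf_basic n : set (set V) := [set U | ultrafilters U /\ U n].
Definition uf_open (O : set (set V)) : Prop :=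
  exists2 S, S `<=` N & O = \bigcup_(n in S) uf_basic n.

Definition uf_deg (U : set V) : Gamma := xget 1%g [set g | U `<=` Ag g].

(* phi is an isomorphism of graded topological groupoids from Sg onto the
   ultrafilter groupoid, whose elements form the set [ultrafilters]. *)
Definition graded_groupoid_iso {Sg : topGroupoidType} (c : Sg -> Gamma)
    (phi : Sg -> set V) : Prop :=
  [/\ set_bij setT ultrafilters phi,
      (forall s t, composable s t <-> uf_composable (phi s) (phi t)),
      (forall s t, composable s t -> phi (s ** t) = uf_mul (phi s) (phi t)) /\
      (forall s, phi (gdinv s) = uf_inv (phi s)),
      (forall O : set Sg, open O <-> uf_open (phi @` O)) &
      (forall s, uf_deg (phi s) = c s)].

End Graded.

End Algebras.

Section TwistedSteinberg.
Context {R : comUnitRingType} {G Sg : topGroupoidType}.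
Variable T : discrete_twist R G Sg.
Local Notation i := (twi T).
Local Notation q := (twq T).
Implicit Types (f g : Sg -> R^o) (s : Sg).

Definition tact (t : unit_group R) s : Sg := i (rngU (q s), t) ** s.

Definition suppG f : set G := q @` [set s | f s != 0].

Definition steinberg : set (Sg -> R^o) :=
  [set f | [/\ (forall s, \forall u \near s, f u = f s),
               (forall t s, f (tact t s) = (uval t)^-1 * f s) &
               compact (suppG f)]].

(* A section supp_G(f) -> supp(f) of q; the default value s is irrelevant. *)
Definition supp_section f s (a : G) : Sg :=
  xget s [set u | q u = a /\ f u != 0].

Definition conv f g : Sg -> R^o := fun s =>
  \sum_(a \in [set a | suppG f a /\ rng a = rng (q s)])
    f (supp_section f s a) * g (gdinv (supp_section f s a) ** s).

(* A_R(G^(0); q^-1(G^(0))), as a subalgebra of A_R(G; Sigma) *)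
Definition steinberg_diag : set (Sg -> R^o) :=
  [set f | steinberg f /\ suppG f `<=` unit_space G].

(* t^-1 if s \in t . X, and 0 if there is no such t *)
Definition tilde1 (X : set Sg) : Sg -> R^o := fun s =>
  xget 0 [set v | exists (t : unit_group R) (u : Sg),
                    [/\ X u, s = tact t u & v = (uval t)^-1]].

Definition local_bisection_hypothesis : Prop :=
  forall n, normalisers conv steinberg steinberg_diag n ->
    open_bisection (suppG n).

End TwistedSteinberg.

Section GradedTwistedSteinberg.
Context {R : comUnitRingType} {Gamma : groupType} {G Sg : topGroupoidType}.
Variable T : graded_twist R Gamma G Sg.

Definition steinberg_gr (g : Gamma) : set (Sg -> R^o) :=
  [set f | steinberg T f /\ suppG T f `<=` gdegG T @^-1` [set g]].

Definition unit_idems (x : Sg) : set (Sg -> R^o) :=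
  [set e | idems (conv T) (steinberg_diag T) e /\ e x = 1].

(* the compact open bisection X chosen in the definition of Phi(s) *)
Definition Phi_bisection (s : Sg) : set Sg :=
  xget set0 [set X | [/\ compact X, open_bisection X,
                         X `<=` gdegS T @^-1` [set gdegS T s] & X s]].

Definition Phi (s : Sg) : set (Sg -> R^o) :=
  upset (conv T) (steinberg T) steinberg_gr (steinberg_diag T)
    [set conv T (tilde1 T (Phi_bisection s)) e | e in unit_idems (src s)].

End GradedTwistedSteinberg.

(* Main.v *)
(* The pivot is the condition that every homogeneous normaliser n of C is
   monomial: range and source are injective on supp_G(n) and the nonzero values
   of n are units. If n is nonzero at s and s' with s, s' of the same source,
   multiplying n by the indicator of a small bisection through s^-1 gives a
   normaliser of degree 1 that is nonzero at the unit r(s) and at s' s^-1. So it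
   suffices to exclude this in degree 1. The local bisection hypothesis does so;
   a conditional expectation implemented by idempotents does so too, because it
   is forced to be the restriction of functions to the unit space. Conversely,
   for monomial normalisers this restriction is implemented by idempotents.

   In N_*(C), m <= n says that n agrees with m over the sources of supp(m). If
   all normalisers are monomial, the supports of the elements of an ultrafilter
   have a common point by compactness, and the ultrafilters are exactly the sets
   {n | n(s) = 1} = Phi(s). Conversely, if Phi is surjective and n(s) <> 0, some
   ultrafilter contains all products n e with e(s(s)) = 1; it is Phi(r) with r in
   the R^*-orbit of s, which forces n to vanish on the source fibre of s outside
   this orbit and to be a unit at s. *)

Require Import Defs.
From mathcomp Require Import all_boot all_algebra all_classical topology.

Set Implicit Arguments.
Unset Strict Implicit.
Unset Printing Implicit Defensive.

Local Open Scope classical_set_scope.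

(** * Groupoids and twists *)

(** Two obstacles shape the development. The total space of the twist is not known to be Hausdorff,
    so arguments with closed sets take place in G: supports are subsets of G, and functions are
    assembled from open sets on which q is injective and whose images in G are compact open
    bisections. Moreover, before one of the conditions is assumed, a homogeneous normaliser may be
    spread over a whole source fibre. The order on normalisers and the sets Phi(s) therefore have to
    be described through values on entire source fibres, and membership of n in Phi(s) includes the
    vanishing of n on the rest of the fibre. Indecomposability of R makes this possible: an
    idempotent of C takes only the values 0 and 1 on units, so that [conv (dag n) n] is, on units,
    the characteristic function of the sources of supp(n). Convolution identities are not proved by
    rearranging double sums. Linearity reduces them to factors whose supports are injective under
    range or source, for which the sum has at most one nonzero term. *)

Section GroupoidAlgebra.
Context {H : groupoidType}.
Implicit Types a b : H.

Lemma gdmul_rng a : rng a ** a = a.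
Proof. by have := gdmulKr _ _ (composablegV a); rewrite gdinvK. Qed.

Lemma rng_rng a : rng (rng a) = rng a.
Proof. by rewrite -{1}(src_rng a) rng_src src_rng. Qed.

Lemma gdmulVK a b : rng a = rng b -> a ** (gdinv a ** b) = b.
Proof.
move=> ab; have := @gdmulKl H (gdinv a) b; rewrite gdinvK; apply.
by rewrite /composable src_inv.
Qed.

Lemma gdmulKV a b : src a = src b -> (a ** gdinv b) ** b = a.
Proof.
move=> ab; have := @gdmulKr H a (gdinv b); rewrite gdinvK; apply.
by rewrite /composable rng_inv.
Qed.

Lemma gdmulI a b b' : src a = rng b -> src a = rng b' ->
  a ** b = a ** b' -> b = b'.
Proof. by move=> ab ab' /(congr1 (gdmul (gdinv a))); rewrite !gdmulKl. Qed.

Lemma gdmulIr a a' b : src a = rng b -> src a' = rng b ->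
  a ** b = a' ** b -> a = a'.
Proof. by move=> ab ab' /(congr1 (fun c => c ** gdinv b)); rewrite !gdmulKr. Qed.

Lemma rngVM a b : rng a = rng b -> rng (gdinv a ** b) = src a.
Proof. by move=> ab; rewrite rngM ?rng_inv// /composable src_inv. Qed.

Lemma srcVM a b : rng a = rng b -> src (gdinv a ** b) = src b.
Proof. by move=> ab; rewrite srcM// /composable src_inv. Qed.

Lemma gdinvM a b : src a = rng b -> gdinv (a ** b) = gdinv b ** gdinv a.
Proof.
move=> ab; have ba : composable (gdinv b) (gdinv a).
  by rewrite /composable src_inv rng_inv.
have bba : src b = rng (gdinv b ** gdinv a) by rewrite rngM// rng_inv.
apply: (@gdmulI (a ** b)); first by rewrite rng_inv.
  by rewrite srcM.
rewrite -[RHS]gdmulA// gdmulVK ?rng_inv//.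
by rewrite -/(rng (a ** b)) rngM.
Qed.

Lemma unit_inv_eq a : src a = a -> gdinv a = a.
Proof.
move=> aU; have ra : rng a = a by rewrite -aU rng_src.
by rewrite -[LHS]gdmul_src src_inv ra.
Qed.

Lemma unit_rng a : src a = a -> rng a = a.
Proof. by move=> aU; rewrite -aU rng_src. Qed.

Lemma unitVM a b : rng a = rng b -> src (gdinv a ** b) = gdinv a ** b -> a = b.
Proof.
move=> ab; rewrite srcVM// => u.
have sab : src a = src b by rewrite -(rngVM ab) -u rng_src.
by rewrite -[RHS](gdmulVK ab) -u -sab gdmul_src.
Qed.

Lemma unitMV a b : src a = src b -> src (a ** gdinv b) = a ** gdinv b -> a = b.
Proof.
move=> ab u; have := gdmulKV ab; rewrite -u srcM; last first.
  by rewrite /composable rng_inv.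
by rewrite src_inv gdmul_rng.
Qed.

End GroupoidAlgebra.

Section Homomorphism.
Context {H K : groupoidType} {f : H -> K} (fh : groupoid_hom f).

Lemma hom_inv a : f (gdinv a) = gdinv (f a).
Proof.
have [c fM] := fh (composableVg a).
have := gdmulKr _ _ c; rewrite -fM -/(src a) (hom_src fh) => <-.
by rewrite -{2}(gdmul_rng (gdinv (f a))) rng_inv.
Qed.

Lemma hom_mul a b : src a = rng b -> f (a ** b) = f a ** f b.
Proof. by move=> ab; have [] := fh ab. Qed.

Lemma hom_unit a : src a = a -> src (f a) = f a.
Proof. by move=> aU; rewrite -(hom_src fh) aU. Qed.

End Homomorphism.

Section TwistAlgebra.
Context {R : comUnitRingType} {G Sg : topGroupoidType}.
Variable T : discrete_twist R G Sg.
Local Notation i := (twi T).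
Local Notation q := (twq T).
Local Notation RU := (unit_group R).
Local Notation tact := (tact T).
Implicit Types (s : Sg) (t : RU).

Lemma twqK x t : q (i (x, t)) = \val x.
Proof.
have : (i @` ([set x] `*` setT)) (i (x, t)) by exists (x, t).
by rewrite tw_exact.
Qed.

Lemma twq_unit_inj s s' : src s = s -> src s' = s' -> q s = q s' -> s = s'.
Proof.
have [[_ qi _] _ _] := twq_units T.
by move=> su s'u; apply: qi; rewrite inE.
Qed.

Lemma twi1_unit x : src (i (x, 1%g)) = i (x, 1%g).
Proof. by have [[iU _ _] _ _] := twi_units T; exact: iU. Qed.

Lemma src_twiE x t : src (i (x, t)) = i (x, 1%g).
Proof.
have [-> _] := twi_hom T x t 1%g.
exact: unit_rng (twi1_unit x).
Qed.

Lemma rng_twiE x t : rng (i (x, t)) = i (x, 1%g).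
Proof. by have [<- _] := twi_hom T x 1%g t; rewrite src_twiE. Qed.

Lemma twq_src s : q (src s) = src (q s).
Proof. exact: (hom_src (twq_hom T)). Qed.

Lemma twq_rng s : q (rng s) = rng (q s).
Proof. exact: (hom_rng (twq_hom T)). Qed.

Lemma twq_inv s : q (gdinv s) = gdinv (q s).
Proof. exact: (hom_inv (twq_hom T)). Qed.

Lemma twqM s s' : src s = rng s' -> q (s ** s') = q s ** q s'.
Proof. exact: (hom_mul (twq_hom T)). Qed.

Lemma twi1_rng s : i (rngU (q s), 1%g) = rng s.
Proof.
apply: twq_unit_inj; rewrite ?src_rng ?twi1_unit//.
by rewrite twqK twq_rng.
Qed.

Lemma twi1_src s : i (srcU (q s), 1%g) = src s.
Proof.
apply: twq_unit_inj; rewrite ?src_src ?twi1_unit//.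
by rewrite twqK twq_src.
Qed.

Lemma twq_src_eq s s' : src (q s) = src (q s') <-> src s = src s'.
Proof.
split=> [e|]; last by rewrite -!twq_src => ->.
by rewrite -!twi1_src; congr (i (_, _)); apply: val_inj.
Qed.

Lemma twq_rng_eq s s' : rng (q s) = rng (q s') <-> rng s = rng s'.
Proof.
split=> [e|]; last by rewrite -!twq_rng => ->.
by rewrite -!twi1_rng; congr (i (_, _)); apply: val_inj.
Qed.

Lemma tact_comp s t : src (i (rngU (q s), t)) = rng s.
Proof. by rewrite src_twiE twi1_rng. Qed.

Lemma twq_tact t s : q (tact t s) = q s.
Proof.
by rewrite /Defs.tact twqM ?tact_comp// twqK /= gdmul_rng.
Qed.

Lemma rng_tact t s : rng (tact t s) = rng s.
Proof. by apply/twq_rng_eq; rewrite twq_tact. Qed.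

Lemma src_tact t s : src (tact t s) = src s.
Proof. by apply/twq_src_eq; rewrite twq_tact. Qed.

Lemma tact1 s : tact 1%g s = s.
Proof. by rewrite /Defs.tact twi1_rng gdmul_rng. Qed.

Lemma tactM t u s : tact (t * u)%g s = tact t (tact u s).
Proof.
rewrite /Defs.tact.
have [tu ->] := twi_hom T (rngU (q s)) t u.
rewrite -gdmulA//; last by rewrite /composable tact_comp.
congr (i (_, _) ** _); apply: val_inj.
by rewrite /= -[i _ ** s]/(tact u s) twq_tact.
Qed.

Lemma tact_inj s t u : tact t s = tact u s -> t = u.
Proof. by move=> /(gdmulIr (tact_comp s t) (tact_comp s u))/(@twi_inj _ _ _ T)[]. Qed.

Lemma tactMl t s s' : src s = rng s' -> tact t (s ** s') = tact t s ** s'.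
Proof.
move=> ss'; rewrite /Defs.tact -gdmulA//; last by rewrite /composable tact_comp.
congr (i (_, _) ** _); apply: val_inj.
by rewrite /= -!twq_rng rngM.
Qed.

(** Centrality (DT3): the scalar sits at the range of s', which is the source of s, and moves across
    s to its range. *)
Lemma tactMr t s s' : src s = rng s' -> s ** tact t s' = tact t (s ** s').
Proof.
move=> ss'; rewrite tactMl// /Defs.tact [in RHS]tw_central.
have -> : srcU (q s) = rngU (q s').
  by apply: val_inj; rewrite /= -twq_src -twq_rng ss'.
by rewrite gdmulA// /composable ?tact_comp// rng_twiE twi1_rng.
Qed.

Lemma tactV t s : gdinv (tact t s) = tact t^-1%g (gdinv s).
Proof.
have sc : src (tact t s) = rng (tact t^-1%g (gdinv s)).
  by rewrite src_tact rng_tact rng_inv.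
apply: (@gdmulI _ (tact t s)); rewrite ?rng_inv//.
rewrite -/(rng (tact t s)) tactMr; last by rewrite rng_inv src_tact.
rewrite -tactMl; last by rewrite rng_inv.
by rewrite -tactM mulVg tact1 rng_tact.
Qed.

(** [s' ** gdinv s] lies over the unit at the range of s, hence is a scalar by (DT1). The fibres of
    q are thus orbits, and an equivariant function that vanishes at one point of a fibre vanishes on
    all of it. *)
Lemma twq_eqP s s' : q s = q s' -> exists t, s' = tact t s.
Proof.
move=> qss'; have ss : src s' = src s by apply/twq_src_eq; rewrite qss'.
have : (q @^-1` [set \val (rngU (q s))]) (s' ** gdinv s).
  by rewrite /= twqM ?rng_inv// twq_inv -qss'.
rewrite -tw_exact => -[[_ t] [/= -> _]] e.
by exists t; rewrite /Defs.tact e gdmulKV.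
Qed.

End TwistAlgebra.

(** * Topology of ample groupoids and twists *)

Section Topology.
Implicit Types T U : topologicalType.

Lemma open_locally T (A : set T) :
  (forall x, A x -> exists O, [/\ open O, O x & O `<=` A]) -> open A.
Proof.
move=> h; rewrite openE => x /h [O [oO Ox OA]].
by apply: (filterS OA); exact: open_nbhs_nbhs.
Qed.

Lemma compact_subcover T (K : set T) (f : T -> set T) : compact K ->
  (forall x, K x -> open (f x)) -> (forall x, K x -> f x x) ->
  exists2 l : seq T, (forall x, x \in l -> K x) &
    forall y, K y -> exists2 x, x \in l & f x y.
Proof.
move=> cK of_ ff; apply: contrapT => nl.
pose D := [set l : seq T | forall x, x \in l -> K x].
pose F (l : seq T) := [set y | K y /\ forall x, x \in l -> ~ f x y].
have GP : ProperFilter (filter_from D F).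
  apply: filter_from_proper.
    apply: filter_from_filter; first by exists [::].
    move=> l l' Dl Dl'; exists (l ++ l').
      by move=> x; rewrite mem_cat => /orP[/Dl|/Dl'].
    by move=> y [Ky ly]; split; split=> // x xl; apply: ly; rewrite mem_cat xl ?orbT.
  move=> l Dl; apply: contrapT => nF; apply: nl; exists l => // y Ky.
  apply: contrapT => ny; apply: nF; exists y; split => // x xl fxy.
  by apply: ny; exists x.
have [|p [Kp clp]] := cK _ GP; first by exists [::] => // y [].
have [||y [[_ ny] fy]] := clp (F [:: p]) (f p).
- by exists [:: p] => // x; rewrite inE => /eqP ->.
- by apply: open_nbhs_nbhs; split; [exact: of_|exact: ff].
by apply: (ny p) => //; rewrite inE.
Qed.

Lemma eq_continuous_closed T U (f g : T -> U) : hausdorff_space U ->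
  continuous f -> continuous g -> closed [set x | f x = g x].
Proof.
rewrite open_hausdorff => hU cf cg; rewrite -openC; apply: open_locally => x /=.
move=> /eqP /hU [[A B] /= [/set_mem Ax /set_mem Bx] [oA oB /eqP AB]].
exists (f @^-1` A `&` g @^-1` B); split => //.
  by apply: openI; [move/continuousP: cf; exact|move/continuousP: cg; exact].
move=> y [/= Ay By] e; suff : (A `&` B) (f y) by rewrite AB.
by split => //; rewrite e.
Qed.

Lemma continuous_pair_cst T U (V : topologicalType) (f : T -> U) (v : V) :
  continuous f -> continuous (fun x => (f x, v)).
Proof. by move=> cf x; apply: cvg_pair; [exact: cf|exact: cvg_cst]. Qed.

Lemma homeomorphism_on_inj T U (f : T -> U) (O : set T) : continuous f ->
  (forall W, open W -> open (f @` W)) -> open O -> set_inj O f ->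
  homeomorphism_on O (f @` O) f.
Proof.
move=> cf of_ oO fi; split.
- by split=> // x Ox; exists x.
- exact: continuous_subspaceT.
move=> W oW; exists (f @` (O `&` W)); first exact/of_/openI.
by apply/seteqP; split => [_ [x [Ox Wx] <-]|_ [] //]; split; exists x.
Qed.

Lemma open_homeomorphism_on T U (f : T -> U) (A O : set T) (B : set U) :
  open B -> open O -> homeomorphism_on A B f -> open (f @` (A `&` O)).
Proof. by move=> oB oO [_ _ /(_ _ oO)][W oW ->]; exact: openI. Qed.

End Topology.

Section TopGroupoid.
Context {H : topGroupoidType}.
Implicit Types a b : H.

Lemma gdmul_near a b (V : set H) : src a = rng b -> nbhs (a ** b) V ->
  exists A B : set H, [/\ nbhs a A, nbhs b B &
    forall x y, A x -> B y -> src x = rng y -> V (x ** y)].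
Proof.
move=> ab nV.
have /within_continuousP/(_ (a, b) ab V nV) := @gdmul_continuous H.
by move=> [[A B] /= [nA nB] AB]; exists A, B; split => // x y Ax By; exact: (AB (x, y)).
Qed.

Lemma src_continuous : continuous (src : H -> H).
Proof.
move=> a V /(gdmul_near (composableVg a)) [A [B [nA nB AB]]].
have nA' : nbhs a (gdinv @^-1` A) by exact: gdinv_continuous.
apply: filterS (filterI nA' nB) => b [/= Ab Bb].
by apply: AB => //; exact: composableVg.
Qed.

Lemma rng_continuous : continuous (rng : H -> H).
Proof.
have -> : (rng : H -> H) = src \o gdinv by apply/funext => a /=; rewrite src_inv.
move=> a; apply: continuous_comp; [exact: gdinv_continuous|exact: src_continuous].
Qed.

Lemma open_bisection_inj (B : set H) : open_bisection B ->
  set_inj B src /\ set_inj B rng.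
Proof. by move=> [_ _ _ [[_ rB _] _ _] [[_ sB _] _ _]]. Qed.

Section OpenSource.
Hypothesis src_open : forall O : set H, open O -> open (src @` O).

(** Openness of the source map is a section hypothesis because the lemmas serve twice: for G, where
    it comes from ampleness, and for Sg, where it comes from the local trivialisations. *)
Lemma rng_open_src (O : set H) : open O -> open (rng @` O).
Proof.
move=> oO; have -> : rng @` O = src @` (gdinv @^-1` O).
  apply/seteqP; split => [_ [a Oa <-]|_ [a Oa <-]].
    by exists (gdinv a); rewrite /= ?gdinvK ?src_inv.
  by exists (gdinv a); rewrite ?rng_inv.
by apply: src_open; move/continuousP: (@gdinv_continuous H); apply.
Qed.

Lemma inj_open_bisection (O : set H) : open O -> set_inj O src ->
  set_inj O rng -> open_bisection O.
Proof.
move=> oO sO rO; split => //; [exact: rng_open_src|exact: src_open|..].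
- by apply: homeomorphism_on_inj => //; [exact: rng_continuous|exact: rng_open_src].
- by apply: homeomorphism_on_inj => //; exact: src_continuous.
Qed.

End OpenSource.
End TopGroupoid.

Section Ample.
Context {G : topGroupoidType} (aG : ample G) (hG : hausdorff_space G).
Implicit Types (a : G) (O K : set G).

Lemma ample_nbhs a O : open O -> O a ->
  exists B, [/\ compact B, open_bisection B, B a & B `<=` O].
Proof.
move=> oO Oa; have [F FB [_ Fb]] := aG.
have [|B [FB' Ba] BO] := Fb a O; first exact: open_nbhs_nbhs.
by have [cB bB] := FB _ FB'; exists B.
Qed.

Lemma open_src O : open O -> open (src @` O).
Proof.
move=> oO; apply: open_locally => _ [a Oa <-].
have [B [_ [_ _ oB _ _] Ba BO]] := ample_nbhs oO Oa.
by exists (src @` B); split => //; exact: image_subset.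
Qed.

Lemma open_rng O : open O -> open (rng @` O).
Proof. exact: rng_open_src open_src O. Qed.

Lemma open_unit_space : open (unit_space G).
Proof.
have -> : unit_space G = src @` setT.
  by apply/seteqP; split => [a ae|_ [a _ <-]]; [exists a|exact: src_src].
exact/open_src/openT.
Qed.

Lemma closed_unit_space : closed (unit_space G).
Proof.
by apply: eq_continuous_closed => //; [exact: src_continuous|move=> a; exact: cvg_id].
Qed.

Lemma compact_src K : compact K -> compact (src @` K).
Proof.
by apply: continuous_compact; apply: continuous_subspaceT; exact: src_continuous.
Qed.

Lemma compact_rng K : compact K -> compact (rng @` K).
Proof.
by apply: continuous_compact; apply: continuous_subspaceT; exact: rng_continuous.
Qed.

(** Composable pairs form a closed set since G is Hausdorff, so those in K x L are compact. The set
    bounds the support of a convolution product. *)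
Lemma compact_gdmul K L : compact K -> compact L ->
  compact [set c | exists a b, [/\ K a, L b, src a = rng b & c = a ** b]].
Proof.
move=> cK cL.
have cc : closed [set p : G * G | src p.1 = rng p.2].
  apply: eq_continuous_closed => // p.
    by apply: (@continuous_comp _ _ _ fst src); [exact: cvg_fst|exact: src_continuous].
  by apply: (@continuous_comp _ _ _ snd rng); [exact: cvg_snd|exact: rng_continuous].
have cKL := compact_closedI (compact_setX cK cL) cc.
have : {within K `*` L `&` [set p : G * G | src p.1 = rng p.2],
    continuous (fun p : G * G => p.1 ** p.2)}.
  by apply: continuous_subspaceW (@gdmul_continuous G) => p [].
move=> /continuous_compact /(_ cKL).
congr compact; apply/seteqP; split => [_ [[a b] [[/= Ka Lb] ab] <-]|_ [a [b [Ka Lb ab ->]]]].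
  by exists a, b.
by exists (a, b).
Qed.

(** Finitely many open bisections cover K and each meets a range fibre at most once. This makes the
    sums in a convolution finite. The induction runs over arbitrary sets S covered by the list, as
    each step removes one bisection from S. *)
Lemma finite_fibre K x : compact K -> finite_set [set a | K a /\ rng a = x].
Proof.
move=> cK.
have /choice [B Bp] : forall a, exists B : set G, [/\ open B, B a & set_inj B rng].
  move=> a; have [B [_ bB Ba _]] := ample_nbhs openT (I : setT a).
  by exists B; split => //; [case: bB|case: (open_bisection_inj bB)].
have [||l _ Kl] := compact_subcover (f := B) cK; [by move=> a; case: (Bp a)..|].
suff : forall S : set G, (forall a, S a -> rng a = x) ->
    (forall a, S a -> exists2 b, b \in l & B b a) -> finite_set S.
  by apply=> [a []//|a [/Kl + _]].
clear Kl; elim: l => [|b l IH] S Sx Sl.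
  by rewrite (_ : S = set0)//; apply/seteqP; split => // a /Sl [].
have -> : S = (S `&` B b) `|` (S `\` B b) by rewrite setUIDK.
rewrite finite_setU; split; last first.
  apply: IH => [a [/Sx]//|a [/Sl [c]]].
  by rewrite inE => /orP[/eqP ->|cl] Bc nB //; exists c.
have [[a [Sa Ba]]|nS] := pselect (exists a, S a /\ B b a); last first.
  rewrite (_ : _ `&` _ = set0)//; apply/seteqP; split => // a [Sa Ba].
  by apply: nS; exists a.
apply: (@sub_finite_set _ _ [set a]) => [c [Sc Bc] /=|]; last exact: finite_set1.
have [_ _ Bi] := Bp b; apply: Bi; rewrite ?inE//.
by rewrite !Sx.
Qed.

End Ample.

Section TwistTopology.
Context {R : comUnitRingType} {G Sg : topGroupoidType}.
Variable T : discrete_twist R G Sg.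
Hypotheses (aG : ample G) (hG : hausdorff_space G).
Local Notation i := (twi T).
Local Notation q := (twq T).
Local Notation RU := (unit_group R).
Local Notation tact := (tact T).
Implicit Types (s : Sg) (t : RU) (X O : set Sg).

Lemma twq_open_comp (W : set G) : open W -> open (q @^-1` W).
Proof. by move/continuousP : (@twq_continuous _ _ _ T); apply. Qed.

Lemma twi_rngU_continuous t : continuous (fun s => i (rngU (q s), t)).
Proof.
have rc : continuous (fun s => rngU (q s)).
  apply: continuous_comp_initial => s.
  by apply: (@continuous_comp _ _ _ q rng); [exact: twq_continuous|exact: rng_continuous].
move=> s; apply: (@continuous_comp _ _ _ (fun s => (rngU (q s), t)) i).
  exact: continuous_pair_cst.
exact: twi_continuous.
Qed.

Lemma tact_continuous t : continuous (tact t).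
Proof.
move=> s V /(gdmul_near (tact_comp T s t)) [A [B [nA nB AB]]].
have nA' : nbhs s ((fun s' => i (rngU (q s'), t)) @^-1` A).
  exact: twi_rngU_continuous.
apply: filterS (filterI nA' nB) => s' [/= As' Bs'].
by apply: AB => //; exact: tact_comp.
Qed.

(* Compact open bisections are slices; asking compactness of the image only
   makes slices stable under restriction to clopen subsets of G although Sg is
   not known to be Hausdorff here. *)
Definition slice X := [/\ open X, set_inj X q, compact (q @` X),
  set_inj (q @` X) src & set_inj (q @` X) rng].

Lemma slice_src X s s' : slice X -> X s -> X s' -> src s = src s' -> s = s'.
Proof.
move=> [_ qi _ si _] Xs Xs' /(proj2 (twq_src_eq T s s')) e.
by apply: qi; rewrite ?inE//; apply: si; rewrite ?inE//.
Qed.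

Lemma slice_rng X s s' : slice X -> X s -> X s' -> rng s = rng s' -> s = s'.
Proof.
move=> [_ qi _ _ ri] Xs Xs' /(proj2 (twq_rng_eq T s s')) e.
by apply: qi; rewrite ?inE//; apply: ri; rewrite ?inE//.
Qed.

(** In the trivialisation (DT2) around q s, the point s has a coordinate t, and c |-> h(c, t) is a
    local section through s. Its image over a small compact open bisection Y is the slice; it is
    open because the unit group is discrete, so that Y x {t} is open. *)
Lemma exists_slice O s : open O -> O s ->
  exists X, [/\ slice X, X s, X `<=` O, compact X & open (q @` X)].
Proof.
move=> oO Os.
have [B [P [bB Bqs cP qP hP]]] := tw_trivial T (q s).
have oB : open B by case: bB.
pose h (p : G * RU) := i (rngU p.1, p.2) ** P p.1.
have hE b t : B b -> h (b, t) = tact t (P b).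
  by move=> Bb; rewrite /h /Defs.tact /= qP.
have [[_ _ hs] /within_continuousP hc _] := hP.
have [[b t] [/= Bb _]] := hs s Bqs; rewrite -/(h (b, t)) => hbs.
have bE : b = q s by rewrite -hbs hE// twq_tact qP.
subst b.
have hc' c : B c -> forall V, nbhs (h (c, t)) V -> \forall y \near c, B y -> V (h (y, t)).
  move=> Bc V /(hc (c, t) (conj Bc I)) [[A C] /= [nA nC] AC].
  apply: filterS nA => y Ay By; apply: (AC (y, t)) => //.
  by split => //=; exact: nbhs_singleton nC.
pose W := [set c | B c /\ O (h (c, t))].
have oW : open W.
  rewrite openE => c [Bc Oc].
  have nB : nbhs c B by apply: open_nbhs_nbhs.
  have nO : nbhs (h (c, t)) O by apply: open_nbhs_nbhs.
  by apply: filterS (filterI nB (hc' _ Bc _ nO)) => y [By /(_ By)].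
have [|Y [cY bY Yqs YW]] := ample_nbhs aG oW (a := q s).
  by split => //; rewrite hbs.
have oY : open Y by case: bY.
pose X := (fun c => h (c, t)) @` Y.
have qX : q @` X = Y.
  apply/seteqP; split => [_ [_ [c Yc <-] <-]|c Yc].
    by have [Bc _] := YW _ Yc; rewrite hE// twq_tact qP.
  have [Bc _] := YW _ Yc; exists (h (c, t)); first by exists c.
  by rewrite hE// twq_tact qP.
exists X; rewrite qX; split => //; last 3 first.
- by exists (q s).
- by move=> _ [c /YW [_ Oc] <-].
- apply: (@continuous_compact _ _ (fun c => h (c, t))) cY.
  apply/within_continuousP => c Yc V nV; have [Bc _] := YW _ Yc.
  apply: filterS (hc' _ Bc _ nV) => y VBy Yy; apply: VBy.
  by have [] := YW _ Yy.
- split; rewrite ?qX//; last 2 first.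
  + by have [] := open_bisection_inj bY.
  + by have [] := open_bisection_inj bY.
  + have -> : X = h @` ((B `*` setT) `&` (fst @^-1` Y `&` snd @^-1` [set t])).
      apply/seteqP; split => [_ [c Yc <-]|_ [[c u] [[/= Bc _] [/= Yc ->]] <-]].
        by exists (c, t) => //; split; split => //=; have [] := YW _ Yc.
      by exists c.
    apply: open_homeomorphism_on hP; first exact: twq_open_comp.
    apply: openI.
      by apply: open_comp => // x _; exact: cvg_fst.
    apply: open_comp => [x _|]; first exact: cvg_snd.
    exact: discrete_open.
  + move=> x y; rewrite !inE => -[c Yc <-] [d Yd <-].
    have [[Bc _] [Bd _]] := (YW _ Yc, YW _ Yd).
    by rewrite !hE// !twq_tact !qP// => ->.
Qed.
Lemma twq_open O : open O -> open (q @` O).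
Proof.
move=> oO; apply: open_locally => _ [s Os <-].
have [X [_ Xs XO _ oX]] := exists_slice oO Os.
by exists (q @` X); split => //; exact: image_subset.
Qed.

(** Let X be a slice through the unit s. A point u of X over a unit and with [src u] in X equals
    [src u], since q is injective on X; these points form a neighbourhood of s. *)
Lemma open_twist_unit_space : open (unit_space Sg).
Proof.
apply: open_locally => s sU.
have [X [sX Xs _ _ _]] := exists_slice openT (I : setT s).
have [oX qi _ _ _] := sX.
exists (X `&` src @^-1` X `&` q @^-1` (unit_space G)); split.
- apply: openI; last exact/twq_open_comp/(open_unit_space aG).
  apply: openI => //.
  by apply: open_comp => // x _; exact: src_continuous.
- by split; [split=> //=; rewrite sU|exact: hom_unit (twq_hom T) _ sU].
move=> u [[Xu /= Xsu] qu]; apply: qi; rewrite ?inE//.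
by rewrite twq_src qu.
Qed.

Lemma twist_open_src O : open O -> open (src @` O).
Proof.
move=> oO; have -> : src @` O = unit_space Sg `&` q @^-1` (src @` (q @` O)).
  apply/seteqP; split => [_ [s Os <-]|u [uU [_ [s Os <-] e]]].
    split; first exact: src_src.
    by exists (q s); rewrite ?twq_src//; exists s.
  exists s => //; apply: (twq_unit_inj (T := T)) => //; first exact: src_src.
  by rewrite twq_src.
apply: openI; first exact: open_twist_unit_space.
exact/twq_open_comp/(open_src aG)/twq_open.
Qed.

Lemma slice_open_bisection X : slice X -> open_bisection X.
Proof.
move=> sX; have [oX _ _ _ _] := sX; apply: inj_open_bisection => //.
- exact: twist_open_src.
- by move=> x y; rewrite !inE; exact: slice_src.
- by move=> x y; rewrite !inE; exact: slice_rng.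
Qed.

Lemma open_bisection_slice X : compact X -> open_bisection X -> slice X.
Proof.
move=> cX bX; have [si ri] := open_bisection_inj bX.
have [oX _ _ _ _] := bX; split => //.
- by move=> x y Xx Xy qxy; apply: si => //; apply/(twq_src_eq T); rewrite qxy.
- apply: continuous_compact cX; apply: continuous_subspaceT.
  exact: twq_continuous.
- move=> _ _ /set_mem [x Xx <-] /set_mem [y Xy <-] /(twq_src_eq T) e.
  by congr q; apply: si; rewrite ?inE.
- move=> _ _ /set_mem [x Xx <-] /set_mem [y Xy <-] /(twq_rng_eq T) e.
  by congr q; apply: ri; rewrite ?inE.
Qed.

Lemma sliceI X (W : set G) : slice X -> open W -> closed W ->
  slice (X `&` q @^-1` W).
Proof.
move=> [oX qi cX si ri] oW cW.
have qE : q @` (X `&` q @^-1` W) = q @` X `&` W.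
  by apply/seteqP; split => [_ [x [Xx Wx] <-]|_ [[x Xx <-] Wx]];
    [split => //; exists x|exists x].
split; rewrite ?qE.
- by apply: openI => //; exact: twq_open_comp.
- by move=> x y; rewrite !inE => -[Xx _] [Xy _]; apply: qi; rewrite inE.
- exact: compact_closedI.
- by move=> x y; rewrite !inE => -[Xx _] [Xy _]; apply: si; rewrite inE.
- by move=> x y; rewrite !inE => -[Xx _] [Xy _]; apply: ri; rewrite inE.
Qed.

(** Points in different fibres of q are separated in G, and a slice around s meets the fibre of s
    only in s. This weak separation property of Sg is what injectivity of [Phi] rests on. *)
Lemma twq_hausdorff_inj s s' : (forall O, open O -> O s -> O s') -> s = s'.
Proof.
move=> h; have [X [[oX qi _ _ _] Xs _ _ _]] := exists_slice openT (I : setT s).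
have [qs|/eqP qs] := pselect (q s = q s').
  by apply: qi; rewrite ?inE//; exact: h.
move: hG; rewrite open_hausdorff => /(_ _ _ qs) [[A B] /= [/set_mem As /set_mem Bs']].
move=> [oA oB /eqP AB]; suff : (A `&` B) (q s') by rewrite AB.
by split => //; exact: (h (q @^-1` A) (twq_open_comp oA)).
Qed.

End TwistTopology.

(** * The convolution algebra *)

Import GRing.Theory.
Local Open Scope ring_scope.

Section Convolution.
Context {R : comUnitRingType} {G Sg : topGroupoidType}.
Variable T : discrete_twist R G Sg.
Local Notation q := (twq T).
Local Notation RU := (unit_group R).
Local Notation tact := (tact T).
Local Notation suppG := (suppG T).
Local Notation conv := (conv T).
Implicit Types (s u v : Sg) (t : RU) (f g h : Sg -> R^o).

Definition equivariant f := forall t s, f (tact t s) = (uval t)^-1 * f s.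

Lemma uval_unit t : uval t \is a GRing.unit.
Proof. exact: svalP t. Qed.

Lemma equivariant_eq0 f s u : equivariant f -> q s = q u -> f s = 0 -> f u = 0.
Proof. by move=> ef /(twq_eqP) [t ->] fs; rewrite ef fs mulr0. Qed.

Lemma suppGP f s : equivariant f -> suppG f (q s) <-> f s != 0.
Proof.
move=> ef; split; last by exists s.
by move=> [u /eqP fu e]; apply/eqP => fs; apply: fu; exact: equivariant_eq0 fs.
Qed.

(* Unlike in [conv], the lift of a does not depend on f, so that the summand is
   linear in f. *)
Definition cterm f g s (a : G) : R^o :=
  let u := xget s [set u | q u = a] in f u * g (gdinv u ** s).

Lemma conv_term_indep f g s u v : equivariant f -> equivariant g ->
  q u = q v -> rng u = rng s ->
  f u * g (gdinv u ** s) = f v * g (gdinv v ** s).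
Proof.
move=> ef eg /twq_eqP [t ->] us.
rewrite tactV -tactMl; last by rewrite src_inv.
by rewrite ef eg mulrACA /= invrK mulVr ?uval_unit// mul1r.
Qed.

Lemma ctermE f g s u : equivariant f -> equivariant g -> rng u = rng s ->
  cterm f g s (q u) = f u * g (gdinv u ** s).
Proof.
move=> ef eg us; rewrite /cterm.
have qx : q (xget s [set v | q v = q u]) = q u.
  by apply: (@xgetPex _ s [set v | q v = q u]); exists u.
apply: conv_term_indep => //.
by rewrite -us; apply/(twq_rng_eq T); rewrite qx.
Qed.

Lemma twq_lift (a : G) : exists u, q u = a.
Proof. by have [u _ <-] := @twq_surj _ _ _ T a I; exists u. Qed.

(** The index set D is left free so that several convolutions can be written over one common set. *)
Lemma convE f g s (D : set G) : equivariant f -> equivariant g ->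
  D `<=` [set a | rng a = rng (q s)] ->
  suppG f `&` [set a | rng a = rng (q s)] `<=` D ->
  conv f g s = \sum_(a \in D) cterm f g s a.
Proof.
move=> ef eg Df fD; rewrite /Defs.conv.
rewrite -(fsbig_widen [set a | suppG f a /\ rng a = rng (q s)] D)//.
  apply: eq_fsbigr => a /set_mem [[u /= fu qu] ra].
  have [qx _] : q (supp_section T f s a) = a /\ f (supp_section T f s a) != 0.
    by apply: (@xgetPex _ s [set u | q u = a /\ f u != 0]); exists u.
  rewrite -[in RHS]qx ctermE//.
  by apply/(twq_rng_eq T); rewrite qx.
move=> a [Da na]; have [u qu] := twq_lift a; subst a.
rewrite /= ctermE//; last by apply/(twq_rng_eq T); exact: Df.
suff -> : f u = 0 by rewrite mul0r.
apply/eqP; apply/negPn/negP => fu; apply: na; split; last exact: Df.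
exact/suppGP.
Qed.

Section FiniteFibre.
Variables (f : Sg -> R^o) (s : Sg).
Hypothesis ef : equivariant f.
Hypothesis ff : finite_set (suppG f `&` [set a | rng a = rng (q s)]).
Variables (g : Sg -> R^o).
Hypothesis eg : equivariant g.

Lemma conv_eq1 u : rng u = rng s ->
  (forall v, rng v = rng s -> q v <> q u -> f v * g (gdinv v ** s) = 0) ->
  conv f g s = f u * g (gdinv u ** s).
Proof.
(* The point q u is adjoined because f u may be zero. *)
move=> us h; pose D := (suppG f `&` [set a | rng a = rng (q s)]) `|` [set q u].
have Df : finite_set D by rewrite finite_setU; split => //; exact: finite_set1.
have Dr : D `<=` [set a | rng a = rng (q s)].
  by move=> a [[]//|->]; apply/(twq_rng_eq T).
rewrite (convE ef eg Dr); last by move=> a; left.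
rewrite (fsbigD1 (q u))//; last by right.
rewrite ctermE// fsbig1 => [|a]; first exact: addr0.
move=> [Da /= nau].
have [v qv] := twq_lift a; subst a.
have vs : rng v = rng s by apply/(twq_rng_eq T); exact: Dr.
by rewrite ctermE//; exact: h.
Qed.

Lemma conv_eq0 : (forall v, rng v = rng s -> f v * g (gdinv v ** s) = 0) ->
  conv f g s = 0.
Proof.
move=> h; rewrite (@conv_eq1 (rng s)) ?rng_rng// ?h ?rng_rng//.
by move=> v vs _; exact: h.
Qed.

Lemma conv_neq0 : conv f g s != 0 ->
  exists u, [/\ rng u = rng s, f u != 0 & g (gdinv u ** s) != 0].
Proof.
move=> /eqP c0; apply: contrapT => n; apply: c0; apply: conv_eq0 => v vs.
have [->|f0] := eqVneq (f v) 0; first by rewrite mul0r.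
have [->|g0] := eqVneq (g (gdinv v ** s)) 0; first by rewrite mulr0.
by exfalso; apply: n; exists v.
Qed.

End FiniteFibre.

Lemma conv_linearl f f' g s (t : R) : equivariant f -> equivariant f' ->
  equivariant (t *: f + f') -> equivariant g ->
  finite_set (suppG f `&` [set a | rng a = rng (q s)]) ->
  finite_set (suppG f' `&` [set a | rng a = rng (q s)]) ->
  conv (t *: f + f') g s = t * conv f g s + conv f' g s.
Proof.
move=> ef ef' eff eg ff ff'.
set S := [set a | _] in ff ff'; pose D := (suppG f `|` suppG f') `&` S.
have Df : finite_set D by rewrite /D setIUl finite_setU.
have DS : D `<=` S by move=> a [].
rewrite (convE eff eg DS); last first.
  move=> a [[u /= fu qu] Sa]; split => //.
  have [f0|f0] := eqVneq (f u) 0; last by left; exists u.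
  by right; exists u => //=; move: fu; rewrite /= !fctE f0 scaler0 add0r.
rewrite (convE ef eg DS); last by move=> a [fa Sa]; split => //; left.
rewrite (convE ef' eg DS); last by move=> a [fa Sa]; split => //; right.
rewrite !fsbig_finite//= mulr_sumr -big_split/=; apply: eq_bigr => a _.
by rewrite /cterm /= !fctE mulrDl -mulrA.
Qed.

Lemma conv_linearr f g g' s (t : R) : equivariant f -> equivariant g ->
  equivariant g' -> equivariant (t *: g + g') ->
  finite_set (suppG f `&` [set a | rng a = rng (q s)]) ->
  conv f (t *: g + g') s = t * conv f g s + conv f g' s.
Proof.
move=> ef eg eg' egg ff.
have DS : suppG f `&` [set a | rng a = rng (q s)] `<=` [set a | rng a = rng (q s)].
  by move=> a [].
rewrite (convE ef egg DS)// (convE ef eg DS)// (convE ef eg' DS)//.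
rewrite !fsbig_finite//= mulr_sumr -big_split/=; apply: eq_bigr => a _.
by rewrite /cterm /= !fctE mulrDr mulrCA.
Qed.

End Convolution.

Section Linspan.
Context {R : pzRingType} {V : lmodType R} {S : set V}.
Implicit Types f g : V.

Lemma linspan_sub f : S f -> linspan S f.
Proof.
by move=> Sf; exists 1%N, (fun=> 1), (fun=> f); split => //; rewrite big_ord1 scale1r.
Qed.

Lemma linspan_linear f g (r : R) :
  linspan S f -> linspan S g -> linspan S (r *: f + g).
Proof.
move=> [n [a [w [Sw ->]]]] [m [b [z [Sz ->]]]].
exists (n + m)%N, (fun k => match fintype.split k with inl i => r * a i | inr j => b j end),
  (fun k => match fintype.split k with inl i => w i | inr j => z j end).
split; first by move=> k; case: fintype.split.
rewrite big_split_ord/= scaler_sumr; congr (_ + _); apply: eq_bigr => k _.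
  by rewrite (unsplitK (inl k)) scalerA.
by rewrite (unsplitK (inr k)).
Qed.

Lemma linspan0 : linspan S 0.
Proof.
exists 0%N, (fun=> 0), (fun=> 0); split; first by case.
by rewrite big_ord0.
Qed.

Lemma linspan_ind (P : set V) : P 0 ->
  (forall (r : R) (f g : V), S f -> P g -> P (r *: f + g)) -> linspan S `<=` P.
Proof.
move=> P0 PS _ [n [a [w [Sw ->]]]]; elim: n a w Sw => [|n IH] a w Sw.
  by rewrite big_ord0.
rewrite big_ord_recl; apply: PS; first exact: Sw.
by apply: (IH (fun k => a (lift ord0 k)) (fun k => w (lift ord0 k))) => k.
Qed.

End Linspan.

(** * Locally constant equivariant functions and their decomposition into slices *)

Section Steinberg.
Context {R : comUnitRingType} {G Sg : topGroupoidType}.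
Variable T : discrete_twist R G Sg.
Hypotheses (aG : ample G) (hG : hausdorff_space G).
Local Notation q := (twq T).
Local Notation RU := (unit_group R).
Local Notation tact := (tact T).
Local Notation suppG := (suppG T).
Local Notation A := (steinberg T).
Local Notation tilde1 := (tilde1 T).
Implicit Types (s u v : Sg) (t : RU) (f g h e : Sg -> R^o) (X : set Sg).

Definition locally_constant f := forall s, \forall u \near s, f u = f s.

Lemma locally_constant_open f (P : set R) : locally_constant f -> open (f @^-1` P).
Proof.
move=> lf; rewrite openE => s /= Ps; apply: filterS (lf s) => u.
by move=> /= ->.
Qed.

Lemma open_suppG f : locally_constant f -> open (suppG f).
Proof.
move=> lf; apply: (twq_open T aG).
exact: (@locally_constant_open f [set r | r != 0] lf).
Qed.

(** By equivariance the zero set of f is a union of fibres of q, so the complement of the support is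
    the image of an open set under the open map q. *)
Lemma closed_suppG f : locally_constant f -> equivariant T f -> closed (suppG f).
Proof.
move=> lf ef; rewrite -openC.
have -> : ~` suppG f = q @` (f @^-1` [set 0]).
  apply/seteqP; split => [a na|_ [s fs <-] /(suppGP s ef)]; last by rewrite fs eqxx.
  have [s qs] := twq_lift T a; exists s => //; apply/eqP/negPn/negP => fs.
  by apply: na; exists s.
exact/(twq_open T aG)/locally_constant_open.
Qed.

Lemma steinbergI f (K : set G) : locally_constant f -> equivariant T f ->
  compact K -> suppG f `<=` K -> A f.
Proof.
move=> lf ef cK fK; split => //.
by apply: subclosed_compact cK fK; exact: closed_suppG.
Qed.

Lemma steinberg_lc f : A f -> locally_constant f. Proof. by case. Qed.
Lemma steinberg_eqv f : A f -> equivariant T f. Proof. by case. Qed.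
Lemma steinberg_compact f : A f -> compact (suppG f). Proof. by case. Qed.
Hint Resolve steinberg_lc steinberg_eqv steinberg_compact : core.

Lemma steinberg_fibre f s : A f ->
  finite_set (suppG f `&` [set a | rng a = rng (q s)]).
Proof. by move=> Af; apply: (finite_fibre aG); exact: steinberg_compact. Qed.
Hint Resolve steinberg_fibre : core.

Lemma suppG_linear f g (r : R) : suppG (r *: f + g) `<=` suppG f `|` suppG g.
Proof.
move=> _ [s /= fs <-]; have [f0|f0] := eqVneq (f s) 0; last by left; exists s.
by right; exists s => //=; move: fs; rewrite !fctE f0 scaler0 add0r.
Qed.

Lemma steinberg0 : A 0.
Proof.
apply: (@steinbergI _ set0); [| |exact: compact0|].
- by move=> s; apply: filterE.
- by move=> t s; rewrite mulr0.
- by move=> a [s /= /eqP].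
Qed.

Lemma steinberg_linear f g (r : R) : A f -> A g -> A (r *: f + g).
Proof.
move=> Af Ag; apply: (steinbergI _ _ (compactU (steinberg_compact Af) (steinberg_compact Ag))).
- move=> s; apply: filterS (filterI (steinberg_lc Af s) (steinberg_lc Ag s)).
  by move=> u [/= fu gu]; rewrite !fctE fu gu.
- move=> t s; rewrite !fctE (steinberg_eqv Af) (steinberg_eqv Ag) mulrDr.
  by congr (_ + _); rewrite /GRing.scale/= mulrCA.
- exact: suppG_linear.
Qed.

Lemma steinbergB f g : A f -> A g -> A (f - g).
Proof. by move=> Af Ag; rewrite addrC -scaleN1r; exact: steinberg_linear. Qed.

(** W is clopen in all uses: a graded component, the unit space, or what remains after some slices
    have been removed. *)
Definition restr (W : set G) f : Sg -> R^o :=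
  fun s => if pselect (W (q s)) then f s else 0.

Lemma restr_in W f s : W (q s) -> restr W f s = f s.
Proof. by rewrite /restr; case: pselect. Qed.

Lemma restr_out W f s : ~ W (q s) -> restr W f s = 0.
Proof. by rewrite /restr; case: pselect. Qed.

Lemma restr_neq0 W f s : restr W f s != 0 -> W (q s) /\ f s != 0.
Proof. by rewrite /restr; case: pselect => //= _; rewrite eqxx. Qed.

Lemma steinberg_restr W f : open W -> closed W -> A f -> A (restr W f).
Proof.
move=> oW cW Af; apply: (steinbergI _ _ (steinberg_compact Af)).
- move=> s; have [Ws|nWs] := pselect (W (q s)).
    have nW : nbhs s (q @^-1` W) by apply: open_nbhs_nbhs; split => //; exact: twq_open_comp.
    apply: filterS (filterI nW (steinberg_lc Af s)) => u [/= Wu fu].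
    by rewrite !restr_in.
  have nW : nbhs s (q @^-1` (~` W)).
    by apply: open_nbhs_nbhs; split => //; apply: twq_open_comp; rewrite openC.
  by apply: filterS nW => u /= Wu; rewrite !restr_out.
- move=> t s; rewrite /restr twq_tact; case: pselect => /= _.
    exact: steinberg_eqv.
  by rewrite mulr0.
- by move=> _ [s /= /restr_neq0[_ fs] <-]; exists s.
Qed.

Lemma tilde1_tact X t u : set_inj X q -> X u -> tilde1 X (tact t u) = (uval t)^-1.
Proof.
move=> qi Xu; rewrite /Defs.tilde1; apply: xget_unique; first by exists t, u.
move=> _ [t' [u' [Xu' e ->]]].
have uu : u = u' by apply: qi; rewrite ?inE// -(twq_tact T t u) e twq_tact.
by subst u'; move/tact_inj : e => ->.
Qed.

Lemma tilde1_in X u : set_inj X q -> X u -> tilde1 X u = 1.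
Proof. by move=> qi /(tilde1_tact 1%g qi); rewrite tact1 => ->; rewrite /= invr1. Qed.

Lemma tilde1_out X s : ~ (q @` X) (q s) -> tilde1 X s = 0.
Proof.
move=> nX; rewrite /Defs.tilde1; apply: xgetPN => r [t [u [Xu e _]]].
by apply: nX; exists u => //; rewrite e twq_tact.
Qed.

Lemma tilde1_neq0 X s : tilde1 X s != 0 -> exists t u, X u /\ s = tact t u.
Proof.
move=> h; have [[u Xu /twq_eqP [t ->]]|n] := pselect ((q @` X) (q s)).
  by exists t, u.
by move: h; rewrite tilde1_out// eqxx.
Qed.

Lemma tilde1_unit X s : set_inj X q -> tilde1 X s != 0 -> tilde1 X s \is a GRing.unit.
Proof.
by move=> qi /tilde1_neq0 [t [u [Xu ->]]]; rewrite tilde1_tact// unitrV uval_unit.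
Qed.

Lemma tilde1_eq1 X s : set_inj X q -> tilde1 X s = 1 -> X s.
Proof.
move=> qi s1; have [|t [u [Xu su]]] := @tilde1_neq0 X s; first by rewrite s1 oner_neq0.
move: s1; rewrite su tilde1_tact// => /(congr1 (@GRing.inv R)); rewrite invrK invr1 => t1.
by rewrite (_ : t = 1%g) ?tact1//; exact: uval_inj.
Qed.

Lemma suppG_tilde1 X : set_inj X q -> suppG (tilde1 X) = q @` X.
Proof.
move=> qi; apply/seteqP; split => [_ [s /= /tilde1_neq0 [t [u [Xu ->]]] <-]|_ [u Xu <-]].
  by rewrite twq_tact; exists u.
by exists u => //=; rewrite tilde1_in// oner_neq0.
Qed.

Lemma equivariant_tilde1 X : set_inj X q -> equivariant T (tilde1 X).
Proof.
move=> qi t s; have [[u Xu /twq_eqP [t' ->]]|n] := pselect ((q @` X) (q s)).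
  by rewrite -tactM !tilde1_tact//= invrM ?uval_unit// mulrC.
by rewrite !tilde1_out ?twq_tact// mulr0.
Qed.

Lemma steinberg_tilde1 X : slice T X -> A (tilde1 X).
Proof.
move=> [oX qi cX _ _]; apply: (@steinbergI _ (q @` X)) => //; last first.
- by rewrite suppG_tilde1.
- exact: equivariant_tilde1.
move=> s; have [[u Xu /twq_eqP [t ->]]|n] := pselect ((q @` X) (q s)).
  have : nbhs (tact t u) (tact t^-1%g @^-1` X).
    apply: open_nbhs_nbhs; split; last by rewrite /= -tactM mulVg tact1.
    by apply: open_comp => // x _; exact: tact_continuous.
  apply: filterS => v /= Xv.
  by rewrite -[v](tact1 T) -(mulgV t) tactM !tilde1_tact.
have : nbhs s (q @^-1` (~` (q @` X))).
  apply: open_nbhs_nbhs; split => //; apply: twq_open_comp.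
  by rewrite openC; exact: compact_closed.
by apply: filterS => v nv; rewrite !tilde1_out.
Qed.

(** Finitely many slices on which f is constant cover the compact support, and subtracting f(u)
    [tilde1] of one of them, cut down to what is left, removes it. The open set O lets the caller
    restrict the slices, for instance to one degree or to the unit space. *)
Lemma steinberg_span (S : set (Sg -> R^o)) f : A f ->
  (forall a, suppG f a -> exists O, [/\ open O, (q @` O) a &
     forall X, slice T X -> X `<=` O -> S (tilde1 X)]) -> linspan S f.
Proof.
move=> Af hS.
have /choice [X Xp] : forall a, exists X : set Sg, suppG f a ->
    [/\ slice T X, (q @` X) a, open (q @` X), forall W, open W -> closed W ->
      S (tilde1 (X `&` q @^-1` W)) &
      forall u v, X u -> X v -> f u = f v].
  move=> a; have [fa|] := pselect (suppG f a); last by exists set0.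
  have [O [oO [u Ou qu] OS]] := hS a fa.
  have [||Y [sY Yu YO _ oY]] := @exists_slice _ _ _ T aG (O `&` f @^-1` [set f u]) u.
  - by apply: openI => //; exact/locally_constant_open/steinberg_lc.
  - by [].
  exists Y => _; split => //.
  - by exists u.
  - move=> W oW cW; apply: OS; first exact: sliceI.
    by move=> v [/YO []].
  - by move=> v w /YO [_ /= ->] /YO [_ /= ->].
have [||l lf fl] := compact_subcover (f := fun a => q @` X a) (steinberg_compact Af).
- by move=> a /Xp [].
- by move=> a /Xp [].
(* W is the part of G not yet treated. It stays clopen because the image of a slice is compact and
   open in the Hausdorff space G. *)
suff : forall W, open W -> closed W ->
    (forall s, f s != 0 -> W (q s) -> exists2 a, a \in l & (q @` X a) (q s)) ->
    linspan S (restr W f).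
  move=> /(_ setT openT closedT).
  have -> : restr setT f = f by apply/funext => s; rewrite restr_in.
  by apply=> s fs _; apply: fl; exists s.
clear fl; elim: l lf => [|a l IH] lf W oW cW Wl.
  rewrite (_ : restr W f = 0); first exact: linspan0.
  apply/funext => s; have [Ws|nWs] := pselect (W (q s)); last exact: restr_out.
  rewrite restr_in//; apply/eqP/negPn/negP => fs.
  by have [] := Wl s fs Ws.
have fa : suppG f a by apply: lf; rewrite inE eqxx.
have [sX [u Xu _] oX SX fX] := Xp _ fa; have [_ qi cX _ _] := sX.
have clX : closed (q @` X a) by exact: compact_closed.
have -> : restr W f = f u *: tilde1 (X a `&` q @^-1` W) + restr (W `\` q @` X a) f.
  apply/funext => s; rewrite !fctE.
  have [Ws|nWs] := pselect (W (q s)); last first.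
    rewrite !restr_out ?tilde1_out ?addr0 ?scaler0//.
    - by move=> [v [_ Wv] e]; apply: nWs; rewrite -e.
    - by move=> [].
  have [[v Xv /twq_eqP [t e]]|nX] := pselect ((q @` X a) (q s)); last first.
    rewrite [in RHS]restr_in// restr_in// tilde1_out ?scaler0 ?add0r//.
    by move=> [v [Xv _] e]; apply: nX; exists v.
  rewrite [X in _ = _ + X]restr_out ?addr0; last first.
    by move=> [_]; apply; exists v => //; rewrite e twq_tact.
  rewrite restr_in// e tilde1_tact; last 2 first.
  - by move=> x y; rewrite !inE => -[Xx _] [Xy _]; apply: qi; rewrite inE.
  - by split => //=; rewrite -(twq_tact T t v) -e.
  by rewrite (steinberg_eqv Af) (fX u v)// /GRing.scale/= mulrC.
apply: linspan_linear; first exact/linspan_sub/SX.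
apply: IH.
- by move=> x xl; apply: lf; rewrite inE xl orbT.
- by apply: openI => //; rewrite openC.
- by apply: closedI => //; rewrite closedC.
move=> s fs [Ws nX]; have [b] := Wl s fs Ws.
by rewrite inE => /orP[/eqP ->//|bl] Xb; exists b.
Qed.

End Steinberg.

(** * Convolution is an associative bilinear product *)

Section SteinbergAlgebra.
Context {R : comUnitRingType} {G Sg : topGroupoidType}.
Variable T : discrete_twist R G Sg.
Hypotheses (aG : ample G) (hG : hausdorff_space G).
Local Notation q := (twq T).
Local Notation RU := (unit_group R).
Local Notation suppG := (suppG T).
Local Notation conv := (conv T).
Local Notation A := (steinberg T).
Local Notation tilde1 := (tilde1 T).
Implicit Types (s u v : Sg) (t : RU) (f g h e : Sg -> R^o) (X : set Sg).
Let sf f s Af := (@steinberg_fibre R G Sg T aG f s Af).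
Hint Resolve steinberg_lc steinberg_eqv steinberg_compact sf : core.

Definition src_inj f := forall u v, f u != 0 -> f v != 0 -> src u = src v -> q u = q v.
Definition rng_inj f := forall u v, f u != 0 -> f v != 0 -> rng u = rng v -> q u = q v.

Lemma steinberg_conv_eq0 f g s : A f -> A g ->
  (forall v, rng v = rng s -> f v * g (gdinv v ** s) = 0) -> conv f g s = 0.
Proof. by move=> Af Ag; apply: conv_eq0; eauto. Qed.

Lemma steinberg_conv_eq1 f g s u : A f -> A g -> rng u = rng s ->
  (forall v, rng v = rng s -> q v <> q u -> f v * g (gdinv v ** s) = 0) ->
  conv f g s = f u * g (gdinv u ** s).
Proof. by move=> Af Ag; apply: conv_eq1; eauto. Qed.

Lemma steinberg_conv_neq0 f g s : A f -> A g -> conv f g s != 0 ->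
  exists u, [/\ rng u = rng s, f u != 0 & g (gdinv u ** s) != 0].
Proof. by move=> Af Ag; apply: conv_neq0; eauto. Qed.

Lemma conv_mulr f g u v : A f -> A g -> rng_inj f -> f u != 0 -> src u = rng v ->
  conv f g (u ** v) = f u * g v.
Proof.
move=> Af Ag ri fu uv; rewrite (@steinberg_conv_eq1 _ _ _ u) ?rngM ?gdmulKl//.
move=> w wu qw; have [->|fw] := eqVneq (f w) 0; first by rewrite mul0r.
by case: qw; apply: ri.
Qed.

(** A second nonzero term, at w, would make g nonzero at w^-1 u v, which has the source of v; then
    q(w) q(v) = q(u) q(v), and q(v) cancels. *)
Lemma conv_mull f g u v : A f -> A g -> src_inj g -> g v != 0 -> src u = rng v ->
  conv f g (u ** v) = f u * g v.
Proof.
move=> Af Ag si gv uv; rewrite (@steinberg_conv_eq1 _ _ _ u) ?rngM ?gdmulKl//.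
move=> w wu qw; have [->|gw] := eqVneq (g (gdinv w ** (u ** v))) 0; first by rewrite mulr0.
have wuv : rng w = rng (u ** v) by rewrite rngM.
case: qw; have swuv : src (gdinv w ** (u ** v)) = src v by rewrite srcVM// srcM.
have e := si _ _ gw gv swuv.
have sw : src w = rng (gdinv w ** (u ** v)) by rewrite rngVM.
have : q w ** q v = q u ** q v.
  by rewrite -{1}e -(twqM T sw) gdmulVK// twqM.
apply: gdmulIr; last by rewrite -!(twq_src, twq_rng) uv.
rewrite -twq_src -twq_rng sw; have := e; move/(congr1 (@rng G)).
by rewrite -!twq_rng.
Qed.

Lemma conv_linl f f' g (r : R) : A f -> A f' -> A g ->
  conv (r *: f + f') g = r *: conv f g + conv f' g.
Proof.
move=> Af Af' Ag; apply/funext => s; apply: conv_linearl; eauto.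
by apply: steinberg_eqv; exact: steinberg_linear.
Qed.

Lemma conv_linr f g g' (r : R) : A f -> A g -> A g' ->
  conv f (r *: g + g') = r *: conv f g + conv f g'.
Proof.
move=> Af Ag Ag'; apply/funext => s; apply: conv_linearr; eauto.
by apply: steinberg_eqv; exact: steinberg_linear.
Qed.

Lemma conv0f g : A g -> conv 0 g = 0.
Proof.
move=> Ag; apply/funext => s; apply: steinberg_conv_eq0 => // [|v _].
  exact: steinberg0.
by rewrite mul0r.
Qed.

Lemma convf0 f : A f -> conv f 0 = 0.
Proof.
move=> Af; apply/funext => s; apply: steinberg_conv_eq0 => // [|v _].
  exact: steinberg0.
by rewrite mulr0.
Qed.

Lemma equivariant_conv f g : A f -> A g -> equivariant T (conv f g).
Proof.
move=> Af Ag t s.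
rewrite (@convE _ _ _ T f g _ (suppG f `&` [set a | rng a = rng (q s)])); eauto; last 2 first.
- by move=> a [_]; rewrite /= twq_tact.
- by move=> a []; rewrite /= twq_tact.
rewrite (@convE _ _ _ T f g _ (suppG f `&` [set a | rng a = rng (q s)])); eauto; last first.
  by move=> a [].
rewrite !fsbig_finite; eauto; rewrite /= mulr_sumr.
rewrite !big_seq; apply: eq_bigr => a; rewrite in_fset_set; last exact: sf.
move=> /set_mem [_ /= ra]; have [u qu] := twq_lift T a; subst a.
have us : rng u = rng s by apply/(twq_rng_eq T).
rewrite !ctermE ?rng_tact//; eauto.
by rewrite tactMr ?src_inv ?rng_inv// (steinberg_eqv Ag) mulrCA.
Qed.

Lemma suppG_conv f g : A f -> A g ->
  suppG (conv f g) `<=`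
    [set c | exists a b, [/\ suppG f a, suppG g b, src a = rng b & c = a ** b]].
Proof.
move=> Af Ag _ [s /= /(steinberg_conv_neq0 Af Ag)[u [us fu gu]] <-].
exists (q u), (q (gdinv u ** s)); split; first by exists u.
- by exists (gdinv u ** s).
- by rewrite -twq_src -twq_rng rngVM.
- by rewrite -twqM ?rngVM// gdmulVK.
Qed.

(** The product is a translate: its value at s is [g (gdinv u ** s)] for the u in X with the range
    of s, and 0 if there is none. Ranges of open sets are open, so for points near s such a u can be
    chosen near the old one, and continuity of the operations gives local constancy. If there is no
    u, the compact set of ranges of q(X) is closed in G and can be avoided. *)
Lemma steinberg_conv_tilde1 X g : slice T X -> A g -> A (conv (tilde1 X) g).
Proof.
move=> sX Ag; have AX := steinberg_tilde1 aG hG sX.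
have [oX qi cX _ _] := sX.
apply: steinbergI (suppG_conv AX Ag) => //; last 2 first.
- exact: equivariant_conv.
- by apply: compact_gdmul => //; exact: steinberg_compact.
have XE s u : X u -> rng u = rng s -> conv (tilde1 X) g s = g (gdinv u ** s).
  move=> Xu us; rewrite (@steinberg_conv_eq1 _ _ _ u)// ?tilde1_in ?mul1r//.
  move=> v vs qv; have [->|] := eqVneq (tilde1 X v) 0; first by rewrite mul0r.
  move=> /tilde1_neq0 [t [w [Xw e]]]; case: qv; rewrite e twq_tact; congr q.
  by apply: (slice_rng sX) => //; rewrite -(rng_tact T t) -e vs.
have X0 s : (forall u, X u -> rng u <> rng s) -> conv (tilde1 X) g s = 0.
  move=> h; apply: steinberg_conv_eq0 => // v vs.
  have [->|] := eqVneq (tilde1 X v) 0; first by rewrite mul0r.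
  move=> /tilde1_neq0 [t [w [Xw e]]]; exfalso; apply: (h _ Xw).
  by rewrite -(rng_tact T t) -e.
move=> s; have [[u [Xu us]]|n] := pselect (exists u, X u /\ rng u = rng s).
  have us' : src (gdinv u) = rng s by rewrite src_inv.
  have [N1 [N2 [nN1 nN2 N12]]] := gdmul_near us' (steinberg_lc Ag (gdinv u ** s)).
  pose O := X `&` gdinv @^-1` (N1°).
  have oO : open O.
    apply: openI => //; apply: open_comp; last exact: open_interior.
    by move=> x _; exact: gdinv_continuous.
  have nO : nbhs s (rng @^-1` (rng @` O)).
    apply: open_nbhs_nbhs; split; last by exists u => //; split.
    apply: open_comp => [x _|]; first exact: rng_continuous.
    exact: (rng_open_src (twist_open_src T aG) oO).
  apply: filterS (filterI nN2 nO) => v [/= N2v [w [Xw /= N1w] wv]].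
  rewrite (XE s u)// (XE v w)//; apply: N12 => //; last by rewrite src_inv.
  exact: interior_subset N1w.
have : nbhs s (q @^-1` (rng @^-1` (~` (rng @` (q @` X))))).
  apply: open_nbhs_nbhs; split.
    apply: twq_open_comp; apply: open_comp => [x _|]; first exact: rng_continuous.
    by rewrite openC; apply: compact_closed => //; exact: compact_rng.
  move=> /= [_ [u Xu <-] /(twq_rng_eq T) e]; apply: n.
  by exists u.
apply: filterS => v /= nv; rewrite !X0// => u Xu e.
  by apply: n; exists u.
by apply: nv; exists (q u); [exists u|apply/(twq_rng_eq T)].
Qed.

Lemma steinberg_gen f : A f -> linspan [set tilde1 X | X in slice T] f.
Proof.
move=> Af; apply: (@steinberg_span _ _ _ T aG hG) => // a _.
have [s <-] := twq_lift T a; exists setT; split; first exact: openT.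
  by exists s.
by move=> X sX _; exists X.
Qed.

Lemma steinberg_ind (P : set (Sg -> R^o)) : P 0 ->
  (forall (r : R) X f, slice T X -> A f -> P f -> P (r *: tilde1 X + f)) ->
  A `<=` P.
Proof.
move=> P0 PS f /steinberg_gen Sf; suff : (A `&` P) f by case.
apply: linspan_ind Sf => [|r _ g [X sX <-] [Ag Pg]].
  by split => //; exact: steinberg0.
split; last exact: PS.
by apply: steinberg_linear => //; exact: steinberg_tilde1.
Qed.

Lemma steinberg_conv f g : A f -> A g -> A (conv f g).
Proof.
move=> + Ag; move: f; apply: steinberg_ind.
  by rewrite /= conv0f//; exact: steinberg0.
move=> r X f sX Af Afg; have AX := steinberg_tilde1 aG hG sX.
by rewrite /= conv_linl//; apply: steinberg_linear => //; exact: steinberg_conv_tilde1.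
Qed.

Lemma rng_inj_tilde1 X : slice T X -> rng_inj (tilde1 X).
Proof.
move=> sX u v /tilde1_neq0 [t [w [Xw ->]]] /tilde1_neq0 [t' [w' [Xw' ->]]].
by rewrite !rng_tact !twq_tact => e; rewrite (slice_rng sX Xw Xw' e).
Qed.

Lemma src_inj_tilde1 X : slice T X -> src_inj (tilde1 X).
Proof.
move=> sX u v /tilde1_neq0 [t [w [Xw ->]]] /tilde1_neq0 [t' [w' [Xw' ->]]].
by rewrite !src_tact !twq_tact => e; rewrite (slice_src sX Xw Xw' e).
Qed.

(** With f and g injective under the range, every convolution involved has at most one nonzero term,
    at points u of supp(f) and v of supp(g) determined by s. The functions [tilde1 X] are of this
    kind, so linearity in f and g yields the general case. *)
Lemma convA_rng_inj f g h : A f -> A g -> A h -> rng_inj f -> rng_inj g ->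
  conv f (conv g h) = conv (conv f g) h.
Proof.
move=> Af Ag Ah rf rg; apply/funext => s.
have Agh := steinberg_conv Ag Ah; have Afg := steinberg_conv Af Ag.
have [[u [fu us]]|n] := pselect (exists u, f u != 0 /\ rng u = rng s); last first.
  rewrite [LHS]steinberg_conv_eq0// => [|v vs]; last first.
    have [->|fv] := eqVneq (f v) 0; first by rewrite mul0r.
    by exfalso; apply: n; exists v.
  rewrite [RHS]steinberg_conv_eq0// => v vs.
  have [->|] := eqVneq (conv f g v) 0; first by rewrite mul0r.
  move=> /(steinberg_conv_neq0 Af Ag) [w [wv fw _]]; exfalso; apply: n; exists w.
  by rewrite wv.
have us' : src u = rng (gdinv u ** s) by rewrite rngVM.
rewrite -{1}(gdmulVK us) conv_mulr//.
have [[v [gv vs]]|n] := pselect (exists v, g v != 0 /\ rng v = src u); last first.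
  rewrite steinberg_conv_eq0// => [|v]; last first.
    rewrite rngVM// => vu; have [->|gv] := eqVneq (g v) 0; first by rewrite mul0r.
    by exfalso; apply: n; exists v.
  rewrite mulr0 steinberg_conv_eq0// => w ws.
  have [->|] := eqVneq (conv f g w) 0; first by rewrite mul0r.
  move=> /(steinberg_conv_neq0 Af Ag) [x [xw fx gx]]; exfalso; apply: n.
  exists (gdinv x ** w); split => //; rewrite rngVM//; apply/(twq_src_eq T).
  by congr src; apply: rf => //; rewrite xw ws us.
have vs' : rng v = rng (gdinv u ** s) by rewrite rngVM.
rewrite -{1}(gdmulVK vs') conv_mulr ?rngVM// mulrA.
have uvs : rng (u ** v) = rng s by rewrite rngM.
rewrite [RHS](steinberg_conv_eq1 Afg Ah uvs) => [|w ws qw].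
  rewrite conv_mulr// gdinvM// -gdmulA//; first by rewrite /composable src_inv rng_inv.
  by rewrite /composable src_inv.
have [->|] := eqVneq (conv f g w) 0; first by rewrite mul0r.
move=> /(steinberg_conv_neq0 Af Ag) [x [xw fx gx]]; case: qw.
have quu : q x = q u by apply: rf => //; rewrite xw ws us.
have suu : src x = src u by apply/(twq_src_eq T); rewrite quu.
rewrite -[in LHS](gdmulVK xw) [LHS]twqM ?rngVM// [RHS]twqM// quu; congr (_ ** _).
by apply: rg => //; rewrite rngVM// suu.
Qed.

Lemma convA f g h : A f -> A g -> A h -> conv f (conv g h) = conv (conv f g) h.
Proof.
move=> + Ag Ah; move: f; apply: steinberg_ind => [|r X f sX Af IH] /=.
  by rewrite !conv0f//; exact: steinberg_conv.
have AX := steinberg_tilde1 aG hG sX.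
rewrite !conv_linl// ?IH//; try exact: steinberg_conv.
suff -> : conv (tilde1 X) (conv g h) = conv (conv (tilde1 X) g) h by [].
clear f Af IH; move: g Ag; apply: steinberg_ind => [|r' Y g sY Ag IH] /=.
  by rewrite conv0f// !convf0// conv0f.
have AY := steinberg_tilde1 aG hG sY.
rewrite conv_linl// !conv_linr// ?conv_linl// ?IH; try exact: steinberg_conv.
by rewrite convA_rng_inj//; exact: rng_inj_tilde1.
Qed.

Lemma algebra_steinberg : algebra conv A.
Proof.
split; [split|..].
- exact: steinberg0.
- by move=> t f g; exact: steinberg_linear.
- exact: steinberg_conv.
- exact: convA.
- by move=> t f g h; exact: conv_linl.
- by move=> t f g h; exact: conv_linr.
Qed.

End SteinbergAlgebra.

(** * Normalisers *)

Section Normalisers.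
Context {R : comUnitRingType} {G Sg : topGroupoidType}.
Variable T : discrete_twist R G Sg.
Hypotheses (aG : ample G) (hG : hausdorff_space G).
Local Notation q := (twq T).
Local Notation RU := (unit_group R).
Local Notation tact := (tact T).
Local Notation suppG := (suppG T).
Local Notation conv := (conv T).
Local Notation A := (steinberg T).
Local Notation C := (steinberg_diag T).
Local Notation tilde1 := (tilde1 T).
Local Notation src_inj := (src_inj T).
Local Notation rng_inj := (rng_inj T).
Implicit Types (s u v x : Sg) (t : RU) (f g h e n m : Sg -> R^o) (X : set Sg).
Let Aconv f g (Af : A f) (Ag : A g) : A (conv f g) := steinberg_conv aG hG Af Ag.
Let assoc f g h (Af : A f) (Ag : A g) (Ah : A h) := convA aG hG Af Ag Ah.
Hint Resolve steinberg_lc steinberg_eqv steinberg_compact Aconv : core.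

Lemma diag_steinberg e : C e -> A e. Proof. by case. Qed.
Hint Resolve diag_steinberg : core.

Lemma diag_neq0 e s : C e -> e s != 0 -> src (q s) = q s.
Proof. by move=> [_ Ce] es; apply: Ce; exists s. Qed.

Lemma twq_unit_tact s : src (q s) = q s -> exists t, s = tact t (src s).
Proof. by move=> qs; apply: twq_eqP; rewrite twq_src. Qed.

Lemma conv_diagl e f s : C e -> A f -> conv e f s = e (rng s) * f s.
Proof.
move=> Ce Af; rewrite (@steinberg_conv_eq1 _ _ _ _ aG _ _ _ (rng s)) ?rng_rng//; eauto.
  by rewrite unit_inv_eq ?src_rng// gdmul_rng.
move=> v vs qv; have [->|ev] := eqVneq (e v) 0; first by rewrite mul0r.
case: qv; have /unit_rng <- := diag_neq0 Ce ev.
by rewrite twq_rng; apply/(twq_rng_eq T).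
Qed.

Lemma conv_diagr e f s : C e -> A f -> conv f e s = f s * e (src s).
Proof.
move=> Ce Af; rewrite (@steinberg_conv_eq1 _ _ _ _ aG _ _ _ s)//; eauto.
move=> v vs qv; have [->|ev] := eqVneq (e (gdinv v ** s)) 0; first by rewrite mulr0.
case: qv; have := diag_neq0 Ce ev.
rewrite twqM ?src_inv// twq_inv; apply: unitVM.
by apply/(twq_rng_eq T).
Qed.

Lemma diag_ext e e' : C e -> C e' -> (forall x, src x = x -> e x = e' x) -> e = e'.
Proof.
move=> Ce Ce' h; apply/funext => s; have [/twq_unit_tact [t ->]|n] := pselect (src (q s) = q s).
  by rewrite !steinberg_eqv ?h ?src_src//; auto.
have [es|/(diag_neq0 Ce)//] := eqVneq (e s) 0.
by have [es'|/(diag_neq0 Ce')//] := eqVneq (e' s) 0; rewrite es es'.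
Qed.

Lemma diag_linear e e' (r : R) : C e -> C e' -> C (r *: e + e').
Proof.
move=> Ce Ce'; split; first by apply: steinberg_linear; auto.
by move=> a /suppG_linear [] [s es <-]; apply: (diag_neq0 _ es).
Qed.

Lemma diag0 : C 0.
Proof. by split; [exact: steinberg0|move=> a [s /= /eqP]]. Qed.

Lemma diag_conv e e' : C e -> C e' -> C (conv e e').
Proof.
move=> Ce Ce'; split; first by auto.
move=> _ [s /= + <-]; rewrite conv_diagl; auto; move=> ee.
apply: (diag_neq0 Ce'); apply: contra_neq ee => ->.
by rewrite mulr0.
Qed.

Lemma diag_convC e e' : C e -> C e' -> conv e e' = conv e' e.
Proof.
move=> Ce Ce'; apply: diag_ext; [exact: diag_conv..|] => x xU.
by rewrite !conv_diagl ?unit_rng//; [rewrite mulrC|auto..].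
Qed.

Lemma comm_subalgebra_diag : comm_subalgebra conv A C.
Proof.
split; [exact: diag_steinberg| |exact: diag_conv|exact: diag_convC].
by split; [exact: diag0|move=> r e e'; exact: diag_linear].
Qed.

Lemma idemsI e : C e -> (forall x, src x = x -> e x = 0 \/ e x = 1) ->
  idems conv C e.
Proof.
move=> Ce h; split => //; apply: diag_ext => [||x xU] //; first exact: diag_conv.
rewrite conv_diagl ?unit_rng//; auto.
by have [->|->] := h x xU; rewrite ?mulr0 ?mulr1.
Qed.

(** The characteristic function of K, carried to q^-1(K) by equivariance: its value at t.x is t^-1
    for a unit x over K. The names K and X refer to subsets of G and Sg respectively. *)
Definition indic (K : set G) : Sg -> R^o := tilde1 (unit_space Sg `&` q @^-1` K).

Lemma slice_units (K : set G) : open K -> compact K -> K `<=` unit_space G ->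
  slice T (unit_space Sg `&` q @^-1` K).
Proof.
move=> oK cK KU.
have qE : q @` (unit_space Sg `&` q @^-1` K) = K.
  apply/seteqP; split => [_ [x [_ Kx] <-]//|a Ka].
  have [u qu] := twq_lift T a; exists (src u).
    by split; [exact: src_src|rewrite /= twq_src qu KU].
  by rewrite twq_src qu KU.
split; rewrite ?qE//.
- by apply: openI; [exact: open_twist_unit_space T aG|exact: twq_open_comp].
- by move=> x y; rewrite !inE => -[xU _] [yU _]; exact: twq_unit_inj.
- by move=> a b; rewrite !inE => /KU aU /KU bU; rewrite aU bU.
- by move=> a b; rewrite !inE => /KU aU /KU bU; rewrite !unit_rng.
Qed.

Section Indicator.
Variable K : set G.
Hypotheses (oK : open K) (cK : compact K) (KU : K `<=` unit_space G).

Lemma indic_in x : src x = x -> K (q x) -> indic K x = 1.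
Proof. by move=> xU Kx; apply: tilde1_in => //; have [] := slice_units oK cK KU. Qed.

Lemma indic_out s : ~ K (q s) -> indic K s = 0.
Proof. by move=> nK; apply: tilde1_out => -[u [uU Ku] e]; apply: nK; rewrite -e. Qed.

Lemma diag_indic : C (indic K).
Proof.
split; first exact/steinberg_tilde1/slice_units.
move=> _ [s /= /tilde1_neq0 [t [u [[uU Ku] ->]]] <-].
by rewrite twq_tact; exact: KU.
Qed.

Lemma idems_indic : idems conv C (indic K).
Proof.
apply: idemsI diag_indic _ => x xU.
by have [Kx|nKx] := pselect (K (q x)); [right; exact: indic_in|left; exact: indic_out].
Qed.

Lemma conv_indicr f s : A f -> K (src (q s)) -> conv f (indic K) s = f s.
Proof.
move=> Af Ks; rewrite conv_diagr//; last exact: diag_indic.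
by rewrite indic_in ?src_src ?twq_src// mulr1.
Qed.

Lemma conv_indicr0 f s : A f -> ~ K (src (q s)) -> conv f (indic K) s = 0.
Proof.
move=> Af Ks; rewrite conv_diagr//; last exact: diag_indic.
by rewrite indic_out ?twq_src// mulr0.
Qed.

Lemma conv_indicl f s : A f -> K (rng (q s)) -> conv (indic K) f s = f s.
Proof.
move=> Af Ks; rewrite conv_diagl//; last exact: diag_indic.
by rewrite indic_in ?src_rng ?twq_rng// mul1r.
Qed.

End Indicator.

(** The unit is the characteristic function of a compact open set of units containing the sources
    and ranges of all supports. *)
Lemma local_unit (F : seq (Sg -> R^o)) : (forall f, f \in F -> A f) ->
  exists2 e, idems conv C e & forall f, f \in F -> conv e f = f /\ conv f e = f.
Proof.
move=> AF; have [K [oK cK KU KF]] : exists K : set G, [/\ open K, compact K,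
    K `<=` unit_space G & forall f, f \in F -> forall s, f s != 0 ->
    K (src (q s)) /\ K (rng (q s))].
  elim: F AF => [|f F IH] AF.
    exists set0; split; [exact: open0|exact: compact0|by []|by []].
  have [|K [oK cK KU KF]] := IH.
    by move=> g gF; apply: AF; rewrite inE gF orbT.
  have Af : A f by apply: AF; rewrite inE eqxx.
  have of_ := open_suppG T aG (steinberg_lc Af).
  have cf : compact (suppG f) by auto.
  exists (src @` suppG f `|` rng @` suppG f `|` K); split.
  - by apply: openU => //; apply: openU; [exact: open_src|exact: open_rng].
  - by apply: compactU => //; apply: compactU; [exact: compact_src|exact: compact_rng].
  - move=> a [[] [b _ <-]|/KU//]; [exact: src_src|exact: src_rng].
  - move=> g; rewrite inE => /orP[/eqP ->|gF] s gs.
      by split; left; [left|right]; exists (q s) => //; exists s.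
    by have [] := KF _ gF _ gs; split; right.
exists (indic K); first exact: idems_indic.
move=> f fF; have Af := AF _ fF; split; apply/funext => s.
  have [fs|fs] := eqVneq (f s) 0; last first.
    by have [] := KF _ fF _ fs => ? ?; rewrite conv_indicl.
  by rewrite conv_diagl ?fs ?mulr0//; exact: diag_indic.
have [fs|fs] := eqVneq (f s) 0; last first.
  by have [] := KF _ fF _ fs => ? ?; rewrite conv_indicr.
by rewrite conv_diagr ?fs ?mul0r//; exact: diag_indic.
Qed.

Local Notation nor_by := (normaliser_by conv A C).
Local Notation Nor := (normalisers conv A C).
Local Notation dag := (dagger conv A C).

Lemma nor_byC n m : A n -> nor_by n m -> nor_by m n.
Proof. by move=> An [Am mnm nmn mn]; split => // c /mn []. Qed.

(** With a local unit e for n, the product n m equals n e m, which is in C by the normalising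
    condition. *)
Lemma nor_by_diag n m : A n -> nor_by n m -> C (conv n m).
Proof.
move=> An [Am mnm nmn mn]; have [|e [Ce _] eF] := @local_unit [:: n].
  by move=> f; rewrite inE => /eqP ->.
have [|_ ne] := eF n; first by rewrite inE.
by rewrite -ne; apply: (mn _ Ce).2.
Qed.

Lemma nor_by_idem n m : A n -> nor_by n m -> idems conv C (conv n m).
Proof.
move=> An nm; split; first exact: nor_by_diag.
by have [Am mnm nmn mn] := nm; rewrite assoc ?nmn; auto.
Qed.

(** As in an inverse semigroup, commuting idempotents force uniqueness: n m = (n m')(n m) = (n m)(n
    m') = n m', likewise on the other side, and then m = m n m = m' n m'. *)
Lemma nor_by_unique n m m' : A n -> nor_by n m -> nor_by n m' -> m = m'.
Proof.
move=> An nm nm'; have [Am mnm nmn _] := nm; have [Am' mnm' nmn' _] := nm'.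
have C1 := nor_by_diag An nm; have C2 := nor_by_diag An nm'.
have C3 := nor_by_diag Am (nor_byC An nm); have C4 := nor_by_diag Am' (nor_byC An nm').
have e1 : conv n m = conv n m'.
  rewrite -{1}nmn' -assoc; [|auto..].
  by rewrite (diag_convC C2 C1) assoc ?nmn; auto.
have e2 : conv m n = conv m' n.
  have -> : conv m n = conv (conv m n) (conv m' n).
    by rewrite -[in LHS]nmn' !assoc; auto.
  rewrite (diag_convC C3 C4).
  have -> : conv (conv m' n) (conv m n) = conv m' (conv (conv n m) n).
    by rewrite !assoc; auto.
  by rewrite nmn.
by rewrite -{1}mnm e2 -assoc// e1 assoc.
Qed.

Lemma dagP n : Nor n -> nor_by n (dag n).
Proof. by move=> [An [m nm]]; rewrite /dagger; apply: xgetPex; exists m. Qed.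

Lemma dag_eq n m : A n -> nor_by n m -> dag n = m.
Proof.
move=> An nm; apply: (nor_by_unique An) => //; apply: dagP.
by split => //; exists m.
Qed.

Lemma dag_Nor n : Nor n -> Nor (dag n).
Proof.
move=> Nn; have nd := dagP Nn; have [An _] := Nn; split; first by case: nd.
by exists n; exact: nor_byC.
Qed.

Lemma nor_by_conv n m n' m' : A n -> A n' -> nor_by n m -> nor_by n' m' ->
  nor_by (conv n n') (conv m' m).
Proof.
move=> An An' nm nm'; have [Am mnm nmn mn] := nm; have [Am' mnm' nmn' mn'] := nm'.
have C1 := nor_by_diag Am (nor_byC An nm); have C2 := nor_by_diag An' nm'.
split; first by auto.
- have -> : conv (conv (conv m' m) (conv n n')) (conv m' m) =
      conv m' (conv (conv (conv m n) (conv n' m')) m).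
    by rewrite !assoc; auto 10.
  rewrite (diag_convC C1 C2).
  have -> : conv m' (conv (conv (conv n' m') (conv m n)) m) =
      conv (conv (conv m' n') m') (conv (conv m n) m).
    by rewrite !assoc; auto 10.
  by rewrite mnm' mnm.
- have -> : conv (conv (conv n n') (conv m' m)) (conv n n') =
      conv n (conv (conv (conv n' m') (conv m n)) n').
    by rewrite !assoc; auto 10.
  rewrite -(diag_convC C1 C2).
  have -> : conv n (conv (conv (conv m n) (conv n' m')) n') =
      conv (conv (conv n m) n) (conv (conv n' m') n').
    by rewrite !assoc; auto 10.
  by rewrite nmn' nmn.
- move=> c Cc; have Ac := diag_steinberg Cc.
  have -> : conv (conv (conv m' m) c) (conv n n') = conv (conv m' (conv (conv m c) n)) n'.
    by rewrite !assoc; auto 10.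
  have -> : conv (conv (conv n n') c) (conv m' m) = conv (conv n (conv (conv n' c) m')) m.
    by rewrite !assoc; auto 10.
  by split; [apply: (mn' _ _).1; apply: (mn _ Cc).1|apply: (mn _ _).2; apply: (mn' _ Cc).2].
Qed.

Lemma Nor_conv n n' : Nor n -> Nor n' -> Nor (conv n n').
Proof.
move=> [An [m nm]] [An' [m' nm']]; split; first by auto.
by exists (conv m' m); exact: nor_by_conv.
Qed.

Lemma idems_nor_by e : idems conv C e -> nor_by e e.
Proof.
move=> [Ce ee]; split; rewrite ?ee; auto.
by move=> c Cc; split; apply: diag_conv => //; exact: diag_conv.
Qed.

Lemma idems_Nor e : idems conv C e -> Nor e.
Proof. by move=> ie; split; [case: ie; auto|exists e; exact: idems_nor_by]. Qed.

Hypothesis iR : indecomposable R.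

(** At a unit convolution in C is multiplication in R, so e(x) is an idempotent of the
    indecomposable ring R. *)
Lemma idems_val e x : idems conv C e -> src x = x -> e x = 0 \/ e x = 1.
Proof.
move=> [Ce ee] xU; apply: iR; move: ee => /(congr1 (@^~ x)) /=.
by rewrite conv_diagl ?unit_rng//; auto.
Qed.

Lemma idems_neq0 e x : idems conv C e -> src x = x -> e x != 0 -> e x = 1.
Proof. by move=> ie xU; case: (idems_val ie xU) => [->|//]; rewrite eqxx. Qed.

(** If the idempotent m n vanished at the source of s, then n = n (m n) would vanish at s. *)
Lemma nor_by_src n m s : A n -> nor_by n m -> n s != 0 -> conv m n (src s) = 1.
Proof.
move=> An nm ns; have [Am _ nmn _] := nm; have mn := nor_byC An nm.
apply: idems_neq0; [exact: nor_by_idem|exact: src_src|].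
apply: contra_neq ns => mns; rewrite -nmn -assoc//.
rewrite conv_diagr// ?mns ?mulr0//; exact: nor_by_diag.
Qed.

Lemma nor_by_rng n m s : A n -> nor_by n m -> n s != 0 -> conv n m (rng s) = 1.
Proof.
move=> An nm ns; have [Am _ nmn _] := nm.
apply: idems_neq0; [exact: nor_by_idem|exact: src_rng|].
apply: contra_neq ns => mns; rewrite -nmn.
rewrite conv_diagl// ?mns ?mul0r//; exact: nor_by_diag.
Qed.

(** On units [conv (dag m) m] is the characteristic function of the sources of supp(m); multiplying
    n by it on the right cuts n down to the fibres over these sources. *)
Lemma hleP n m : A n -> Nor m -> hle conv A C m n <->
  forall s s', m s' != 0 -> src s = src s' -> n s = m s.
Proof.
move=> An Nm; have [Am _] := Nm; have mm := dagP Nm.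
have [Ad _ mdm _] := mm; have dm := nor_byC Am mm.
have Cd := nor_by_diag Ad dm; have id := nor_by_idem Ad dm.
rewrite /hle -assoc//; split => [mE s s' ms' ss'|h].
  by rewrite [in RHS]mE conv_diagr// ss' (nor_by_src Am mm)// mulr1.
apply/funext => s; rewrite conv_diagr//.
have [ds|ds] := eqVneq (conv (dag m) m (src s)) 0.
  rewrite ds mulr0; apply/eqP/negPn/negP => ms.
  by move/eqP: ds; rewrite (nor_by_src Am mm) ?oner_eq0.
rewrite (idems_neq0 id (src_src s) ds) mulr1.
have [u [us du mu]] := steinberg_conv_neq0 aG Ad Am ds.
by rewrite (h s _ mu)// srcVM// src_src.
Qed.

Definition mono f := [/\ A f, src_inj f, rng_inj f & forall s, f s != 0 -> f s \is a GRing.unit].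

(** Injectivity already forces unit values: the convolution n n^dagger at the range of s has the
    single term n(s) n^dagger(s^-1), and its value there is 1. *)
Lemma Nor_mono n : Nor n -> src_inj n -> rng_inj n -> mono n.
Proof.
move=> Nn si ri; have [An _] := Nn; have nm := dagP Nn; have [Am _ _ _] := nm.
split=> // s ns; apply/unitrPr; exists (dag n (gdinv s)).
rewrite -(conv_mulr aG An Am ri ns) ?rng_inv//.
exact: (nor_by_rng An nm ns).
Qed.

Lemma mono_dag n s : mono n -> Nor n -> n s != 0 -> dag n (gdinv s) = (n s)^-1.
Proof.
move=> [An si ri un] Nn ns; have nm := dagP Nn; have [Am _ _ _] := nm.
have := nor_by_rng An nm ns.
rewrite [X in conv _ _ X](_ : _ = s ** gdinv s)// (conv_mulr aG An Am ri ns) ?rng_inv// => e.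
by apply: (mulrI (un _ ns)); rewrite e divrr ?un.
Qed.

(** An explicit candidate for the generalised inverse of a monomial f. The convention [0^-1 = 0]
    makes it vanish wherever f(s^-1) does. *)
Definition star f : Sg -> R^o := fun s => (f (gdinv s))^-1.

Lemma star_neq0 f s : star f s != 0 -> f (gdinv s) != 0.
Proof. by apply: contra_neq; rewrite /star => ->; rewrite invr0. Qed.

Lemma mono_star f : mono f -> mono (star f).
Proof.
move=> [Af si ri un].
have As : A (star f).
  have := steinberg_compact Af => cf.
  have cf' : compact (gdinv @` suppG f).
    apply: continuous_compact cf; apply: continuous_subspaceT.
    exact: gdinv_continuous.
  apply: steinbergI cf' _ => //.
  - move=> s; have : nbhs s (gdinv @^-1` [set u | f u = f (gdinv s)]).
      by apply: gdinv_continuous; exact: (steinberg_lc Af).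
    by apply: filterS => u; rewrite /star /= => ->.
  - move=> t s; rewrite /star tactV (steinberg_eqv Af) /= invrK.
    have [->|fs] := eqVneq (f (gdinv s)) 0; first by rewrite mulr0 invr0 mulr0.
    by rewrite invrM ?uval_unit ?un// mulrC.
  - move=> _ [s /= /star_neq0 fs <-]; exists (q (gdinv s)); first by exists (gdinv s).
    by rewrite twq_inv gdinvK.
split => //.
- move=> u v /star_neq0 fu /star_neq0 fv uv; apply: (can_inj (@gdinvK G)).
  by rewrite -!twq_inv; apply: ri => //; rewrite !rng_inv.
- move=> u v /star_neq0 fu /star_neq0 fv uv; apply: (can_inj (@gdinvK G)).
  by rewrite -!twq_inv; apply: si => //; rewrite !src_inv.
- by move=> s /star_neq0 fs; rewrite unitrV; exact: un.
Qed.

(** A nonzero term of the product at s comes from u in supp(g) and from u^-1 s, whose inverse is in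
    supp(f) and has the source of u. Injectivity of the source on supp(f) puts both over the same
    point of G, so s lies over a unit. *)
Lemma star_diag f g : mono f -> A g -> (forall s, g s != 0 -> f s != 0) ->
  C (conv g (star f)).
Proof.
move=> mf Ag gf; have [As _ _ _] := mono_star mf; have [Af si ri un] := mf.
split; first by auto.
move=> _ [s /= /(steinberg_conv_neq0 aG Ag As) [u [us gu /star_neq0 fu]] <-].
have : q u = q (gdinv (gdinv u ** s)).
  by apply: si => //; [exact: gf|rewrite src_inv rngVM].
rewrite twq_inv => /(congr1 gdinv); rewrite gdinvK twqM ?src_inv// twq_inv => e.
have /= := congr1 (gdmul (q u)) e; rewrite gdmulVK; last by apply/(twq_rng_eq T).
by move=> <-; exact: src_rng.
Qed.

Lemma star_rng f s : mono f -> f s != 0 -> conv f (star f) (rng s) = 1.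
Proof.
move=> mf fs; have [As _ _ _] := mono_star mf; have [Af si ri un] := mf.
rewrite [X in conv _ _ X](_ : _ = s ** gdinv s)// (conv_mulr aG Af As ri fs) ?rng_inv//.
by rewrite /star gdinvK divrr ?un.
Qed.

Lemma starK f : star (star f) = f.
Proof. by apply/funext => s; rewrite /star gdinvK invrK. Qed.

Lemma star_mulK f : mono f -> conv (conv f (star f)) f = f.
Proof.
move=> mf; have [Af _ _ _] := mf; apply/funext => s.
rewrite conv_diagl//; last exact: star_diag.
have [->|fs] := eqVneq (f s) 0; first by rewrite mulr0.
by rewrite star_rng// mul1r.
Qed.

Lemma mono_nor_by f : mono f -> nor_by f (star f).
Proof.
move=> mf; have ms := mono_star mf; have [As _ _ _] := ms; have [Af _ _ _] := mf.
split => //; [by have := star_mulK ms; rewrite starK|exact: star_mulK|].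
move=> c Cc; split; last first.
  apply: star_diag => // [|s]; first by auto.
  by rewrite conv_diagr//; apply: contra_neq => ->; rewrite mul0r.
(* The remaining half is the same statement for [star f], whose own [star] is f. *)
rewrite -{2}(starK f); apply: star_diag => // [|s]; first by auto.
by rewrite conv_diagr//; apply: contra_neq => ->; rewrite mul0r.
Qed.

Lemma mono_Nor f : mono f -> Nor f.
Proof. by move=> mf; split; [case: mf|exists (star f); exact: mono_nor_by]. Qed.

Lemma mono_tilde1 X : slice T X -> mono (tilde1 X).
Proof.
move=> sX; split; first exact: steinberg_tilde1.
- exact: src_inj_tilde1.
- exact: rng_inj_tilde1.
- by have [_ qi _ _ _] := sX => s; exact: tilde1_unit.
Qed.

End Normalisers.

(** * The map Phi and ultrafilters *)

Section Graded.
Context {R : comUnitRingType} {Gamma : groupType} {G Sg : topGroupoidType}.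
Variable T : graded_twist R Gamma G Sg.
Hypotheses (aG : ample G) (hG : hausdorff_space G) (iR : indecomposable R).
Local Notation q := (twq T).
Local Notation suppG := (suppG T).
Local Notation conv := (conv T).
Local Notation A := (steinberg T).
Local Notation C := (steinberg_diag T).
Local Notation Ag := (steinberg_gr T).
Local Notation tilde1 := (tilde1 T).
Local Notation N := (hnormalisers conv A Ag C).
Local Notation Nor := (normalisers conv A C).
Local Notation dag := (dagger conv A C).
Local Notation deg := (gdegS T).
Local Notation hle := (hle conv A C).
Local Notation mono := (mono T).
Implicit Types (s u v x : Sg) (f g h e n m : Sg -> R^o) (X O : set Sg) (a b : Gamma).
Let Aconv f g (Af : A f) (Ag : A g) : A (conv f g) := steinberg_conv aG hG Af Ag.
Hint Resolve steinberg_lc steinberg_eqv steinberg_compact Aconv diag_steinberg : core.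

Lemma gr_steinberg a f : Ag a f -> A f. Proof. by case. Qed.

Lemma gr_deg a f s : Ag a f -> f s != 0 -> deg s = a.
Proof. by move=> [_ fa] fs; rewrite gdegSE; apply: fa; exists s. Qed.

Lemma grI a f : A f -> (forall s, f s != 0 -> deg s = a) -> Ag a f.
Proof. by move=> Af h; split => // _ [s /= /h e <-]; rewrite /= -gdegSE. Qed.

Lemma diag_gr e : C e -> Ag 1%g e.
Proof.
move=> Ce; apply: grI => [|s es]; first by auto.
by rewrite gdegSE -(diag_neq0 Ce es) gdeg_src.
Qed.

Lemma gr_tilde1 a X : slice T X -> X `<=` deg @^-1` [set a] -> Ag a (tilde1 X).
Proof.
move=> sX Xa; apply: grI => [|s]; first exact: steinberg_tilde1.
move=> /tilde1_neq0 [t [u [Xu ->]]].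
by rewrite gdegSE twq_tact -gdegSE; exact: Xa.
Qed.

Lemma gr_conv a b f g : Ag a f -> Ag b g -> Ag (a * b)%g (conv f g).
Proof.
move=> fa gb; have [Af _] := fa; have [Agg _] := gb.
apply: grI => [|s]; first by auto.
move=> /(steinberg_conv_neq0 aG Af Agg) [u [us fu gu]].
rewrite -(gdmulVK us) gdegM; last by rewrite /composable rngVM.
by rewrite (gr_deg fa fu) (gr_deg gb gu).
Qed.

Lemma gr_linear a (r : R) f g : Ag a f -> Ag a g -> Ag a (r *: f + g).
Proof.
move=> [Af fa] [Agg ga]; split; first exact: steinberg_linear.
by move=> x /suppG_linear [/fa|/ga].
Qed.

Lemma gr0 a : Ag a 0.
Proof. by split; [exact: steinberg0|move=> x [s /= /eqP]]. Qed.

Lemma exists_homogeneous_slice O s : open O -> O s ->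
  exists X, [/\ slice T X, X s, X `<=` O, compact X & X `<=` deg @^-1` [set deg s]].
Proof.
move=> oO Os.
have [||X [sX Xs XO cX _]] := @exists_slice _ _ _ T aG (O `&` deg @^-1` [set deg s]) s.
- by apply: openI => //; exact: open_gdeg.
- by [].
by exists X; split => // u /XO [].
Qed.

Lemma hnor_Nor n : N n -> Nor n. Proof. by move=> [a _ []]. Qed.

Lemma hnor_steinberg n : N n -> A n. Proof. by move=> /hnor_Nor []. Qed.

Lemma idems_hnor e : idems conv C e -> N e.
Proof.
move=> ie; exists 1%g => //; split; last by apply: diag_gr; case: ie.
exact: idems_Nor.
Qed.

Lemma hnor_conv n m : N n -> N m -> N (conv n m).
Proof.
move=> [a _ [Nn na]] [b _ [Nm mb]]; exists (a * b)%g => //; split.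
  exact: Nor_conv.
exact: gr_conv.
Qed.

Lemma mono_hnor a f : mono f -> Ag a f -> N f.
Proof. by move=> mf fa; exists a => //; split => //; exact: mono_Nor. Qed.

Lemma steinberg_restr_deg a f : A f -> A (restr T (gdegG T @^-1` [set a]) f).
Proof.
apply: (steinberg_restr aG); first exact: open_gdeg.
by rewrite -openC; exact: (@open_gdeg _ _ (gdegG T) (~` [set a])).
Qed.

(* The component m1 of m of degree g^-1 satisfies n m1 = n m and m1 n = m n, as
   n m and m n have degree 1; hence m = m1 n m1. *)
Lemma dag_gr a n : Nor n -> Ag a n -> Ag a^-1%g (dag n).
Proof.
move=> Nn na; have [An _] := Nn; have nm := dagP Nn; move: (dag n) nm => m nm.
have [Am mnm nmn _] := nm; have Cnm := nor_by_diag aG hG An nm.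
have Cmn := nor_by_diag aG hG Am (nor_byC An nm).
pose W := gdegG T @^-1` [set a^-1%g]; pose m1 := restr T W m.
have Am1 : A m1 by exact: steinberg_restr_deg.
have m1a : Ag a^-1%g m1.
  by apply: grI => // s /restr_neq0[]; rewrite gdegSE.
have Ad : A (m - m1) by exact: steinbergB.
have md s : deg s = a^-1%g -> (m - m1) s = 0.
  by move=> ds; rewrite !fctE /m1 restr_in ?subrr// /W /= -gdegSE.
have mE : m = 1 *: m1 + (m - m1) by rewrite scale1r addrC subrK.
have e1 : conv n m = conv n m1.
  apply/funext => s; have [ds|ds] := pselect (deg s = 1%g).
    rewrite [in LHS]mE conv_linr// fctE scale1r fctE.
    rewrite [X in _ + X](@steinberg_conv_eq0 _ _ _ _ aG n)//; first by rewrite addr0.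
    move=> v vs; have [->|nv] := eqVneq (n v) 0; first by rewrite mul0r.
    rewrite md ?mulr0//; rewrite gdegM; last by rewrite /composable src_inv.
    by rewrite gdegV ds mulg1 (gr_deg na nv).
  have -> : conv n m s = 0.
    by apply/eqP/negPn/negP => /(gr_deg (diag_gr Cnm)).
  apply/esym/eqP/negPn/negP => /(gr_deg (gr_conv na m1a)).
  by rewrite mulgV.
have e2 : conv m n = conv m1 n.
  apply/funext => s; have [ds|ds] := pselect (deg s = 1%g).
    rewrite [in LHS]mE conv_linl// fctE scale1r fctE.
    rewrite [X in _ + X](@steinberg_conv_eq0 _ _ _ _ aG (m - m1))//; first by rewrite addr0.
    move=> v vs; have [->|nv] := eqVneq (n (gdinv v ** s)) 0; first by rewrite mulr0.
    have := gr_deg na nv; rewrite gdegM; last by rewrite /composable src_inv.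
    rewrite gdegV ds mulg1 => dv; rewrite md ?mul0r//.
    by rewrite -dv invgK.
  have -> : conv m n s = 0.
    by apply/eqP/negPn/negP => /(gr_deg (diag_gr Cmn)).
  apply/esym/eqP/negPn/negP => /(gr_deg (gr_conv m1a na)).
  by rewrite mulVg.
rewrite -mnm e2 -(convA aG hG)// e1.
have := gr_conv m1a (gr_conv na m1a).
by rewrite mulgV mulg1.
Qed.

Lemma hnor_dag n : N n -> N (dag n).
Proof.
move=> [a _ [Nn na]]; exists a^-1%g => //; split; last exact: dag_gr.
exact: dag_Nor.
Qed.

Lemma hnor_hleP n m : A n -> N m -> hle m n <->
  forall s s', m s' != 0 -> src s = src s' -> n s = m s.
Proof. by move=> An /hnor_Nor; exact: hleP. Qed.

(** No monomiality is assumed. An element m lies above some [conv (tilde1 X) e] with e(s(s)) = 1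
    exactly when m and [tilde1 X] agree on the source fibre of s, which is the condition on the
    right. The chosen bisection X thereby disappears. *)
Lemma PhiE s : Phi T s = [set m | [/\ N m, m s = 1 &
  forall s', src s' = src s -> q s' <> q s -> m s' = 0]].
Proof.
rewrite /Phi; set X := Phi_bisection T s.
have [cX bX Xd Xs] : [/\ compact X, open_bisection X, X `<=` deg @^-1` [set deg s] & X s].
  have [Y [sY Ys _ cY Yd]] := exists_homogeneous_slice openT (I : setT s).
  apply: (@xgetPex _ set0 [set X | [/\ compact X, open_bisection X,
    X `<=` deg @^-1` [set deg s] & X s]]).
  by exists Y; split => //; exact: slice_open_bisection sY.
have sX := open_bisection_slice T cX bX; have AX := steinberg_tilde1 aG hG sX.
have [oX qi _ _ _] := sX.
have NX : N (tilde1 X) by apply: mono_hnor (mono_tilde1 aG hG sX) (gr_tilde1 sX Xd).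
have Xfib s' : src s' = src s -> q s' <> q s -> tilde1 X s' = 0.
  move=> ss qs; apply: tilde1_out => -[u Xu qu]; apply: qs; rewrite -qu; congr q.
  by apply: (slice_src sX) => //; rewrite -ss; apply/(twq_src_eq T); rewrite qu.
apply/seteqP; split => [m [Nm [_ [e [ie es] <-]]]|m [Nm ms m0]].
  have [Ce _] := ie.
  move=> /(hnor_hleP (hnor_steinberg Nm) (hnor_conv NX (idems_hnor ie))) h.
  have XeE s' : conv (tilde1 X) e s' = tilde1 X s' * e (src s') by apply: conv_diagr.
  have Xes : conv (tilde1 X) e s != 0 by rewrite XeE es mulr1 tilde1_in ?oner_neq0.
  split => // [|s' ss qs].
    by rewrite (h s s)// XeE es mulr1 tilde1_in.
  by rewrite (h s' s)// XeE Xfib ?mul0r.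
split => //; pose f := m - tilde1 X; have Am := hnor_steinberg Nm.
have Af : A f by exact: steinbergB.
have f0 s' : src s' = src s -> f s' = 0.
  move=> ss; rewrite /f !fctE; have [qs|qs] := pselect (q s' = q s).
    have [t ->] := twq_eqP (esym qs).
    by rewrite (steinberg_eqv Am) ms (steinberg_eqv AX) tilde1_in// subrr.
  by rewrite m0// Xfib// subrr.
(* The sources of the support of m - [tilde1 X] form a compact, hence closed, set that misses the
   source of s. Over a compact open neighbourhood K away from it the two functions agree on entire
   fibres. *)
pose W := unit_space G `&` ~` (src @` suppG f).
have oW : open W.
  apply: openI; first exact: open_unit_space.
  by rewrite openC; apply: compact_closed => //; apply: compact_src; exact: steinberg_compact.
have Ws : W (src (q s)).
  split; first exact: src_src.
  by move=> [_ [u fu <-] /(twq_src_eq T) /f0 e]; move: fu; rewrite /= e eqxx.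
have [K [cK [oK _ _ _ _] Ks KW]] := ample_nbhs aG oW Ws.
have KU : K `<=` unit_space G by move=> a /KW [].
have ie := idems_indic T aG hG oK cK KU.
exists (conv (tilde1 X) (indic T K)).
  exists (indic T K) => //; split => //.
  by rewrite indic_in ?src_src// twq_src.
apply/(hnor_hleP Am (hnor_conv NX (idems_hnor ie))) => u v.
have [Kv|nKv] := pselect (K (src (q v))); last by rewrite conv_indicr0// eqxx.
move=> _ /(twq_src_eq T) uv; have Ku : K (src (q u)) by rewrite uv.
rewrite conv_indicr//; apply/eqP; rewrite -subr_eq0.
apply/negPn/negP => fu; have [_] := KW _ Ku; apply.
by exists (q u) => //; exists u.
Qed.

Lemma tilde1_Phi X s : slice T X -> X s -> X `<=` deg @^-1` [set deg s] ->
  Phi T s (tilde1 X).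
Proof.
move=> sX Xs Xd; have [_ qi _ _ _] := sX; rewrite PhiE; split.
- exact: mono_hnor (mono_tilde1 aG hG sX) (gr_tilde1 sX Xd).
- by rewrite tilde1_in.
move=> s' ss qs; apply: tilde1_out => -[u Xu qu]; apply: qs; rewrite -qu; congr q.
by apply: (slice_src sX) => //; rewrite -ss; apply/(twq_src_eq T); rewrite qu.
Qed.

End Graded.

(** * Surjectivity of Phi against monomiality of the homogeneous normalisers *)

Section Ultrafilters.
Context {R : comUnitRingType} {Gamma : groupType} {G Sg : topGroupoidType}.
Variable T : graded_twist R Gamma G Sg.
Hypotheses (aG : ample G) (hG : hausdorff_space G) (iR : indecomposable R).
Local Notation q := (twq T).
Local Notation RU := (unit_group R).
Local Notation tact := (tact T).
Local Notation suppG := (suppG T).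
Local Notation conv := (conv T).
Local Notation A := (steinberg T).
Local Notation C := (steinberg_diag T).
Local Notation Ag := (steinberg_gr T).
Local Notation tilde1 := (tilde1 T).
Local Notation N := (hnormalisers conv A Ag C).
Local Notation dag := (dagger conv A C).
Local Notation deg := (gdegS T).
Local Notation hle := (hle conv A C).
Local Notation mono := (mono T).
Local Notation is_filter := (is_filter conv A Ag C).
Local Notation ultrafilters := (ultrafilters conv A Ag C).
Local Notation upset := (upset conv A Ag C).
Local Notation Phi := (Phi T).
Implicit Types (s u v x : Sg) (f g h e n m : Sg -> R^o) (X O : set Sg).
Implicit Types (U W : set (Sg -> R^o)).
Let Aconv f g (Af : A f) (Ag : A g) : A (conv f g) := steinberg_conv aG hG Af Ag.
Hint Resolve steinberg_lc steinberg_eqv steinberg_compact Aconv diag_steinberg : core.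
Hint Resolve hnor_steinberg : core.

Lemma hle_refl n : N n -> hle n n.
Proof. by move=> Nn; apply/(hnor_hleP aG hG iR) => //; auto. Qed.

Lemma hle_trans n m p : N n -> N m -> N p -> hle n m -> hle m p -> hle n p.
Proof.
move=> Nn Nm Np /(hnor_hleP aG hG iR (hnor_steinberg Nm) Nn) nm.
move=> /(hnor_hleP aG hG iR (hnor_steinberg Np) Nm) mp.
apply/(hnor_hleP aG hG iR) => // [|s s' ns ss]; first by auto.
by rewrite -(nm s s')// (mp s s')// (nm s' s').
Qed.

Lemma filter_lower_bound U n (l : seq (Sg -> R^o)) : is_filter U -> U n ->
  (forall m, m \in l -> U m) ->
  exists2 p, U p & forall m, m \in n :: l -> hle p m.
Proof.
move=> [UN _ _ Ud] Un; elim: l => [|m l IH] lU.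
  exists n => // m; rewrite inE => /eqP ->; apply: hle_refl.
  by have [] := UN _ Un.
have [|p Up pl] := IH; first by move=> k kl; apply: lU; rewrite inE kl orbT.
have [|r Ur [rp rm]] := Ud p m Up; first by apply: lU; rewrite inE eqxx.
have UN' k : U k -> N k by move=> /UN [].
exists r => // k; rewrite !inE => /or3P[/eqP ->|/eqP ->//|kl].
  by apply: (hle_trans _ _ _ rp); auto; apply: pl; rewrite inE eqxx.
apply: (hle_trans _ _ _ rp); auto; last by apply: pl; rewrite inE kl orbT.
by apply: UN'; apply: lU; rewrite inE kl orbT.
Qed.

Lemma ultrafilter_extension U : is_filter U -> exists2 W, ultrafilters W & U `<=` W.
Proof.
move=> fU; pose P W := W = set0 \/ is_filter W /\ U `<=` W.
have [F FP Ft|W [PW maxW]] := @Zorn_bigcup _ P.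
  have [[W0 [FW0 W0n]]|nF] := pselect (exists W, F W /\ W <> set0); last first.
    left; apply/seteqP; split => // m [W FW Wm].
    by case: nF; exists W; split => // W0; rewrite W0 in Wm.
  have FP' W m : F W -> W m -> is_filter W /\ U `<=` W.
    by move=> /FP [->//|//].
  have [[_ [m0 W0m0] _ _] UW0] : is_filter W0 /\ U `<=` W0 by case: (FP _ FW0).
  right; split; last by move=> m /UW0; exists W0.
  split.
  - by move=> m [W FW Wm]; have [[WN _ _ _] _] := FP' _ _ FW Wm; exact: WN.
  - by exists m0, W0.
  - apply/seteqP; split => [m [W FW Wm]|m [Nm [n [W FW Wn] nm]]].
      have [[WN _ _ _] _] := FP' _ _ FW Wm; have [Nm _] := WN _ Wm.
      by split => //; exists m; [exists W|exact: hle_refl].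
    have [[_ _ Wu _] _] := FP' _ _ FW Wn.
    by exists W => //; rewrite Wu; split => //; exists n.
  move=> m n [W FW Wm] [W' FW' Wn].
  have [WW|WW] := Ft _ _ FW FW'.
    have [[_ _ _ Wd] _] := FP' _ _ FW' Wn.
    by have [p Wp pp] := Wd m n (WW _ Wm) Wn; exists p => //; exists W'.
  have [[_ _ _ Wd] _] := FP' _ _ FW Wm.
  by have [p Wp pp] := Wd m n Wm (WW _ Wn); exists p => //; exists W.
have [_ [u Uu] _ _] := fU.
have [W0|[fW UW]] := PW.
  exfalso; apply: (maxW U); last by right; split.
  by rewrite W0; split; [exact: sub0set|move=> /(_ _ Uu)].
exists W => //; split => // W' fW' WW'; apply: contrapT => ne.
apply: (maxW W'); last by right; split => //; exact: subset_trans WW'.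
by split => // W'W; apply: ne; apply/seteqP.
Qed.

Section Surjective.
Hypothesis Phi_surj : set_surj setT ultrafilters Phi.

Lemma surj_concentrated n s : N n -> n s != 0 ->
  n s \is a GRing.unit /\ forall s', n s' != 0 -> src s' = src s -> q s' = q s.
Proof.
move=> Nn ns; have An := hnor_steinberg Nn.
(* Elements of B agree with n on the source fibre of s, so everything above them is nonzero at s:
   the filter they generate is proper although nothing is known yet about the shape of n. *)
pose B := [set m | exists2 e, unit_idems T (src s) e & m = conv n e].
have BN m : B m -> N m.
  by move=> [e [ie _] ->]; apply: hnor_conv => //; exact: idems_hnor.
have Bval m s' : B m -> src s' = src s -> m s' = n s'.
  move=> [e [[Ce _] es] ->] ss; rewrite conv_diagr// ss es mulr1//.
have fB : is_filter (upset B).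
  split.
  - move=> m [Nm [k Bk km]]; split => // m0; move: km.
    move=> /(hnor_hleP aG hG iR (hnor_steinberg Nm) (BN _ Bk)) /(_ s s).
    rewrite Bval// => /(_ ns erefl); rewrite m0 => /esym.
    by apply/eqP.
  - have oS : open (suppG n) by exact: open_suppG (steinberg_lc An).
    have oK := open_src aG oS; have cK := compact_src (steinberg_compact An).
    have KU : src @` suppG n `<=` unit_space G by move=> _ [z _ <-]; exact: src_src.
    have B1 : B (conv n (indic T (src @` suppG n))).
      exists (indic T (src @` suppG n)) => //; split; first exact: idems_indic.
      by rewrite indic_in ?src_src// twq_src; exists (q s) => //; exists s.
    exists (conv n (indic T (src @` suppG n))); split; first exact: BN.
    by exists (conv n (indic T (src @` suppG n))) => //; apply: hle_refl; exact: BN.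
  - apply/seteqP; split => [m um|m [Nm [k [Nk [j Bj jk]] km]]].
      by have [Nm _] := um; split => //; exists m => //; exact: hle_refl.
    by split => //; exists j => //; apply: hle_trans jk km => //; exact: BN.
  move=> m m' [Nm [k Bk km]] [Nm' [k' Bk' km']].
  have [e [ie es] kE] := Bk; have [e' [ie' es'] kE'] := Bk'.
  have [Ce _] := ie; have [Ce' _] := ie'.
  have Cee := diag_conv aG hG Ce Ce'.
  have iee : idems conv C (conv e e').
    split => //; apply: diag_ext; [exact: diag_conv|exact: Cee|move=> x xU].
    rewrite !conv_diagl ?unit_rng//; auto.
    have [->|->] := idems_val aG iR ie xU; rewrite ?mul0r// !mul1r.
    by have [->|->] := idems_val aG iR ie' xU; rewrite ?mul0r// !mul1r.
  have Bj : B (conv n (conv e e')).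
    exists (conv e e') => //; split => //.
    by rewrite conv_diagl ?rng_src ?es ?es' ?mul1r//; auto.
  have jE z : conv n (conv e e') z = n z * (e (src z) * e' (src z)).
    by rewrite conv_diagr// conv_diagl ?rng_src//; auto.
  have jk : hle (conv n (conv e e')) k.
    apply/(hnor_hleP aG hG iR (hnor_steinberg (BN _ Bk)) (BN _ Bj)) => z z'.
    rewrite !jE kE conv_diagr// => + zz; rewrite zz.
    have [->|->] := idems_val aG iR ie' (src_src z'); rewrite ?mulr0 ?eqxx//.
    by rewrite mulr1.
  have jk' : hle (conv n (conv e e')) k'.
    apply/(hnor_hleP aG hG iR (hnor_steinberg (BN _ Bk')) (BN _ Bj)) => z z'.
    rewrite !jE kE' conv_diagr// => + zz; rewrite zz.
    have [->|->] := idems_val aG iR ie (src_src z'); rewrite ?mul0r ?mulr0 ?eqxx//.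
    by rewrite mul1r.
  have Nj := BN _ Bj; have Nk := BN _ Bk; have Nk' := BN _ Bk'.
  exists (conv n (conv e e')); last first.
    by split; [exact: hle_trans jk km|exact: hle_trans jk' km'].
  by split => //; exists (conv n (conv e e')) => //; exact: hle_refl.
have [U uU BU] := ultrafilter_extension fB.
have [r _ rU] := Phi_surj uU.
have Br m : B m -> Phi r m.
  by move=> Bm; rewrite rU; apply: BU; split; [exact: BN|exists m => //; exact/hle_refl/BN].
(* Otherwise the product of n with the characteristic function of a neighbourhood of s(s) avoiding
   s(r) would be an element of B, hence of Phi(r), that vanishes at r. *)
have rs : src r = src s.
  apply: contrapT => /(twq_src_eq T) /eqP rs.
  move: hG; rewrite open_hausdorff => /(_ _ _ rs) [[V V'] /= [/set_mem Vr /set_mem Vs]].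
  move=> [oV oV' /eqP VV].
  have [||K [cK [oK _ _ _ _] Ks KV]] := ample_nbhs aG (O := unit_space G `&` V') (a := src (q s)).
  - by apply: openI => //; exact: open_unit_space.
  - by split => //; exact: src_src.
  have KU : K `<=` unit_space G by move=> z /KV [].
  have : Phi r (conv n (indic T K)).
    apply: Br; exists (indic T K) => //; split; first exact: idems_indic.
    by rewrite indic_in ?src_src// twq_src.
  rewrite PhiE// => -[_ + _]; rewrite conv_indicr0//; first by move=> /esym/eqP; rewrite oner_eq0.
  by move=> /KV [_ V'r]; suff : (V `&` V') (src (q r)) by rewrite VV.
have [m Bm] : B !=set0.
  have [_ [m [_ [k Bk _]]] _ _] := fB; by exists k.
have := Br _ Bm; rewrite PhiE// => -[_ mr m0].
have [qs|qs] := pselect (q s = q r); last first.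
  by have := m0 s (esym rs) qs; rewrite Bval// => /eqP; rewrite (negbTE ns).
split.
  (* On this fibre n agrees with m, and m(r) = 1; hence n(s) = t^-1 when s = t.r. *)
  have [t ->] := twq_eqP (esym qs); rewrite (steinberg_eqv An).
  by rewrite -(Bval m r)// mr mulr1 unitrV uval_unit.
move=> s' ns' ss; apply: contrapT; rewrite qs => qs'.
by have := m0 s' (etrans ss (esym rs)) qs'; rewrite Bval// => /eqP; rewrite (negbTE ns').
Qed.

Lemma surj_mono n : N n -> mono n.
Proof.
move=> Nn; have Nd := hnor_dag aG hG Nn; have Ad := hnor_steinberg Nd.
have An := hnor_steinberg Nn; have nm := dagP (hnor_Nor Nn).
have si k : N k -> src_inj T k.
  by move=> Nk u v ku kv uv; apply: (surj_concentrated Nk kv).2.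
split=> //; [exact: si| |by move=> s /(surj_concentrated Nn) []].
move=> u v nu nv uv.
have Cmn := nor_by_diag aG hG Ad (nor_byC An nm).
(* [dag n] is nonzero at some w over u^-1, and then w v is in the support of
   [dag n * n], which consists of units. *)
have [w [wu dw nw]] : exists w, [/\ rng w = src u, dag n w != 0 & n (gdinv w) != 0].
  have [|w [wu dw nw]] := steinberg_conv_neq0 aG Ad An (s := src u).
    by rewrite (nor_by_src aG hG iR An nm nu) oner_neq0.
  move: wu nw; rewrite rng_src => wu.
  have -> : gdinv w ** src u = gdinv w by rewrite -wu -src_inv gdmul_src.
  by exists w.
have e : q (gdinv w) = q u by apply: (si n) => //; rewrite src_inv.
have wv : src w = rng v by rewrite -uv -rng_inv; apply/(twq_rng_eq T); rewrite e.
have : conv (dag n) n (w ** v) != 0.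
  rewrite (conv_mull aG Ad An (si _ Nn) nv wv).
  apply: contra_neq nv => dn; have [wU _] := surj_concentrated Nd dw.
  by apply: (mulrI wU); rewrite mulr0.
move=> /(diag_neq0 Cmn); rewrite twqM// -(gdinvK (q w)) -twq_inv e.
by apply: unitVM; apply/(twq_rng_eq T).
Qed.

End Surjective.

Section Monomial.
Hypothesis Nmono : forall n, N n -> mono n.

Lemma mono_PhiE s : Phi s = [set m | N m /\ m s = 1].
Proof.
rewrite PhiE//; apply/seteqP; split => [m []//|m [Nm ms]]; split => // s' ss qs.
apply/eqP/negPn/negP => ms'; apply: qs; have [_ si _ _] := Nmono Nm.
by apply: si => //; rewrite ms oner_neq0.
Qed.

Lemma Phi_hom_slice O s : open O -> O s -> exists X, [/\ slice T X, X s, X `<=` O,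
  X `<=` deg @^-1` [set deg s] & Phi s (tilde1 X)].
Proof.
move=> oO Os; have [X [sX Xs XO _ Xd]] := exists_homogeneous_slice T aG oO Os.
by exists X; split => //; exact: tilde1_Phi.
Qed.

(** The order asks for agreement on whole source fibres over supp(m). When the source is injective
    on both supports, such a fibre carries a single orbit of nonzero values, and agreement on
    supp(m) is enough. *)
Lemma mono_hleI n m : A n -> N m -> (forall s, m s != 0 -> n s = m s) ->
  (forall s s', n s != 0 -> n s' != 0 -> src s = src s' -> q s = q s') -> hle m n.
Proof.
move=> An Nm h si; apply/(hnor_hleP aG hG iR) => // s s' ms' ss.
have ns' : n s' != 0 by rewrite h.
have Am := hnor_steinberg Nm.
have [qs|qs] := pselect (q s' = q s).
  have [t ->] := twq_eqP qs.
  by rewrite (steinberg_eqv An) (steinberg_eqv Am) h.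
have -> : n s = 0 by apply/eqP/negPn/negP => ns; apply: qs; exact: esym (si _ _ ns ns' ss).
apply/esym/eqP/negPn/negP => ms; apply: qs; have [_ sm _ _] := Nmono Nm.
by apply: sm.
Qed.

Lemma Phi_filter s : is_filter (Phi s).
Proof.
rewrite mono_PhiE; split.
- by move=> m [Nm ms]; split => // m0; move: ms; rewrite m0 => /esym/eqP; rewrite oner_eq0.
- have [X [_ _ _ _ PX]] := Phi_hom_slice openT (I : setT s).
  by exists (tilde1 X); move: PX; rewrite mono_PhiE.
- apply/seteqP; split => [m [Nm ms]|m [Nm [n [Nn ns] nm]]].
    by split => //; exists m => //; exact: hle_refl.
  split => //; move/(hnor_hleP aG hG iR (hnor_steinberg Nm) Nn) : nm => /(_ s s).
  by rewrite ns oner_neq0 => /(_ isT erefl).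
move=> m n [Nm ms] [Nn ns].
(* A slice inside the open set where m and n are both 1 gives a common lower bound. *)
pose O := m @^-1` [set 1] `&` n @^-1` [set 1].
have [||X [sX Xs XO _ PX]] := @Phi_hom_slice O s.
- by apply: openI; apply: locally_constant_open; apply: steinberg_lc; eauto.
- by [].
move: PX; rewrite mono_PhiE => -[NX X1]; exists (tilde1 X) => //.
have le k : N k -> (forall u, X u -> k u = 1) -> hle (tilde1 X) k.
  move=> Nk k1; have [Ak sk _ _] := Nmono Nk; apply: mono_hleI => // u.
  move=> /tilde1_neq0 [t [w [Xw ->]]]; have [_ qi _ _ _] := sX.
  by rewrite tilde1_tact// (steinberg_eqv Ak) k1// mulr1.
by split; apply: le => // u /XO [].
Qed.

(** Suppose a larger filter contains w with w(s) <> 1, and take a slice X through s on which w is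
    never 1. A common lower bound of w and [tilde1 X] agrees with both wherever it is nonzero, say
    at t.v with v in X; this gives t^-1 w(v) = t^-1, so w(v) = 1. *)
Lemma Phi_ultrafilter s : ultrafilters (Phi s).
Proof.
split; first exact: Phi_filter.
move=> W fW PW; apply/seteqP; split => // w Ww.
have [WN _ Wu Wd] := fW; have [Nw _] := WN _ Ww; have Aw := hnor_steinberg Nw.
rewrite mono_PhiE; split => //; apply: contrapT => ws.
pose O := w @^-1` [set~ 1].
have [||X [sX Xs XO _ PX]] := @Phi_hom_slice O s; [|by []|].
  exact: locally_constant_open (steinberg_lc Aw).
have [p Wp [pw pX]] := Wd _ _ Ww (PW _ PX).
have [Np /eqP p0] := WN _ Wp; have Ap := hnor_steinberg Np.
have [u pu] : exists u, p u != 0.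
  apply: contrapT => n; case/eqP: p0; apply/funext => u.
  by apply/eqP/negPn/negP => pu; apply: n; exists u.
have wp := (hnor_hleP aG hG iR Aw Np).1 pw u u pu erefl.
have Xp := (hnor_hleP aG hG iR (steinberg_tilde1 aG hG sX) Np).1 pX u u pu erefl.
have : tilde1 X u != 0 by rewrite Xp.
move=> /tilde1_neq0 [t [v [Xv uE]]]; have [_ qi _ _ _] := sX.
apply: (XO _ Xv) => /=; move: Xp; rewrite -wp uE tilde1_tact// (steinberg_eqv Aw).
rewrite -{1}[_^-1]mulr1 => /(mulrI _) -> //.
by rewrite unitrV uval_unit.
Qed.

Lemma Phi_surjective : set_surj setT ultrafilters Phi.
Proof.
move=> U [fU maxU]; have [UN [n Un] _ _] := fU.
have [Nn _] := UN _ Un; have An := hnor_steinberg Nn.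
have [a na aU] : exists2 a : G, suppG n a & forall m, U m -> suppG m a.
  apply: contrapT => nex.
  (* Without a common point, the complements of the closed supports of the k(a) cover supp(n). A
     lower bound of n and finitely many k(a) is nonzero somewhere, and that point is left
     uncovered. *)
  have /choice [k kp] : forall a : G, exists m, suppG n a -> U m /\ ~ suppG m a.
    move=> a; have [na|] := pselect (suppG n a); last by exists 0.
    apply: contrapT => nm; apply: nex; exists a => // m Um.
    by apply: contrapT => nma; apply: nm; exists m.
  have [|||l lK Kl] := @compact_subcover _ (suppG n) (fun a : G => ~` suppG (k a)).
  - exact: steinberg_compact.
  - move=> a /kp [Uk _]; rewrite openC; have [Nk _] := UN _ Uk.
    have Ak := hnor_steinberg Nk.
    by apply: (closed_suppG aG); [exact: steinberg_lc Ak|exact: steinberg_eqv].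
  - by move=> a /kp [].
  have [|p Up ple] := @filter_lower_bound U n [seq k a | a <- l] fU Un.
    by move=> m /mapP [a /lK /kp [Uk _] ->].
  have [Np /eqP p0] := UN _ Up.
  have [s ps] : exists s, p s != 0.
    apply: contrapT => nps; case/eqP: p0; apply/funext => s.
    by apply/eqP/negPn/negP => ps; apply: nps; exists s.
  have ke m : m \in n :: [seq k a | a <- l] -> N m -> m s != 0.
    move=> ml Nm; have := ple _ ml => /(hnor_hleP aG hG iR (hnor_steinberg Nm) Np).
    by move=> /(_ s s ps erefl) ->.
  have [|a al ks] := Kl (q s).
    by exists s => //=; apply: ke => //; rewrite inE eqxx.
  apply: ks; exists s => //=; have [Uk _] := kp _ (lK _ al).
  by apply: ke; [rewrite inE map_f ?orbT|have [] := UN _ Uk].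
have [s0 /= ns0 qs0] := na.
have [_ _ _ /(_ _ ns0) un] := Nmono Nn.
(* Moving s0 within its orbit by the unit n(s0) makes n equal to 1. *)
pose s := tact (exist _ (n s0) un : RU) s0.
have ns : n s = 1 by rewrite /s (steinberg_eqv An) /= mulVr.
exists s => //; apply: maxU; first exact: Phi_filter.
move=> m Um; rewrite mono_PhiE; have [Nm _] := UN _ Um; split => //.
have [_ _ _ Ud] := fU; have [p Up [pm pn]] := Ud _ _ Um Un.
have [Np _] := UN _ Up; have Ap := hnor_steinberg Np.
have ps : p s != 0 by apply/(suppGP _ (steinberg_eqv Ap)); rewrite /s twq_tact qs0; exact: aU.
rewrite ((hnor_hleP aG hG iR (hnor_steinberg Nm) Np).1 pm s s ps erefl).
by rewrite -((hnor_hleP aG hG iR An Np).1 pn s s ps erefl).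
Qed.

End Monomial.
End Ultrafilters.

(** * Phi as an isomorphism of graded topological groupoids *)

Section Isomorphism.
Context {R : comUnitRingType} {Gamma : groupType} {G Sg : topGroupoidType}.
Variable T : graded_twist R Gamma G Sg.
Hypotheses (aG : ample G) (hG : hausdorff_space G) (iR : indecomposable R).
Local Notation q := (twq T).
Local Notation conv := (conv T).
Local Notation A := (steinberg T).
Local Notation C := (steinberg_diag T).
Local Notation Ag := (steinberg_gr T).
Local Notation tilde1 := (tilde1 T).
Local Notation N := (hnormalisers conv A Ag C).
Local Notation dag := (dagger conv A C).
Local Notation deg := (gdegS T).
Local Notation mono := (mono T).
Local Notation Phi := (Phi T).
Implicit Types (s u v x : Sg) (f g h e n m : Sg -> R^o) (X O : set Sg).
Implicit Types (U W : set (Sg -> R^o)).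
Let Aconv f g (Af : A f) (Ag : A g) : A (conv f g) := steinberg_conv aG hG Af Ag.
Hint Resolve steinberg_lc steinberg_eqv steinberg_compact Aconv diag_steinberg : core.
Hint Resolve hnor_steinberg : core.
Hypothesis Nmono : forall n, N n -> mono n.
Let PhiM := mono_PhiE aG hG iR Nmono.
Let Phi_slice O s (oO : open O) (Os : O s) := @Phi_hom_slice _ _ _ _ T aG hG iR _ _ oO Os.

Lemma Phi_inj s s' : Phi s = Phi s' -> s = s'.
Proof.
move=> ss; apply: (twq_hausdorff_inj T aG hG) => O oO Os.
have [X [[_ qi _ _ _] Xs XO _]] := Phi_slice oO Os.
by rewrite ss PhiM => -[_ X1]; apply: XO; exact: tilde1_eq1 X1.
Qed.

Lemma Phi_conv s s' n m : src s = rng s' -> Phi s n -> Phi s' m ->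
  Phi (s ** s') (conv n m).
Proof.
move=> ss; rewrite !PhiM => -[Nn ns] [Nm ms]; split; first exact: hnor_conv.
have [An _ ri _] := Nmono Nn; have [Am _ _ _] := Nmono Nm.
by rewrite conv_mulr// ns ?ms ?mul1r ?oner_neq0.
Qed.

Lemma Phi_dag s n : Phi s n -> Phi (gdinv s) (dag n).
Proof.
rewrite !PhiM => -[Nn ns]; split; first exact: hnor_dag.
rewrite (mono_dag aG hG iR (Nmono Nn) (hnor_Nor Nn)) ?ns ?oner_neq0//.
by rewrite invr1.
Qed.

Lemma dagK n : N n -> dag (dag n) = n.
Proof.
move=> Nn; have [An _] := hnor_Nor Nn; have nm := dagP (hnor_Nor Nn).
have [Am _ _ _] := nm; apply: dag_eq => //; exact: nor_byC.
Qed.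

(** If the source of s differs from the range of s', disjoint neighbourhoods of them in G give
    slices X and Y containing no composable pair, so the product of [tilde1 X] and [tilde1 Y] is
    0. *)
Lemma Phi_composable s s' : composable s s' <-> uf_composable conv (Phi s) (Phi s').
Proof.
split=> [ss n m Pn Pm nm|h].
  have := Phi_conv ss Pn Pm; rewrite nm PhiM => -[_ /esym/eqP].
  by rewrite oner_eq0.
apply: contrapT => ss.
have /eqP ss' : src (q s) <> rng (q s').
  by move=> e; apply: ss; rewrite /composable -(unit_rng (src_src s));
     apply/(twq_rng_eq T); rewrite twq_src rng_src.
move: hG; rewrite open_hausdorff => /(_ _ _ ss') [[V V'] /= [/set_mem Vs /set_mem Vs']].
move=> [oV oV' /eqP VV].
have [||X [sX _ XV _ PX]] := @Phi_slice (q @^-1` (src @^-1` V)) s; [|by []|].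
  by apply: twq_open_comp; apply: open_comp => // x _; exact: src_continuous.
have [||Y [sY _ YV _ PY]] := @Phi_slice (q @^-1` (rng @^-1` V')) s'; [|by []|].
  by apply: twq_open_comp; apply: open_comp => // x _; exact: rng_continuous.
apply: (h _ _ PX PY); apply/funext => w.
apply: (steinberg_conv_eq0 aG); [exact: steinberg_tilde1..|move=> v vw].
have [->|] := eqVneq (tilde1 X v) 0; first by rewrite mul0r.
move=> /tilde1_neq0 [t [x [Xx ve]]].
have [->|] := eqVneq (tilde1 Y (gdinv v ** w)) 0; first by rewrite mulr0.
move=> /tilde1_neq0 [t' [y [Yy we]]].
suff : (V `&` V') (src (q x)) by rewrite VV.
split; first exact: XV Xx.
have -> : src (q x) = rng (q y); last exact: YV Yy.
by rewrite -!(twq_src, twq_rng) -(src_tact T t) -(rng_tact T t') -ve -we rngVM.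
Qed.

(** To place k from Phi(s s') above a product, take any m in Phi(s') and n = k m^dagger, which is in
    Phi(s) because s = (s s') s'^-1. Then n m = k (m^dagger m) lies below k. *)
Lemma Phi_mul s s' : composable s s' ->
  Phi (s ** s') = uf_mul conv A Ag C (Phi s) (Phi s').
Proof.
move=> ss; apply/seteqP; split => [k Pk|k [Nk [_ [n Pn [m Pm <-]] le]]]; last first.
  have := Phi_conv ss Pn Pm; rewrite !PhiM => -[Nnm nm1]; split => //.
  by rewrite -nm1; apply: (hnor_hleP aG hG iR (hnor_steinberg Nk) Nnm).1 le _ _ _ erefl;
     rewrite nm1 oner_neq0.
have [Y [_ _ _ _ Pm]] := Phi_slice openT (I : setT s').
set m := tilde1 Y in Pm.
have [Nk k1] : N k /\ k (s ** s') = 1 by move: Pk; rewrite PhiM.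
have [Nm m1] : N m /\ m s' = 1 by move: Pm; rewrite PhiM.
have Pn : Phi s (conv k (dag m)).
  have := Phi_conv _ Pk (Phi_dag Pm); rewrite srcM// rng_inv => /(_ erefl).
  by rewrite gdmulKr.
have Nn : N (conv k (dag m)) by move: Pn; rewrite PhiM => -[].
split => //; exists (conv (conv k (dag m)) m); first by exists (conv k (dag m)) => //; exists m.
have Nnm := hnor_conv aG hG Nn Nm.
have Ak := hnor_steinberg Nk; have Am := hnor_steinberg Nm.
have mm := dagP (hnor_Nor Nm); have [Ad _ _ _] := mm; have dm := nor_byC Am mm.
have Ce := nor_by_diag aG hG Ad dm; have ie := nor_by_idem aG hG Ad dm.
have kE z : conv (conv k (dag m)) m z = k z * conv (dag m) m (src z).
  by rewrite -(convA aG hG)// conv_diagr.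
apply/(hnor_hleP aG hG iR Ak Nnm) => u v.
rewrite !kE => + uv; rewrite uv.
have [->|->] := idems_val aG iR ie (src_src v); first by rewrite mulr0 eqxx.
by rewrite !mulr1.
Qed.

Lemma Phi_inv s : Phi (gdinv s) = uf_inv conv A C (Phi s).
Proof.
apply/seteqP; split => [n Pn|_ [n Pn <-]]; last exact: Phi_dag.
have := Phi_dag Pn; rewrite gdinvK => Pd; exists (dag n) => //.
by apply: dagK; move: Pn; rewrite PhiM => -[].
Qed.

(** Under [Phi] the basic open set of n corresponds to the points where n is 1, a set that is open
    by local constancy; slices show that these sets form a basis. *)
Lemma Phi_open O : open O <-> uf_open conv A Ag C (Phi @` O).
Proof.
split=> [oO|[S SN SO]].
  exists [set n | N n /\ forall s, n s = 1 -> O s]; first by move=> n [].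
  apply/seteqP; split => [_ [s Os <-]|U [n [Nn nO] [uU Un]]].
    have [X [[_ qi _ _ _] Xs XO _ PX]] := Phi_slice oO Os.
    have NX : N (tilde1 X) by move: PX; rewrite PhiM => -[].
    exists (tilde1 X).
      by split => // s' X1; apply: XO; exact: tilde1_eq1 X1.
    by split => //; exact: Phi_ultrafilter.
  have [s _ sU] := Phi_surjective aG hG iR Nmono uU.
  exists s => //; apply: nO; move: Un; rewrite -sU PhiM.
  by case.
have -> : O = \bigcup_(n in S) (n @^-1` [set 1]).
  apply/seteqP; split => [s Os|s [n Sn ns]].
    have : (Phi @` O) (Phi s) by exists s.
    by rewrite SO => -[n Sn [_]]; rewrite PhiM => -[_ ns]; exists n.
  have : (Phi @` O) (Phi s).
    rewrite SO; exists n => //; split; first exact: Phi_ultrafilter.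
    by rewrite PhiM; split => //; exact: SN.
  by move=> [s' Os' /Phi_inj <-].
apply: bigcup_open => n Sn; apply: locally_constant_open.
exact: steinberg_lc (hnor_steinberg (SN _ Sn)).
Qed.

Lemma Phi_deg s : uf_deg Ag (Phi s) = deg s.
Proof.
have [X [_ _ _ _ PX]] := Phi_slice openT (I : setT s).
have degE n (g : Gamma) : Phi s n -> Ag g n -> g = deg s.
  rewrite PhiM => -[Nn ns] ng; apply/esym/(gr_deg ng).
  by rewrite ns oner_neq0.
rewrite /uf_deg; apply: xget_unique => [n|g Pg]; last exact: degE PX (Pg _ PX).
move=> Pn; have [[g _ [_ ng]] _] : N n /\ n s = 1 by move: Pn; rewrite PhiM.
by rewrite -(degE n g).
Qed.

Lemma Phi_iso : graded_groupoid_iso conv A Ag C deg Phi.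
Proof.
split; [split|exact: Phi_composable|split|exact: Phi_open|exact: Phi_deg].
- by move=> s _; exact: Phi_ultrafilter.
- by move=> s s' _ _; exact: Phi_inj.
- exact: Phi_surjective.
- exact: Phi_mul.
- exact: Phi_inv.
Qed.

End Isomorphism.

(** * Quasi-Cartan pairs *)

Section CartanPair.
Context {R : comUnitRingType} {Gamma : groupType} {G Sg : topGroupoidType}.
Variable T : graded_twist R Gamma G Sg.
Hypotheses (aG : ample G) (hG : hausdorff_space G) (iR : indecomposable R).
Local Notation q := (twq T).
Local Notation suppG := (suppG T).
Local Notation conv := (conv T).
Local Notation A := (steinberg T).
Local Notation C := (steinberg_diag T).
Local Notation Ag := (steinberg_gr T).
Local Notation tilde1 := (tilde1 T).
Local Notation N := (hnormalisers conv A Ag C).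
Local Notation Nor := (normalisers conv A C).
Local Notation dag := (dagger conv A C).
Local Notation deg := (gdegS T).
Local Notation mono := (mono T).
Implicit Types (s u v x : Sg) (f g h e n m : Sg -> R^o) (X O : set Sg).
Implicit Types (U W : set (Sg -> R^o)).
Let Aconv f g (Af : A f) (Ag : A g) : A (conv f g) := steinberg_conv aG hG Af Ag.
Hint Resolve steinberg_lc steinberg_eqv steinberg_compact Aconv diag_steinberg : core.
Hint Resolve hnor_steinberg : core.
Local Notation Nor1 := (normalisers conv (Ag 1%g) C).

Lemma gr1_conv f g : Ag 1%g f -> Ag 1%g g -> Ag 1%g (conv f g).
Proof. by move=> f1 g1; have := gr_conv aG hG f1 g1; rewrite mulg1. Qed.

Lemma Nor1_Nor n : Nor1 n -> Nor n.
Proof.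
move=> [n1 [m [m1 mnm nmn mn]]]; split; first exact: gr_steinberg n1.
by exists m; split => //; exact: gr_steinberg m1.
Qed.

(** The generalised inverse again has degree 1, so it is available inside the degree 1 component. *)
Lemma Nor_Nor1 n : Nor n -> Ag 1%g n -> Nor1 n.
Proof.
move=> Nn n1; split => //; exists (dag n).
have [_ mnm nmn mn] := dagP Nn; split => //.
by have := dag_gr aG hG Nn n1; rewrite invg1.
Qed.

Lemma Nor1_hnor n : Nor1 n -> N n.
Proof. by move=> Nn; exists 1%g => //; split; [exact: Nor1_Nor|case: Nn]. Qed.

(* If n is nonzero at s and s', choose a slice X through s^-1: then n * tilde1 X
   is nonzero at the unit s s^-1 and at s' s^-1. *)
Lemma mono_of_units :
  (forall n u w, Nor1 n -> src u = u -> n u != 0 -> n w != 0 ->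
    src w = u \/ rng w = u -> q w = q u) ->
  forall n, N n -> mono n.
Proof.
move=> H n Nn; have [a _ [Norn na]] := Nn; have An := hnor_steinberg Nn.
have inv_slice s : n s != 0 -> exists X, [/\ mono (tilde1 X), tilde1 X (gdinv s) = 1 &
    Ag a^-1%g (tilde1 X)].
  move=> ns; have [X [sX Xs _ _ Xd]] :=
    exists_homogeneous_slice T aG openT (I : setT (gdinv s)).
  exists X; split; first exact: mono_tilde1.
    by have [_ qi _ _ _] := sX; exact: tilde1_in.
  by apply: (gr_tilde1 aG hG sX) => u /Xd; rewrite /= gdegV (gr_deg na ns).
apply: (Nor_mono aG hG iR) => // s' s ns' ns ss.
  have [X [mX X1 Xa]] := inv_slice s ns; have [AX si _ _] := mX.
  have X0 : tilde1 X (gdinv s) != 0 by rewrite X1 oner_neq0.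
  have N1 : Nor1 (conv n (tilde1 X)).
    apply: Nor_Nor1; first by apply: Nor_conv => //; exact: mono_Nor.
    by have := gr_conv aG hG na Xa; rewrite mulgV.
  have val u : src u = src s -> conv n (tilde1 X) (u ** gdinv s) = n u.
    by move=> us; rewrite (conv_mull aG An AX si X0) ?rng_inv// X1 mulr1.
  have := H _ (rng s) (s' ** gdinv s) N1 (src_rng s).
  rewrite [X in conv _ _ X != 0](_ : _ = s ** gdinv s)// !val// => /(_ ns ns').
  rewrite srcM ?rng_inv//; last by rewrite /composable rng_inv.
  rewrite src_inv => /(_ (or_introl erefl)).
  rewrite twqM ?rng_inv// twq_inv twq_rng => e.
  apply: unitMV; first by apply/(twq_src_eq T).
  by rewrite e src_rng.
have [X [mX X1 Xa]] := inv_slice s ns; have [AX _ ri _] := mX.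
have X0 : tilde1 X (gdinv s) != 0 by rewrite X1 oner_neq0.
have N1 : Nor1 (conv (tilde1 X) n).
  apply: Nor_Nor1; first by apply: Nor_conv => //; exact: mono_Nor.
  by have := gr_conv aG hG Xa na; rewrite mulVg.
have val u : rng u = rng s -> conv (tilde1 X) n (gdinv s ** u) = n u.
  by move=> us; rewrite (conv_mulr aG AX An ri X0) ?src_inv// X1 mul1r.
have := H _ (src s) (gdinv s ** s') N1 (src_src s).
rewrite [X in conv _ _ X != 0](_ : _ = gdinv s ** s)// !val// => /(_ ns ns').
rewrite rngVM// => /(_ (or_intror erefl)).
rewrite twqM ?src_inv// twq_inv twq_src => e.
apply/esym/unitVM; first by apply/(twq_rng_eq T).
by rewrite e src_src.
Qed.

Lemma steinberg_gr_span a (S : set (Sg -> R^o)) f : Ag a f ->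
  (forall X, slice T X -> X `<=` deg @^-1` [set a] -> S (tilde1 X)) -> linspan S f.
Proof.
move=> fa hS; have [Af _] := fa; apply: (steinberg_span aG hG Af) => _ [s fs <-].
exists (deg @^-1` [set a]); split; first exact: open_gdeg.
  by exists s => //; exact: gr_deg fa fs.
exact: hS.
Qed.

Local Notation unit_restr := (restr T (unit_space G)).

Lemma steinberg_unit_restr f : A f -> A (unit_restr f).
Proof.
by apply: (steinberg_restr aG); [exact: open_unit_space|exact: closed_unit_space].
Qed.

Lemma diag_unit_restr f : A f -> C (unit_restr f).
Proof.
by move=> Af; split; [exact: steinberg_unit_restr|move=> _ [s /= /restr_neq0[? _] <-]].
Qed.

Lemma unit_restr_diag c : C c -> unit_restr c = c.
Proof.
move=> Cc; apply/funext => s; have [su|su] := pselect (unit_space G (q s)).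
  by rewrite restr_in.
by rewrite restr_out//; apply/esym/eqP/negPn/negP => /(diag_neq0 Cc).
Qed.

Lemma unit_restr_linear (r : R) f g : unit_restr (r *: f + g) = r *: unit_restr f + unit_restr g.
Proof.
apply/funext => s; rewrite !fctE.
have [su|su] := pselect (unit_space G (q s)); first by rewrite !restr_in.
by rewrite !restr_out// scaler0 addr0.
Qed.

Section Expectation.
Variable P : (Sg -> R^o) -> (Sg -> R^o).
Hypotheses (condP : cond_expectation conv (Ag 1%g) C P)
  (implP : implemented_by_idempotents conv (Ag 1%g) C P).

(** As a product of [tilde1 X] with an idempotent, P([tilde1 X]) vanishes where [tilde1 X] does; as
    an element of C it vanishes off the units. Let k be the characteristic function of the units in
    q(X). Then k [tilde1 X] k lies in C and is fixed by P, while the bimodule property turns it into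
    k P([tilde1 X]) k, which determines the values over these units. *)
Lemma expectation_tilde1 X : slice T X -> X `<=` deg @^-1` [set 1%g] ->
  P (tilde1 X) = unit_restr (tilde1 X).
Proof.
move=> sX Xd; have mX := mono_tilde1 aG hG sX; have X1 := gr_tilde1 aG hG sX Xd.
have [AX si ri _] := mX; have [oX qi cX _ _] := sX.
have NX := Nor_Nor1 (mono_Nor aG hG mX) X1.
have [PC _ Pid Pmul] := condP; have CP := PC _ X1.
have [e ie [Pe _]] := implP NX; have [Ce _] := ie.
pose K := q @` X `&` unit_space G.
have oK : open K by apply: openI; [exact: twq_open|exact: open_unit_space].
have cK : compact K by apply: compact_closedI => //; exact: closed_unit_space.
have KU : K `<=` unit_space G by move=> a [].
have Ck := diag_indic T aG hG oK cK KU; set k := indic T K in Ck.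
(* A point of the support whose source is in K shares that source with a unit in q(X), hence lies
   over this unit. Cutting by k leaves exactly the values over units. *)
have kXk : conv (conv k (tilde1 X)) k = unit_restr (tilde1 X).
  apply/funext => s; rewrite conv_diagr ?conv_diagl//; last by auto.
  have [Xs|Xs] := eqVneq (tilde1 X s) 0.
    by rewrite Xs mulr0 mul0r /restr; case: pselect.
  have [su|su] := pselect (unit_space G (q s)).
    have Kq : K (q s) by split => //; rewrite -(suppG_tilde1 qi); exists s.
    rewrite restr_in// /k !indic_in ?src_src ?src_rng ?mulr1 ?mul1r//.
      by rewrite twq_src su.
    by rewrite twq_rng unit_rng.
  rewrite restr_out// [X in _ * X]indic_out ?mulr0// twq_src => -[[u Xu qu] _].
  apply: su; have -> : q s = q u; last by rewrite qu; exact: src_src.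
  apply: si => //; first by rewrite tilde1_in ?oner_neq0.
  by apply/(twq_src_eq T); rewrite qu src_src.
have := Pmul _ _ _ X1 Ck Ck; rewrite kXk Pid; last exact: diag_unit_restr.
move=> PE; apply/funext => s.
have [su|su] := pselect (unit_space G (q s)); last first.
  rewrite restr_out//; apply/eqP/negPn/negP => /(diag_neq0 CP) su'.
  exact: su su'.
have [Xs|Xs] := eqVneq (tilde1 X s) 0.
  by rewrite restr_in// Xs Pe conv_diagr// Xs mul0r.
have Kq : K (q s) by split => //; rewrite -(suppG_tilde1 qi); exists s.
rewrite PE conv_diagr ?conv_diagl//; auto.
rewrite /k !indic_in ?src_src ?src_rng ?mulr1 ?mul1r//.
  by rewrite twq_src su.
by rewrite twq_rng unit_rng.
Qed.

Lemma expectationE f : Ag 1%g f -> P f = unit_restr f.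
Proof.
move=> f1; have [PC Plin Pid Pmul] := condP.
have Pf := steinberg_gr_span (S := [set tilde1 X | X in
  [set X | slice T X /\ X `<=` deg @^-1` [set 1%g]]]) f1.
have : linspan [set tilde1 X | X in
    [set X | slice T X /\ X `<=` deg @^-1` [set 1%g]]] f.
  by apply: Pf => X sX Xd; exists X.
move=> {Pf} Sf; suff : (Ag 1%g `&` [set f | P f = unit_restr f]) f by case.
apply: linspan_ind Sf => [|r _ g [X [sX Xd] <-] [g1 /= Pg]].
  by split => /=; [exact: gr0|rewrite Pid ?unit_restr_diag//; exact: diag0].
have X1 := gr_tilde1 aG hG sX Xd.
split => /=; first exact: gr_linear.
by rewrite Plin// unit_restr_linear Pg expectation_tilde1.
Qed.

(** In degree 1 the restriction of n to units equals n e = e n. From n(u) <> 0 follows e(u) = 1, so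
    at any w with source or range u the restriction takes the value n(w); if this is nonzero, w lies
    over a unit, which must be q u. *)
Lemma expectation_mono n : N n -> mono n.
Proof.
move=> Nn; apply: mono_of_units Nn => {}n u w Nn uU nu nw uw.
have [n1 _] := Nn; have [An _] := n1.
have [e ie [Pr Pl]] := implP Nn; have [Ce _] := ie.
rewrite expectationE// in Pr Pl.
have quU : src (q u) = q u by rewrite -twq_src uU.
have eu : e u = 1.
  apply: (idems_neq0 aG iR ie uU); apply: contra_neq nu => eu.
  by have := congr1 (@^~ u) Pr; rewrite /= restr_in// conv_diagr// uU eu mulr0.
have qwU : src (q w) = q w.
  apply: contrapT => nU; case: uw => wu.
    have := congr1 (@^~ w) Pr; rewrite /= restr_out// conv_diagr// wu eu mulr1.
    by move=> /esym/eqP; apply/negP.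
  have := congr1 (@^~ w) Pl; rewrite /= restr_out// conv_diagl// wu eu mul1r.
  by move=> /esym/eqP; apply/negP.
case: uw => wu; first by rewrite -qwU -twq_src wu.
by rewrite -(unit_rng qwU) -twq_rng wu.
Qed.

End Expectation.

Section Cartan.
Hypothesis Nmono : forall n, N n -> mono n.

Lemma submodule_linspan (B S : set (Sg -> R^o)) : submodule B -> S `<=` B ->
  linspan S `<=` B.
Proof.
move=> [B0 Bl] SB; apply: linspan_ind => // r f g Sf Bg.
by apply: Bl => //; exact: SB.
Qed.

Lemma submodule_gr a : submodule (Ag a).
Proof. by split; [exact: gr0|move=> r f g; exact: gr_linear]. Qed.

Lemma algebra_gr1 : algebra conv (Ag 1%g).
Proof.
have [_ _ cA cl cr] := algebra_steinberg T aG hG.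
split; [exact: submodule_gr|exact: gr1_conv|..].
- by move=> f g h [Af _] [Agg _] [Ah _]; exact: cA.
- by move=> t f g h [Af _] [Agg _] [Ah _]; exact: cl.
- by move=> t f g h [Af _] [Agg _] [Ah _]; exact: cr.
Qed.

Lemma steinberg_linspan_gr (S : set (Sg -> R^o)) :
  (forall a X, slice T X -> X `<=` deg @^-1` [set a] -> S (tilde1 X)) ->
  A `<=` linspan S.
Proof.
move=> hS f Af; apply: (steinberg_span aG hG Af) => _ [s _ <-].
exists (deg @^-1` [set deg s]); split; first exact: open_gdeg.
  by exists s.
by move=> X; exact: hS.
Qed.

Lemma graded_algebra_steinberg : graded_algebra conv A Ag.
Proof.
have alg := algebra_steinberg T aG hG; split => //.
- by move=> a; split; [move=> f []|exact: submodule_gr].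
- by move=> a b f g; exact: gr_conv.
- apply/seteqP; split; last first.
    by apply: submodule_linspan; [by case: alg|move=> f [a _ []]].
  apply: steinberg_linspan_gr => a X sX Xd; exists a => //.
  exact: gr_tilde1.
move=> l f ul fl fsum a al; apply/funext => s; apply/eqP/negPn/negP => fs.
have := congr1 (@^~ s) fsum; rewrite (bigD1_seq a)//= fctE.
rewrite [X in _ + X](_ : _ = 0) ?addr0; first by apply/eqP.
rewrite fct_sumE; apply: big1 => b ba; apply/eqP/negPn/negP => fbs; case/eqP: ba.
by rewrite -(gr_deg (fl a) fs) (gr_deg (fl b) fbs).
Qed.

(** The slices can be taken inside the open set of units, where [tilde1] takes only the values 0 and
    1. *)
Lemma diag_span : C `<=` linspan (idems conv C).
Proof.
move=> c Cc; apply: (steinberg_span aG hG (diag_steinberg Cc)) => _ [s cs <-].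
exists (unit_space Sg); split; first exact: (open_twist_unit_space T aG).
  exists (src s); first exact: src_src.
  by rewrite twq_src (diag_neq0 Cc cs).
move=> X sX XU; have [_ qi _ _ _] := sX.
have CX : C (tilde1 X).
  split; first exact: steinberg_tilde1.
  rewrite suppG_tilde1// => _ [x /XU xU <-].
  exact: hom_unit (twq_hom T) _ xU.
apply: (idemsI aG hG CX) => x xU.
have [[u Xu qu]|n] := pselect ((q @` X) (q x)); last by left; exact: tilde1_out.
by right; rewrite -(twq_unit_inj (XU _ Xu) xU qu) tilde1_in.
Qed.

(** If f(s) <> 0, a slice X through s^-1 moves this value to a unit: the product of [tilde1 X] and f
    takes the value f(s) at the source of s. *)
Lemma faithful_unit_restr : faithful conv (Ag 1%g) C unit_restr.
Proof.
move=> f f1 /eqP f0; have [Af _] := f1.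
have [s fs] : exists s, f s != 0.
  apply: contrapT => n; apply: f0; apply/funext => s.
  by apply/eqP/negPn/negP => fs; apply: n; exists s.
have [X [sX Xs _ _ Xd]] := exists_homogeneous_slice T aG openT (I : setT (gdinv s)).
have mX := mono_tilde1 aG hG sX; have [AX _ ri _] := mX; have [_ qi _ _ _] := sX.
have Xs1 := tilde1_in qi Xs.
exists (tilde1 X).
  apply: Nor_Nor1; first exact: mono_Nor.
  by apply: (gr_tilde1 aG hG sX) => u /Xd; rewrite /= gdegV (gr_deg f1 fs) invg1.
apply/eqP => /(congr1 (@^~ (src s))) /=; rewrite restr_in; last first.
  by rewrite /unit_space /= twq_src src_src.
rewrite (_ : src s = gdinv s ** s)// (conv_mulr aG AX Af ri) ?src_inv ?Xs1 ?oner_neq0//.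
by rewrite mul1r; apply/eqP.
Qed.

(** The idempotent is the characteristic function of the units in supp(n). Injectivity of the source
    handles multiplication on the right, injectivity of the range multiplication on the left. *)
Lemma implemented_unit_restr : implemented_by_idempotents conv (Ag 1%g) C unit_restr.
Proof.
move=> n /Nor1_hnor Nn; have [An si ri _] := Nmono Nn.
pose K := suppG n `&` unit_space G.
have oK : open K.
  by apply: openI; [exact: open_suppG (steinberg_lc An)|exact: open_unit_space].
have cK : compact K.
  by apply: compact_closedI; [exact: steinberg_compact|exact: closed_unit_space].
have KU : K `<=` unit_space G by move=> a [].
have Ck := diag_indic T aG hG oK cK KU.
exists (indic T K); first exact: idems_indic.
split.
  apply/funext => s; have [ns|ns] := eqVneq (n s) 0.
    by rewrite conv_diagr// ns mul0r /restr; case: pselect.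
  have [su|su] := pselect (unit_space G (q s)).
    by rewrite restr_in// conv_indicr// su; split => //; exists s.
  rewrite restr_out// conv_indicr0// => -[[u nu qu] _].
  apply: su; have -> : q s = q u; last by rewrite qu; exact: src_src.
  by apply: si => //; apply/(twq_src_eq T); rewrite qu src_src.
apply/funext => s; have [ns|ns] := eqVneq (n s) 0.
  by rewrite conv_diagl// ns mulr0 /restr; case: pselect.
have [su|su] := pselect (unit_space G (q s)).
  by rewrite restr_in// conv_indicl// (unit_rng su); split => //; exists s.
rewrite restr_out// conv_diagl// [indic _ _ _]indic_out ?mul0r// twq_rng => -[[u nu qu] _].
apply: su; have -> : q s = q u; last by rewrite qu; exact: src_rng.
by apply: ri => //; apply/(twq_rng_eq T); rewrite qu rng_rng.
Qed.

Lemma cond_expectation_unit_restr : cond_expectation conv (Ag 1%g) C unit_restr.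
Proof.
split.
- by move=> f [Af _]; exact: diag_unit_restr.
- by move=> r f g _ _; exact: unit_restr_linear.
- exact: unit_restr_diag.
move=> c f d [Af _] Cc Cd; apply/funext => s.
have AP := steinberg_unit_restr Af.
rewrite conv_diagr ?conv_diagl//; last by auto.
have [su|su] := pselect (unit_space G (q s)).
  by rewrite !restr_in// conv_diagr ?conv_diagl//; auto.
by rewrite !restr_out// mulr0 mul0r.
Qed.

Lemma mono_graded_quasi_Cartan_pair : graded_quasi_Cartan_pair conv A Ag C.
Proof.
have [CA sC CM CC] := comm_subalgebra_diag T aG hG.
have comm1 : comm_subalgebra conv (Ag 1%g) C.
  by split => // c Cc; exact: diag_gr.
split; [exact: graded_algebra_steinberg|exact: comm1| |]; last first.
  apply/seteqP; split; last first.
    apply: submodule_linspan; last exact: hnor_steinberg.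
    by have [] := algebra_steinberg T aG hG.
  apply: steinberg_linspan_gr => a X sX Xd.
  exact: mono_hnor (mono_tilde1 aG hG sX) (gr_tilde1 aG hG sX Xd).
split; [exact: algebra_gr1|exact: comm1|split].
- move=> e t ie /eqP e0 te; have [Ce _] := ie.
  have [x [xU ex]] : exists x, src x = x /\ e x != 0.
    apply: contrapT => n; apply: e0; apply: (diag_ext Ce (diag0 T aG)) => x xU.
    by apply/eqP/negPn/negP => ex; apply: n; exists x.
  have := congr1 (@^~ x) te; rewrite /= !fctE (idems_neq0 aG iR ie xU ex).
  by rewrite /GRing.scale/= mulr1.
- by move=> F F1; apply: (local_unit aG hG) => f /F1 [].
- by apply/seteqP; split; [exact: diag_span|apply: submodule_linspan => // e []].
- apply/seteqP; split; last first.
    by apply: submodule_linspan; [exact: submodule_gr|move=> f []].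
  move=> f f1; apply: (steinberg_gr_span f1) => X sX Xd.
  apply: Nor_Nor1; first exact/(mono_Nor aG hG)/mono_tilde1.
  exact: gr_tilde1.
exists unit_restr; split; [exact: cond_expectation_unit_restr|exact: faithful_unit_restr|exact: implemented_unit_restr].
Qed.

End Cartan.
End CartanPair.

(** * The twist in degree one *)

Section DegreeOne.
Context {R : comUnitRingType} {Gamma : groupType} {G Sg : topGroupoidType}.
Variable T : graded_twist R Gamma G Sg.
Hypotheses (aG : ample G) (hG : hausdorff_space G) (iR : indecomposable R).
Local Notation G1 := (gker (gdegG T)).
Local Notation S1 := (gker (gdegS T)).
Local Notation T1 := (gker_twist T).
Local Notation RU := (unit_group R).
Local Notation A := (steinberg T).
Local Notation C := (steinberg_diag T).
Local Notation Ag := (steinberg_gr T).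
Local Notation A1 := (steinberg T1).
Local Notation C1 := (steinberg_diag T1).
Local Notation N := (hnormalisers (conv T) A Ag C).
Local Notation Nor1 := (normalisers (conv T) (Ag 1%g) C).
Local Notation deg := (gdegS T).
Implicit Types (f g : Sg -> R^o) (h k : S1 -> R^o).

Lemma compact_embedding (X Y : topologicalType) (j : X -> Y) (K : set X) :
  embedding j -> compact (j @` K) -> compact K.
Proof.
move=> ej cK F FF FK.
have jF P : F P -> (j @ F) (j @` P).
  by move=> FP; apply: (@filterS _ F _ P) => // x Px; exists x.
have [y [[x Kx <-] clx]] := cK (j @ F) _ (jF _ FK).
exists x; split => // P Q FP /(embedding_nbhs ej) [W jW WQ].
have [_ [[z Pz <-] Wz]] := clx (j @` P) W (jF _ FP) jW.
by exists z; split => //; exact: WQ.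
Qed.

(** [res] and [ext] identify the degree 1 component with the algebra of the twist over G_1, and C
    with its diagonal; normalisers are carried across in both directions. *)
Definition res f : S1 -> R^o := fun s => f (\val s).

Definition ext h : Sg -> R^o := fun s =>
  if pselect ((deg @^-1` [set 1%g]) s) is left p then h (exist _ s (mem_set p)) else 0.

Lemma ext_val h (s : S1) : ext h (\val s) = h s.
Proof.
rewrite /ext; case: pselect => [p|]; last by case; exact: gkerP.
by congr h; exact: val_inj.
Qed.

Lemma ext_neq0 h s : ext h s != 0 -> exists2 s1 : S1, s = \val s1 & h s1 != 0.
Proof.
rewrite /ext; case: pselect => [p hs|_]; last by rewrite eqxx.
by exists (exist _ s (mem_set p)).
Qed.

Lemma extK h : res (ext h) = h.
Proof. by apply/funext => s; rewrite /res ext_val. Qed.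

Lemma resK f : Ag 1%g f -> ext (res f) = f.
Proof.
move=> f1; apply/funext => s; rewrite /ext; case: pselect => [p//|n].
by apply/esym/eqP/negPn/negP => /(gr_deg f1).
Qed.

Lemma val_tact (t : RU) (s : S1) : \val (tact T1 t s) = tact T t (\val s).
Proof.
rewrite /tact val_gdmul /= ?gker_unit_rngU//.
exact: tact_comp.
Qed.

Lemma suppG_res f : suppG T1 (res f) = (\val : G1 -> G) @^-1` suppG T f.
Proof.
apply/seteqP; split => [_ [s fs <-]|a [s fs qs]]; first by exists (\val s).
have ds : deg s = 1%g by rewrite gdegSE qs gkerP.
by exists (exist _ s (mem_set ds)) => //; exact: val_inj.
Qed.

Lemma suppG_ext h : suppG T (ext h) = (\val : G1 -> G) @` suppG T1 h.
Proof.
apply/seteqP; split => [_ [s /ext_neq0 [s1 -> hs] <-]|_ [_ [s /= hs <-] <-]].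
  by exists (twq T1 s1) => //; exists s1.
by exists (\val s) => //=; rewrite ext_val.
Qed.

Lemma suppG_res_image f : Ag 1%g f -> (\val : G1 -> G) @` suppG T1 (res f) = suppG T f.
Proof. by move=> f1; rewrite -suppG_ext resK. Qed.

Lemma equivariant_res f : equivariant T f -> equivariant T1 (res f).
Proof. by move=> ef t s; rewrite /res val_tact. Qed.

Lemma res_steinberg f : Ag 1%g f -> A1 (res f).
Proof.
move=> f1; have [Af _] := f1; split.
- move=> s; have := embedding_continuous (embedding_gker (gdegS T)).
  move=> /(_ s [set u | f u = f (\val s)]); apply.
  exact: (steinberg_lc Af).
- by apply: equivariant_res; exact: steinberg_eqv.
apply: (compact_embedding (embedding_gker (gdegG T))).
by rewrite suppG_res_image//; exact: steinberg_compact.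
Qed.

Lemma ext_steinberg h : A1 h -> Ag 1%g (ext h).
Proof.
move=> Ah; have [lh eh ch] := Ah.
apply: grI => [|s /ext_neq0 [s1 -> _]]; last exact: gkerP.
split.
- move=> s; have [ds|ds] := pselect (deg s = 1%g).
    pose s1 : S1 := exist _ s (mem_set ds).
    have [W nW Wh] := (embedding_nbhs (embedding_gker (gdegS T)) _ _).1 (lh s1).
    have nD : nbhs s (deg @^-1` [set 1%g]).
      by apply: open_nbhs_nbhs; split => //; exact: open_gdeg.
    apply: filterS (filterI nW nD) => u [Wu du].
    pose u1 : S1 := exist _ u (mem_set du).
    by have := Wh u1 Wu; rewrite /= -(ext_val h u1) -(ext_val h s1).
  have nD : nbhs s (deg @^-1` [set~ 1%g]).
    by apply: open_nbhs_nbhs; split => //; exact: open_gdeg.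
  have e0 u : deg u <> 1%g -> ext h u = 0.
    by move=> du; apply/eqP/negPn/negP => /ext_neq0 [u1 uE _]; apply: du; rewrite uE gkerP.
  by apply: filterS nD => u /= du; rewrite !e0.
- move=> t s; have [ds|ds] := pselect (deg s = 1%g).
    pose s1 : S1 := exist _ s (mem_set ds).
    by have := eh t s1; rewrite -!ext_val val_tact.
  have e0 u : deg u <> 1%g -> ext h u = 0.
    by move=> du; apply/eqP/negPn/negP => /ext_neq0 [u1 uE _]; apply: du; rewrite uE gkerP.
  by rewrite !e0 ?mulr0// gdegSE twq_tact -gdegSE.
rewrite suppG_ext; apply: continuous_compact ch; apply: continuous_subspaceT.
exact: embedding_continuous (embedding_gker (gdegG T)).
Qed.

Lemma res_diag f : C f -> C1 (res f).
Proof.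
move=> Cf; split; first exact/res_steinberg/diag_gr.
move=> _ [s /= fs <-]; apply/gker_unitE; exact: (diag_neq0 Cf fs).
Qed.

Lemma ext_diag h : C1 h -> C (ext h).
Proof.
move=> Ch; have [Ah hU] := Ch; split; first by case: (ext_steinberg Ah).
by rewrite suppG_ext => _ [a ha <-]; apply/gker_unitE; exact: hU.
Qed.

(** The support of f lies in degree 1, so both sums run over the same points. *)
Lemma res_conv f g : Ag 1%g f -> Ag 1%g g ->
  res (conv T f g) = conv T1 (res f) (res g).
Proof.
move=> f1 g1; have [Af _] := f1; have [Agg _] := g1; apply/funext => s.
have [ef eg] := (steinberg_eqv Af, steinberg_eqv Agg).
have [ef1 eg1] := (equivariant_res ef, equivariant_res eg).
pose D := suppG T f `&` [set a | rng a = rng (twq T (\val s))].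
pose D1 := suppG T1 (res f) `&` [set a | rng a = rng (twq T1 s)].
rewrite {1}/res (@convE _ _ _ T _ _ _ D)//; last by move=> a [].
rewrite (@convE _ _ _ T1 _ _ _ D1)//; last by move=> a [].
have bD : set_bij D1 D \val.
  split.
  - move=> a [fa ra]; split; first by move: fa; rewrite suppG_res.
    by rewrite /= -val_rng ra val_rng.
  - by move=> a b _ _; exact: val_inj.
  move=> _ [[u fu <-] ra]; have du : deg u = 1%g by exact: gr_deg f1 fu.
  pose u1 : S1 := exist _ u (mem_set du).
  exists (twq T1 u1) => //; split; first by exists u1.
  by apply: val_inj; rewrite !val_rng.
rewrite (reindex_fsbig \val D1 D _ bD); apply: eq_fsbigr => a /set_mem [_ /= ra].
have [u qu] := twq_lift T1 a; subst a.
have us : rng u = rng s by apply/(twq_rng_eq T1).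
rewrite ctermE// (ctermE (u := \val u))//; last by rewrite -!val_rng us.
rewrite /res val_gdmul val_gdinv// /composable src_inv -!val_rng us//.
Qed.

Lemma res_Nor1 n : Nor1 n -> normalisers (conv T1) A1 C1 (res n).
Proof.
move=> [n1 [m [m1 mnm nmn mn]]]; split; first exact: res_steinberg.
have c1 := gr1_conv aG hG; exists (res m); split; first exact: res_steinberg.
- by rewrite -!res_conv ?mnm//; exact: c1.
- by rewrite -!res_conv ?nmn//; exact: c1.
move=> c /ext_diag Cc; have [mcn ncm] := mn _ Cc; have ec1 := diag_gr Cc.
rewrite -(extK c) -!res_conv//; try exact: c1.
by split; exact: res_diag.
Qed.

Lemma ext_Nor1 n : normalisers (conv T1) A1 C1 n -> Nor1 (ext n).
Proof.
move=> [An [m [Am mnm nmn mn]]]; have n1 := ext_steinberg An; split => //.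
have m1 := ext_steinberg Am; have c1 := gr1_conv aG hG; exists (ext m).
have res_inj f g : Ag 1%g f -> Ag 1%g g -> res f = res g -> f = g.
  by move=> f1 g1 /(congr1 ext); rewrite !resK.
have res_diagI f : Ag 1%g f -> C1 (res f) -> C f by move=> f1 /ext_diag; rewrite resK.
split=> //.
- apply: res_inj => //; first by apply: (c1) => //; exact: c1.
  by rewrite !res_conv ?extK//; exact: c1.
- apply: res_inj => //; first by apply: (c1) => //; exact: c1.
  by rewrite !res_conv ?extK//; exact: c1.
move=> c Cc; have [mcn ncm] := mn _ (res_diag Cc); have cc1 := diag_gr Cc.
split; apply: res_diagI; try by apply: (c1) => //; exact: c1.
- by rewrite !res_conv ?extK//; exact: c1.
- by rewrite !res_conv ?extK//; exact: c1.
Qed.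

(** Only the two points u and w of [mono_of_units] have to be compared. Both have degree 1, so they
    pass to the degree 1 twist together with n. *)
Lemma local_bisection_mono : local_bisection_hypothesis T1 ->
  forall n, N n -> mono T n.
Proof.
move=> lbh; apply: (mono_of_units aG hG iR) => n u w Nn uU nu nw uw.
have [n1 _] := Nn; have du := gr_deg n1 nu; have dw := gr_deg n1 nw.
pose u1 : S1 := exist _ u (mem_set du); pose w1 : S1 := exist _ w (mem_set dw).
have [si ri] := open_bisection_inj (lbh _ (res_Nor1 Nn)).
suff : twq T1 w1 = twq T1 u1 by move/(congr1 \val).
case: uw => wu; [apply: si|apply: ri]; rewrite ?inE.
- by exists w1.
- by exists u1.
- by apply/(twq_src_eq T1); apply: val_inj; rewrite !val_src /= wu.
- by exists w1.
- by exists u1.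
- by apply/(twq_rng_eq T1); apply: val_inj; rewrite !val_rng /= wu unit_rng.
Qed.

Lemma mono_local_bisection : (forall n, N n -> mono T n) ->
  local_bisection_hypothesis T1.
Proof.
move=> Nmono n Nn; have Ne := ext_Nor1 Nn; have [e1 _] := Ne.
have [Ae si ri _] := Nmono _ (Nor1_hnor Ne).
have -> : suppG T1 n = (\val : G1 -> G) @^-1` suppG T (ext n).
  by rewrite -suppG_res extK.
apply: open_bisection_gker; apply: inj_open_bisection.
- exact: open_src.
- exact: open_suppG (steinberg_lc Ae).
- move=> _ _ /set_mem [u nu <-] /set_mem [v nv <-] /(twq_src_eq T); exact: si.
- move=> _ _ /set_mem [u nu <-] /set_mem [v nv <-] /(twq_rng_eq T); exact: ri.
Qed.

End DegreeOne.

(** Condition (c) is split into surjectivity of [Phi] and the isomorphism property. The implications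
    form a cycle, each passing through monomiality of the homogeneous normalisers. *)
Theorem theorem7p5 (R : comUnitRingType) (Gamma : groupType)
    (G Sg : topGroupoidType) (T : graded_twist R Gamma G Sg) :
  indecomposable R -> ample G -> hausdorff_space G ->
  let A := steinberg T in
  let Agr := steinberg_gr T in
  let C := steinberg_diag T in
  let Sg_star := ultrafilters (conv T) A Agr C in
  [<-> graded_quasi_Cartan_pair (conv T) A Agr C;
       local_bisection_hypothesis (gker_twist T);
       set_surj setT Sg_star (Phi T);
       graded_groupoid_iso (conv T) A Agr C (gdegS T) (Phi T)].
Proof.
move=> iR aG hG A Agr C Sg_star.
tfae.
- move=> [_ _ [_ _ [_ _ _ _ [P [condP _ implP]]]] _].
  by apply: mono_local_bisection => // n; exact: expectation_mono condP implP n.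
- by move=> /local_bisection_mono Nmono; apply: Phi_surjective => //; exact: Nmono.
- move=> surj; apply: Phi_iso => // n; exact: surj_mono.
- move=> [[_ _ surj] _ _ _ _].
  by apply: mono_graded_quasi_Cartan_pair => // n; exact: surj_mono.
Qed.
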